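(* Let $X$ be a doubling, uniformly perfect, compact metric space. Suppose that $X$ also verifies the following two hypotheses: 1. (Uniform linear connectivity of components) There exists a constant $K_\ell\ge1$ such that every connected component of $X$ is $K_\ell$-linearly connected. 2. (Uniform separation of components) There exists a constant $K_s\ge1$ such that for all $0<r\le\mathrm{diam}\,X$ there exists a covering $\mathcal W_r$ of $X$ by open and closed sets such that for every $W\in\mathcal W_r$ one has $\mathrm{dist}(W,X\setminus W)\ge r/K_s$ and there exists a connected component $Y$ of $X$ with $Y\subset W\subset V_r(Y)$. Then $Q_X=Q_N$. In particular, when $X$ is linearly connected, the critical exponent $Q_X$ is equal to the Ahlfors regular conformal dimension of $X$.
   Context: Metric notions. $B(x,r)$ is the open ball; $V_r(A)=\bigcup_{x\in A}B(x,r)$; $\mathrm{dist}(A,C)=\inf\{d(x,y):x\in A,y\in C\}$ ($+\infty$ if one set is empty). Doubling: there is $K_D\ge1$ such that every ball can be covered by at most $K_D$ balls of half the radius. Uniformly perfect: there is $K_P>1$ with $B(x,r)\setminus B(x,K_P^{-1}r)\ne\emptyset$ for all $x$ and $0<r\le\mathrm{diam}\,X$. A connected metric space $Y$ is $K$-linearly connected if for all $r\in(0,\mathrm{diam}\,Y]$ and all $x,y\in Y$ with $d(x,y)\le r$, $\inf\{\mathrm{diam}\,J:J\subset Y\text{ connected},\,x,y\in J\}\le Kr$ (up to changing the constant, equivalently: any $x,y\in Y$ are joined by a curve of diameter at most $K\,d(x,y)$); it is linearly connected if this holds for some $K\geq 1$. Gauge. A distance $\theta$ on $X$ is Ahlfors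 regular of dimension $q>0$ if there are a Radon measure $\mu$ and $K\ge1$ with $K^{-1}\le\mu(B_r)/r^q\le K$ for every $\theta$-ball of radius $0<r\le\mathrm{diam}_\theta X$. The Ahlfors regular conformal dimension is the infimum of $\dim_H(X,\theta)$ over all Ahlfors regular distances $\theta$ on $X$ for which $\mathrm{id}:(X,d)\to(X,\theta)$ is a quasisymmetric homeomorphism. Coverings. Fix $\kappa>1$, $b>1$, $\lambda\ge32$ and $L\ge2$. For each $k\ge1$, $\mathcal U_k$ is a finite covering of $X$ such that each $B\in\mathcal U_k$ has a chosen center $x_B\in X$ with $B(x_B,\kappa^{-1}b^{-k})\subset B\subset B(x_B,\kappa b^{-k})$, and the balls $B(x_B,\kappa^{-1}b^{-k})$, $B\in\mathcal U_k$, are pairwise disjoint. $\mathcal U=\bigsqcup_k\mathcal U_k$, $|B|=k$ if $B\in\mathcal U_k$, and $\mu\cdot B:=B(x_B,\mu\kappa b^{-k})$. $G_k$ is the graph with vertex set $\mathcal U_k$ and an edge between distinct $B,B'$ whenever $\lambda\cdot B\cap\lambda\cdot B'\ne\emptyset$. Moduli. For a family $\Gamma$ of subsets of a finite set $V$ and $p>0$, $\mathrm{Mod}_p(\Gamma,V)=\inf_\rho\sum_{v\in V}\rho(v)^p$ over all $\rho:V\to[0,\infty)$ with $\sum_{v\in\gamma}\rho(v)\ge1$ for every $\gamma\in\Gamma$ (it is $0$ if $\Gamma=\emptyset$). $Q_N$: for $B\in\mathcal U$, $k\ge1$, let $\Gamma_k(B)$ be the family of vertex sets of paths $\{B_i\}_{i=1}^N$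 of $G_{|B|+k}$ such that the center of $B_1$ belongs to $B$ and the center of $B_N$ belongs to $X\setminus 2\cdot B$. $M_{p,k}=\sup_{B\in\mathcal U}\mathrm{Mod}_p(\Gamma_k(B),\mathcal U_{|B|+k})$ and $Q_N=\inf\{p>0:\liminf_kM_{p,k}=0\}$. $Q_X$: for $B\in\mathcal U$ let $\Gamma(B)$ be the family of curves in $X$ which intersect both the closure $\overline{\ell\cdot B}$ and $X\setminus L\cdot B$, where $\ell=1+b^{-1}$; let $\Delta_k(B)=\{\{A\in\mathcal U_{|B|+k}:A\cap\gamma\ne\emptyset\}:\gamma\in\Gamma(B)\}$, $M^X_{p,k}=\sup_{B\in\mathcal U}\mathrm{Mod}_p(\Delta_k(B),\mathcal U_{|B|+k})$ and $Q_X=\inf\{p>0:\liminf_kM^X_{p,k}=0\}$. *)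

(* Defs.v *)
From HB Require Import structures.
From mathcomp Require Import all_boot all_order all_algebra.
From mathcomp Require Import all_classical all_reals all_analysis.

Set Implicit Arguments.
Unset Strict Implicit.
Unset Printing Implicit Defensive.

Import Order.TTheory GRing.Theory Num.Theory.
Import numFieldNormedType.Exports.

Local Open Scope classical_set_scope.
Local Open Scope ring_scope.

(* Supremum in [0, +oo], so that the supremum of the empty set is 0
   (ereal_sup set0 is -oo). *)
Definition nnsup (R : realType) (S : set (\bar R)) : \bar R :=
  ereal_sup (0%E |` S).

Definition diam (R : realType) (X : metricType R) (A : set X) : \bar R :=
  nnsup [set r | exists x y, [/\ A x, A y & r = (mdist x y)%:E]].

Definition set_dist (R : realType) (X : metricType R) (A C : set X) : \bar R :=
  ereal_inf [set r | exists x y, [/\ A x, C y & r = (mdist x y)%:E]].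

Definition thickening (R : realType) (X : metricType R) (r : R) (A : set X) :
  set X := \bigcup_(x in A) ball x r.

Definition doubling (R : realType) (X : metricType R) : Prop :=
  exists K : nat, (1 <= K)%N /\
    forall (x : X) (r : R), 0 < r -> exists s : seq X,
      (size s <= K)%N /\ ball x r `<=` \bigcup_(y in [set` s]) ball y (r / 2).

Definition uniformly_perfect (R : realType) (X : metricType R) : Prop :=
  exists K : R, 1 < K /\
    forall (x : X) (r : R), 0 < r -> (r%:E <= diam [set: X])%E ->
      ball x r `\` ball x (K^-1 * r) !=set0.

(* For [J `<=` Y], [connected J] in X and in the subspace Y coincide. *)
Definition linearly_connected_with (R : realType) (X : metricType R) (K : R)
    (Y : set X) : Prop :=
  connected Y /\
  forall r : R, 0 < r -> (r%:E <= diam Y)%E ->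
  forall x y : X, Y x -> Y y -> mdist x y <= r ->
    (ereal_inf [set diam J | J in
       [set J : set X | [/\ J `<=` Y, connected J, J x & J y]]]
     <= (K * r)%:E)%E.

Definition linearly_connected (R : realType) (X : metricType R) : Prop :=
  exists K : R, 1 <= K /\ linearly_connected_with K [set: X].

Definition uniformly_linearly_connected_components
    (R : realType) (X : metricType R) : Prop :=
  exists K : R, 1 <= K /\
    forall x : X, linearly_connected_with K (connected_component [set: X] x).

Definition uniformly_separated_components
    (R : realType) (X : metricType R) : Prop :=
  exists K : R, 1 <= K /\
    forall r : R, 0 < r -> (r%:E <= diam [set: X])%E ->
    exists C : set (set X),
      \bigcup_(W in C) W = [set: X] /\
      forall W, C W ->
        [/\ open W, closed W, ((r / K)%:E <= set_dist W (~` W))%E &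
            exists x : X, let Y := connected_component [set: X] x in
              Y `<=` W /\ W `<=` thickening r Y].

Record distance (R : realType) (X : choiceType) := Distance {
  distance_fun :> X -> X -> R ;
  distance_xx : forall x, distance_fun x x = 0 ;
  distance_eq0 : forall x y, distance_fun x y = 0 -> x = y ;
  distance_sym : forall x y, distance_fun x y = distance_fun y x ;
  distance_triangle : forall y x z,
    distance_fun x z <= distance_fun x y + distance_fun y z }.

(* An alias of the carrier X, which receives the metric structure of theta. *)
Definition remetric (R : realType) (X : choiceType) (theta : distance R X) :
  Type := X.

HB.instance Definition _ (R : realType) (X : choiceType)
  (theta : distance R X) := Choice.on (remetric theta).
HB.instance Definition _ (R : realType) (X : choiceType)
  (theta : distance R X) :=
  isMetric.Build R (remetric theta) (distance_xx theta)
    (distance_eq0 (d := theta)) (distance_sym theta) (distance_triangle theta).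

(* [measurableType]s are pointed types: the Borel space of T therefore carries
   a base point, which has no bearing on its measurable sets. *)
Definition based (T : choiceType) (x0 : T) : Type := T.

HB.instance Definition _ (T : choiceType) (x0 : T) := Choice.on (based x0).
HB.instance Definition _ (T : choiceType) (x0 : T) :=
  isPointed.Build (based x0) x0.

Notation borel x0 :=
  (g_sigma_algebraType (open : set (set (based x0)))) (only parsing).

Definition radon (R : realType) (T : topologicalType) (x0 : T)
    (mu : {measure set (borel x0) -> \bar R}) : Prop :=
  (forall x : T, exists U : set T, [/\ open U, U x & (mu U < +oo)%E]) /\
  (forall A : set (borel x0), measurable A ->
    mu A = ereal_sup [set mu K | K in
             [set K : set T | [/\ compact K, closed K & K `<=` A]]]).

Definition ahlfors_regular_of_dim (R : realType) (X : metricType R) (q : R) :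
    Prop :=
  exists (x0 : X) (mu : {measure set (borel x0) -> \bar R}), radon mu /\
  exists K : R, 1 <= K /\
    forall (x : X) (r : R), 0 < r -> (r%:E <= diam [set: X])%E ->
      ((K^-1)%:E <= mu (ball x r) * ((r `^ q)^-1)%:E <= K%:E)%E.

Definition ahlfors_regular (R : realType) (X : metricType R) : Prop :=
  exists q : R, 0 < q /\ ahlfors_regular_of_dim X q.

(* Hausdorff measures, used for s > 0 only, so that diam set0 `^ s = 0. *)
Definition hausdorff_content (R : realType) (X : metricType R) (s delta : R)
    (A : set X) : \bar R :=
  ereal_inf [set (\sum_(0 <= i <oo) poweR (diam (F i)) s)%E | F in
    [set F : nat -> set X | A `<=` \bigcup_i F i /\
                            forall i, (diam (F i) <= delta%:E)%E]].

Definition hausdorff_measure (R : realType) (X : metricType R) (s : R)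
    (A : set X) : \bar R :=
  ereal_sup [set hausdorff_content s delta A | delta in
    [set delta : R | 0 < delta]].

Definition hausdorff_dim (R : realType) (X : metricType R) (A : set X) :
    \bar R :=
  ereal_inf [set s%:E | s in
    [set s : R | 0 < s /\ hausdorff_measure s A = 0%E]].

Definition homeomorphism (T S : topologicalType) (f : T -> S) : Prop :=
  continuous f /\
  exists g : S -> T, [/\ cancel f g, cancel g f & continuous g].

Definition quasisymmetric (R : realType) (X Y : metricType R) (f : X -> Y) :
    Prop :=
  homeomorphism f /\
  exists eta : R -> R,
    (* eta is an increasing homeomorphism of [0, +oo[; the continuity of the
       inverse is automatic *)
    [/\ set_bij `[0, +oo[ `[0, +oo[ eta,
        {in `[0, +oo[ &, {homo eta : s t / s < t}},
        {within `[0, +oo[, continuous eta} &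
        forall x a b : X, x <> b ->
          mdist (f x) (f a) / mdist (f x) (f b)
          <= eta (mdist x a / mdist x b)].

Definition ahlfors_regular_conformal_dim (R : realType) (X : metricType R) :
    \bar R :=
  ereal_inf [set hausdorff_dim [set: remetric theta] | theta in
    [set theta : distance R X |
      ahlfors_regular (remetric theta) /\
      @quasisymmetric R X (remetric theta) idfun]].

(* [cells U k] indexes the elements of the covering at level [k], faithfully by
   [cell_inj]; level 0 is unconstrained and never used. *)
Record coverings (R : realType) (X : metricType R) (kappa b : R) := Coverings {
  cells : nat -> finType ;
  cell : forall k, cells k -> set X ;
  cell_center : forall k, cells k -> X ;
  cell_inj : forall k, (0 < k)%N -> injective (@cell k) ;
  cell_cover : forall k, (0 < k)%N -> \bigcup_(B : cells k) cell B = [set: X] ;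
  cell_inner : forall k, (0 < k)%N -> forall B : cells k,
    ball (cell_center B) (kappa^-1 * b ^- k) `<=` cell B ;
  cell_outer : forall k, (0 < k)%N -> forall B : cells k,
    cell B `<=` ball (cell_center B) (kappa * b ^- k) ;
  cell_disjoint : forall k, (0 < k)%N ->
    trivIset [set: cells k] (fun B => ball (cell_center B) (kappa^-1 * b ^- k)) }.

Definition dilate (R : realType) (X : metricType R) (kappa b : R)
    (U : coverings X kappa b) (mu : R) (k : nat) (B : cells U k) : set X :=
  ball (cell_center B) (mu * kappa * b ^- k).

Definition nerve_edge (R : realType) (X : metricType R) (kappa b : R)
    (U : coverings X kappa b) (lambda : R) (k : nat) : rel (cells U k) :=
  fun B B' => (B != B') && `[< dilate lambda B `&` dilate lambda B' !=set0 >].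

Definition modulus (R : realType) (V : finType) (p : R)
    (Gamma : set {set V}) : \bar R :=
  ereal_inf [set (\sum_(v : V) rho v `^ p)%:E | rho in
    [set rho : V -> R | (forall v, 0 <= rho v) /\
       forall gamma : {set V}, Gamma gamma ->
         1 <= \sum_(v in gamma) rho v]].

Definition path_family (R : realType) (X : metricType R) (kappa b : R)
    (U : coverings X kappa b) (lambda : R) (n : nat) (B : cells U n) (k : nat) :
    set {set cells U (n + k)} :=
  [set gamma | exists (B1 : cells U (n + k)) (s : seq (cells U (n + k))),
    [/\ path (@nerve_edge R X kappa b U lambda (n + k)%N) B1 s,
        cell B (cell_center B1),
        ~ dilate 2 B (cell_center (last B1 s)) &
        gamma =i B1 :: s]].
Arguments path_family {R X kappa b U} lambda {n} B k.

Definition curve_family (R : realType) (X : metricType R) (kappa b : R)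
    (U : coverings X kappa b) (L : R) (n : nat) (B : cells U n) :
    set (set X) :=
  [set c @` `[0, 1]%classic | c in
    [set c : R -> X | {within `[0, 1], continuous c} /\
      exists s t, [/\ s \in `[0, 1], t \in `[0, 1],
        closure (dilate (1 + b^-1) B) (c s) & ~ dilate L B (c t)]]].

Definition curve_cells_family (R : realType) (X : metricType R) (kappa b : R)
    (U : coverings X kappa b) (L : R) (n : nat) (B : cells U n) (k : nat) :
    set {set cells U (n + k)} :=
  [set delta | exists2 gamma, curve_family L B gamma &
    forall A : cells U (n + k), A \in delta <-> cell A `&` gamma !=set0].
Arguments curve_cells_family {R X kappa b U} L {n} B k.

Definition sup_modulus_paths (R : realType) (X : metricType R) (kappa b : R)
    (U : coverings X kappa b) (lambda p : R) (k : nat) : \bar R :=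
  nnsup [set m | exists (n : nat) (B : cells U n),
    (0 < n)%N /\ m = modulus p (path_family lambda B k)].

Definition sup_modulus_curves (R : realType) (X : metricType R) (kappa b : R)
    (U : coverings X kappa b) (L p : R) (k : nat) : \bar R :=
  nnsup [set m | exists (n : nat) (B : cells U n),
    (0 < n)%N /\ m = modulus p (curve_cells_family L B k)].

Definition Q_N (R : realType) (X : metricType R) (kappa b : R)
    (U : coverings X kappa b) (lambda : R) : \bar R :=
  ereal_inf [set p%:E | p in
    [set p : R | 0 < p /\ limn_einf (sup_modulus_paths U lambda p) = 0%E]].

Definition Q_X (R : realType) (X : metricType R) (kappa b : R)
    (U : coverings X kappa b) (L : R) : \bar R :=
  ereal_inf [set p%:E | p in
    [set p : R | 0 < p /\ limn_einf (sup_modulus_curves U L p) = 0%E]].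

(* Main.v *)
(* A curve leaving a neighbourhood of [B] passes through a path of cells, so that
   [Q_X <= Q_N] needs no connectivity.  Conversely, at a scale comparable to the
   mesh, a path of cells with bounded jumps stays in one of the separated clopen
   sets, hence close to a single component [Y], and linear connectivity of [Y]
   shadows the path by a curve: weights admissible for curves, smeared over
   neighbouring cells, are admissible for paths.

   If [theta] is Ahlfors [q]-regular and quasisymmetric to the original distance,
   the weights [diam_theta A / diam_theta B] are admissible up to a constant and
   their [s]-masses tend to 0 for [s > q], which gives [Q_N <= q]; moreover
   [q <= dim_H] by the mass distribution principle.

   If the moduli of curves at exponent [p] tend to 0, there is a step [k] for
   which weights [rho_B] on the cells [k] levels below [B], admissible for paths
   crossing [B] with large jumps, satisfy [sum rho_B^p <= 1/2].  Distribute a mass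
   [mu] down the levels, [B] giving at least [mu B * rho_B(A)^p] to its
   descendant [A] and the other half of its mass being used to keep [mu] doubling.
   With [h = mu^(1/p)], a chain of fine cells crossing [B] costs at least [h B],
   so chains can be coarsened one level at a time, and the infimum [theta] of the
   costs of chains is comparable to [h] at the scale of each cell.  Hence [theta]
   is quasisymmetric to the original distance, and the limit of the masses is
   Ahlfors [p]-regular for [theta]. *)

Require Import Defs.
From HB Require Import structures.
From mathcomp Require Import all_boot all_order all_algebra.
From mathcomp Require Import all_classical all_reals all_analysis.
From mathcomp Require Import lra.

Set Implicit Arguments.
Unset Strict Implicit.
Unset Printing Implicit Defensive.

Import Order.TTheory GRing.Theory Num.Theory.
Import numFieldNormedType.Exports.

Local Open Scope classical_set_scope.
Local Open Scope ring_scope.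

(** * Chains and curves *)

(** The order of the constants shapes the second half. A chain measured by [theta] jumps by a
    multiple [C0] of the radii, and [C0] must be large enough for one cell of level 0 to see all of
    X, so it depends on the diameter; the edges of [nerve_edge] are fixed by [lambda]. This is why
    [discrete_weights] starts from curves and allows any jump [Lam]: [C0] is chosen first, the step
    between levels last. Cells of successive levels are not nested, so the masses do not live on a
    tree. Each is the image of the previous one under a Markov kernel, whose floor keeps the
    doubling constant from growing with the level; the limit measure is the law of the limit of the
    random cells, realised on [0, 1[ with Lebesgue measure. Quasisymmetry also needs the masses to
    decay geometrically; this is read off the limit measure, whose balls uniform perfectness splits
    into disjoint parts. Exponents [p < 1] are allowed, so sums of powers are handled by counting,
    not by convexity. *)

Ltac pos := by repeat first [ assumption | done | apply: mulr_gt0 |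
  apply: addr_gt0 | rewrite invr_gt0 | apply: powR_gt0 | apply: exprn_gt0 ].

(* The context is dropped because its size dominates the cost of [lra]. *)
Ltac glra := clear; intros; lra.

Section MetricTools.
Context {R : realType} {X : metricType R}.
Implicit Types (x y z : X) (r s : R).

Lemma mball_open x r : open (ball x r).
Proof.
rewrite openE => z; rewrite ballEmdist /= => xz.
apply/nbhs_ballP; exists (r - mdist x z) => /=; first by rewrite subr_gt0.
move=> w; rewrite !ballEmdist /= => zw.
by have := metric_triangle x z w; lra.
Qed.

Lemma iterated_doubling : doubling X -> exists K : nat,
  forall m (x : X) r, 0 < r -> exists s : seq X,
    (size s <= K ^ m)%N /\
    ball x r `<=` \bigcup_(y in [set` s]) ball y (r / 2 ^+ m).
Proof.
case=> K [_ HK]; exists K; elim=> [|m IH] x r r0.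
  exists [:: x]; split => // z xz; exists x; first by rewrite /= inE.
  by rewrite expr0 divr1.
have [s [ss Hs]] := IH x r r0.
have rm0 : 0 < r / 2 ^+ m by rewrite divr_gt0// exprn_gt0.
have /choice [t Ht] : forall y, exists t : seq X, (size t <= K)%N /\
  ball y (r / 2 ^+ m) `<=` \bigcup_(z in [set` t]) ball z (r / 2 ^+ m / 2).
  by move=> y; exact: HK.
exists (flatten [seq t y | y <- s]); split.
  rewrite size_flatten /shape -map_comp expnSr.
  apply: leq_trans (leq_mul ss (leqnn K)).
  elim: (s) => //= y s' IHs; rewrite mulSn leq_add//.
  exact: (Ht y).1.
move=> z /Hs[y /= ys] /((Ht y).2)[w /= wt zw]; exists w => /=.
  by apply/flattenP; exists (t y) => //; apply/mapP; exists y.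
by rewrite exprSr invfM mulrA.
Qed.

(** A ball of radius [Q1 * s] is covered by [K ^ m] balls of radius at most [s / 2], and such a ball
    contains at most one point of an [s]-separated family. *)
Lemma doubling_packing : doubling X -> forall Q : R, exists N : nat,
  (0 < N)%N /\ forall (I : finType) (c : I -> X) x s r, 0 < s -> r <= Q * s ->
    (forall i j, i != j -> s <= mdist (c i) (c j)) ->
    (#|[pred i | mdist x (c i) <= r]%R| <= N)%N.
Proof.
move=> /iterated_doubling[K HK] Q.
pose Q1 := Num.max Q 0 + 1.
have Q10 : 0 < Q1 by rewrite ltr_wpDl// le_max lexx orbT.
have [m Hm] : exists m : nat, Q1 <= 2 ^+ m / 2.
  exists (Num.truncn (2 * Q1)).+1.
  have : 2 * Q1 < (Num.truncn (2 * Q1)).+1%:R by rewrite truncnS_gt.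
  have : ((Num.truncn (2 * Q1)).+1%:R : R) <= 2 ^+ (Num.truncn (2 * Q1)).+1.
    by rewrite -natrX ler_nat ltnW// ltn_expl.
  lra.
exists (K ^ m).+1; split => // I c x s r s0 rQ sep.
have Q1s : 0 < Q1 * s by rewrite mulr_gt0.
have [t [st Ht]] := HK m x (Q1 * s) Q1s.
apply: leq_trans (leqnSn _); apply: leq_trans st.
have small : Q1 * s / 2 ^+ m <= s / 2.
  rewrite ler_pdivrMr ?exprn_gt0//.
  have : s * Q1 <= s * (2 ^+ m / 2) by rewrite ler_pM2l.
  lra.
have /choice [f Hf] : forall i : I, exists y, mdist x (c i) <= r ->
    y \in t /\ ball y (Q1 * s / 2 ^+ m) (c i).
  move=> i; case: (leP (mdist x (c i)) r) => [xr|_]; last by exists x.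
  have /Ht[y yt yc] : ball x (Q1 * s) (c i).
    rewrite ballEmdist /=; apply: le_lt_trans xr _; apply: le_lt_trans rQ _.
    rewrite ltr_pM2r// /Q1; apply: le_lt_trans (_ : Num.max Q 0 < _).
      by rewrite le_max lexx.
    by rewrite ltrDl.
  by exists y.
rewrite cardE -(size_map f); apply: uniq_leq_size.
  rewrite map_inj_in_uniq ?enum_uniq// => i j.
  rewrite !mem_enum !inE => /Hf[_ yi] /Hf[_ yj] fij; apply/eqP.
  apply/negPn/negP => /sep; move: yi yj; rewrite fij !ballEmdist /= => yi yj.
  have := metric_triangle (c i) (f j) (c j); rewrite (metric_sym (c i) (f j)).
  lra.
by move=> y /mapP[i]; rewrite mem_enum inE => /Hf[]? _ ->.
Qed.

(** Any cluster point will do: the whole tail from [i] on stays within [2 * e i] of [u i], hence so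
    does the cluster point. *)
Lemma compact_geometric_limit (u : nat -> X) (e : nat -> R) :
  compact [set: X] -> (forall i, mdist (u i) (u i.+1) <= e i) ->
  (forall i, e i.+1 <= e i / 2) ->
  exists l, forall i, mdist (u i) l <= 2 * e i.
Proof.
move=> Xc ue eh.
have e0 i : 0 <= e i by exact: le_trans (mdist_ge0 _ _) (ue i).
have uu n : forall i, mdist (u i) (u (i + n)%N) <= 2 * e i.
  elim: n => [|n IH] i; first by rewrite addn0 mdistxx mulr_ge0.
  have := metric_triangle (u i) (u i.+1) (u (i + n.+1)%N).
  have := IH i.+1; rewrite addSnnS; have := ue i; have := eh i; lra.
have [l [_ ul]] := Xc (u @ \oo) _ filterT.
exists l => i; apply/ler_addgt0Pl => d d0.
have ui : (u @ \oo) [set x | mdist (u i) x <= 2 * e i].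
  by exists i => // n /= le_in; rewrite -(subnKC le_in); exact: uu.
have [z [/= uz]] := ul _ (ball l d) ui (nbhsx_ballx l d d0).
rewrite ballEmdist /= => lz.
have := metric_triangle (u i) z l; rewrite (metric_sym z); lra.
Qed.

(* The set of endpoints of s-chains from x is relatively clopen. *)
Lemma connected_chain (J : set X) s x y : connected J -> 0 < s -> J x -> J y ->
  exists N (w : nat -> X), [/\ w 0%N = x, w N = y, forall i, J (w i) &
    forall i, (i < N)%N -> mdist (w i) (w i.+1) <= s].
Proof.
move=> Jc s0 Jx Jy.
pose C := [set z | exists N (w : nat -> X), [/\ w 0%N = x, w N = z,
    forall i, J (w i) &
    forall i, (i < N)%N -> mdist (w i) (w i.+1) <= s]].
have Cx : C x by exists 0%N, (fun=> x).
have CJ z : C z -> J z by move=> [N [w [_ <- ]]].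
have Cext z z' : C z -> J z' -> mdist z z' <= s -> C z'.
  move=> [N [w [w0 wN Jw ws]]] Jz' zz'.
  exists N.+1, (fun i => if (i <= N)%N then w i else z'); split => //.
  - by rewrite ltnn.
  - by move=> i; case: ifP.
  - move=> i; rewrite ltnS => iN; rewrite iN.
    by case: ltngtP iN => // [iN _|-> _]; [exact: ws|rewrite wN].
have oballs (Q : set X) : open (\bigcup_(z in Q) ball z s).
  by apply: bigcup_open => z _; exact: mball_open.
suff E : C = J by have : C y by rewrite E.
apply: Jc; first by exists x.
- exists (\bigcup_(z in C) ball z s) => //; apply/seteqP; split => [z Cz|z].
    by split; [exact: CJ|exists z => //; exact: ballxx].
  move=> [Jz [z' Cz']]; rewrite ballEmdist /= => zz'.
  by apply: (Cext _ _ Cz' Jz); exact: ltW.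
- exists (~` \bigcup_(z in J `\` C) ball z s); first exact: open_closedC.
  apply/seteqP; split => [z Cz|z [Jz nz]].
    split; first exact: CJ.
    move=> [z' [Jz' nC]]; rewrite ballEmdist /= metric_sym => zz'.
    by apply: nC; apply: (Cext _ _ Cz Jz'); exact: ltW.
  apply: contrapT => nCz; apply: nz; exists z => //; exact: ballxx.
Qed.
End MetricTools.

(** * Curves that shadow chains *)

Section Curves.
Context {R : realType} {X : metricType R}.

(** Linear connectivity in the form that is used: a witness [J] in place of an infimum of extended
    diameters, with only distances from [x] controlled. *)
Definition chain_connected (K : R) (Y : set X) := forall x y, Y x -> Y y ->
  exists J : set X, [/\ J `<=` Y, connected J, J x, J y &
    forall z, J z -> mdist x z <= K * mdist x y].

Lemma diam_ge (A : set X) x y : A x -> A y -> ((mdist x y)%:E <= diam A)%E.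
Proof. by move=> Ax Ay; apply: ereal_sup_ubound; right; exists x, y. Qed.

(** The infimum need not be attained; adding 1 to the constant buys a set [J]. Equal endpoints are
    treated apart because the scale [r] has to be positive. *)
Lemma linearly_connected_chain_connected (K : R) (Y : set X) : 1 <= K ->
  linearly_connected_with K Y -> chain_connected (K + 1) Y.
Proof.
move=> K1 [_ HY] x y Yx Yy; have [->|xy] := eqVneq x y.
  exists [set y]; split => //; first by move=> z ->.
    exact: connected1.
  by move=> z /= ->; rewrite mdistxx mulr0.
have r0 : 0 < mdist x y by rewrite mdist_gt0.
have := HY _ r0 (diam_ge Yx Yy) x y Yx Yy (lexx _).
move=> /le_lt_trans Hinf.
have /Hinf/ereal_inf_lt[_ [J [JY Jc Jx Jy] <-] Jd] :
  ((K * mdist x y)%:E < ((K + 1) * mdist x y)%:E)%E by rewrite lte_fin; lra.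
exists J; split => // z Jz; rewrite -lee_fin; apply: le_trans (ltW Jd).
exact: diam_ge.
Qed.

(** All steps are cut into the same number [M] of pieces, short subchains waiting at their end
    point, so that point [i] of the refined chain belongs to step [i %/ M]. Refinements thus share
    one time parameter, and their limit is a curve. *)
Lemma chain_refine (K : R) (Y : set X) (N : nat) (w : nat -> X) s t :
  0 <= K -> chain_connected K Y -> (0 < N)%N -> 0 < t -> (forall i, Y (w i)) ->
  (forall i, (i < N)%N -> mdist (w i) (w i.+1) <= s) ->
  exists M w', [/\ (0 < M)%N, forall i, Y (w' i),
    forall i, (i < N * M)%N -> mdist (w' i) (w' i.+1) <= t &
    forall i, (i <= N * M)%N -> mdist (w (i %/ M)%N) (w' i) <= K * s].
Proof.
move=> K0 HY N0 t0 Yw ws.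
have /choice[c Hc] : forall i, exists nu : nat * (nat -> X),
    [/\ nu.2 0%N = w i, nu.2 nu.1 = w i.+1, forall j, Y (nu.2 j),
      forall j, (j < nu.1)%N -> mdist (nu.2 j) (nu.2 j.+1) <= t &
      forall j, mdist (w i) (nu.2 j) <= K * mdist (w i) (w i.+1)].
  move=> i; have [J [JY Jc Ji Ji1 Jd]] := HY _ _ (Yw i) (Yw i.+1).
  have [n [u [u0 un uJ ut]]] := connected_chain Jc t0 Ji Ji1.
  by exists (n, u); split => //= j; [exact: JY|exact: Jd].
(* The extra 1 guarantees that every subchain has arrived at the index [M - 1] modulo [M]. *)
pose M := (\max_(i < N) (c i).1).+1.
have cM i : (i < N)%N -> ((c i).1 < M)%N.
  by move=> iN; rewrite ltnS; exact: (leq_bigmax (Ordinal iN)).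
pose w' k := if (k < N * M)%N then
  (c (k %/ M)%N).2 (minn (k %% M) (c (k %/ M)%N).1) else w N.
have w'M q : (q <= N)%N -> w' (q * M)%N = w q.
  rewrite /w' ltn_mul2r /= leq_eqVlt => /orP[/eqP ->|qN]; first by rewrite ltnn.
  by rewrite qN mulnK// modnMl min0n; case: (Hc q).
exists M, w'; split => //.
- by move=> i; rewrite /w'; case: ifP => // _; case: (Hc (i %/ M)%N).
- move=> i iNM; have qN : (i %/ M < N)%N by rewrite ltn_divLR.
  have [u0 un _ ut _] := Hc (i %/ M)%N.
  have iE := divn_eq i M; have mM : (i %% M < M)%N by rewrite ltn_mod.
  move: mM; rewrite leq_eqVlt => /orP[/eqP mM|mM].
    have -> : i.+1 = ((i %/ M).+1 * M)%N by rewrite {1}iE -addnS mM mulSn addnC.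
    rewrite w'M// /w' iNM (minn_idPr _); last first.
      by rewrite -ltnS mM; exact: cM.
    by rewrite un mdistxx ltW.
  have qE : (i.+1 %/ M)%N = (i %/ M)%N.
    by rewrite {1}iE -addnS divnMDl// (divn_small mM) addn0.
  have mE : (i.+1 %% M)%N = (i %% M).+1.
    by rewrite {1}iE -addnS modnMDl modn_small.
  have i1NM : (i.+1 < N * M)%N by rewrite -ltn_divLR// qE.
  rewrite /w' iNM i1NM qE mE.
  case: (ltnP (i %% M) (c (i %/ M)%N).1) => h.
    by rewrite (minn_idPl h); exact: ut.
  by rewrite (minn_idPr _) ?mdistxx ?(ltW t0)// ltnW.
- move=> i; rewrite leq_eqVlt => /orP[/eqP ->|iNM].
    rewrite mulnK// w'M// mdistxx.
    rewrite mulr_ge0//; exact: le_trans (mdist_ge0 _ _) (ws 0%N N0).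
  have qN : (i %/ M < N)%N by rewrite ltn_divLR.
  rewrite /w' iNM; have [_ _ _ _ ud] := Hc (i %/ M)%N.
  apply: le_trans (ud _) _; apply: ler_wpM2l => //; exact: ws.
Qed.

(** This makes time compatible with refinement: the index read in a refined chain lies over the
    index read in the chain at the same time. *)
Lemma truncn_mulr_divn (x : R) (M : nat) : 0 <= x -> (0 < M)%N ->
  (Num.truncn (x * M%:R) %/ M)%N = Num.truncn x.
Proof.
move=> x0 M0; set n := Num.truncn _.
have xM0 : 0 <= x * M%:R by rewrite mulr_ge0.
have MR0 : 0 < M%:R :> R by rewrite ltr0n.
have /andP[nx xn] := truncn_itv xM0.
apply/esym/truncn_def; apply/andP; split.
  rewrite -(ler_pM2r MR0) -natrM; apply: le_trans nx.
  by rewrite ler_nat; exact: leq_divM.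
rewrite -(ltr_pM2r MR0) -natrM; apply: lt_le_trans xn _.
by rewrite ler_nat; exact: ltn_ceil.
Qed.

Lemma truncn_near (x y : R) : `|x - y| < 1 ->
  (Num.truncn x <= (Num.truncn y).+1)%N.
Proof.
move=> xy.
have [x1|x1] := leP 1 x; last first.
  by rewrite (_ : Num.truncn x = 0%N)//; apply/truncn0Pn; rewrite -ltNge.
have /andP[xn _] := truncn_itv (le_trans ler01 x1).
rewrite -ltnS -(ltr_nat R); apply: le_lt_trans xn _.
have := truncnS_gt y; rewrite -[X in _ -> _ < X]natr1.
by move: xy; rewrite ltr_norml => /andP[_]; lra.
Qed.

(** The chain is refined repeatedly, with steps [s / 2 ^+ j], and [c t] is the limit of the points
    read at time [t]. Two times closer than the inverse length of the [j]-th chain read equal or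
    consecutive points of it, which gives continuity. *)
Lemma curve_near_chain (K : R) (Y : set X) (N : nat) (w : nat -> X) s :
  compact [set: X] -> 0 <= K -> chain_connected K Y -> (0 < N)%N -> 0 < s ->
  (forall i, Y (w i)) ->
  (forall i, (i < N)%N -> mdist (w i) (w i.+1) <= s) ->
  exists c : R -> X, {within `[0, 1], continuous c} /\
    forall t : R, 0 <= t <= 1 ->
      mdist (w (Num.truncn (t * N%:R))) (c t) <= 2 * (K * s).
Proof.
move=> Xc K0 HY N0 s0 Yw ws.
pose sg (j : nat) : R := s / 2 ^+ j.
have sg0 j : 0 < sg j by rewrite divr_gt0// exprn_gt0.
have sgS j : sg j.+1 = sg j / 2 by rewrite /sg exprSr invfM mulrA.
pose good j (S : nat * (nat -> X)) := [/\ (0 < S.1)%N, forall i, Y (S.2 i) &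
  forall i, (i < S.1)%N -> mdist (S.2 i) (S.2 i.+1) <= sg j].
have /choice[f Hf] : forall jS : nat * (nat * (nat -> X)),
    exists S' : nat * (nat * (nat -> X)), good jS.1 jS.2 ->
    [/\ (0 < S'.1)%N, S'.2.1 = (jS.2.1 * S'.1)%N, good jS.1.+1 S'.2 &
      forall i, (i <= jS.2.1 * S'.1)%N ->
        mdist (jS.2.2 (i %/ S'.1)%N) (S'.2.2 i) <= K * sg jS.1].
  move=> [j [N1 w1]] /=.
  have [[N10 Yw1 ws1]|] := pselect (good j (N1, w1)); last first.
    by move=> ngood; exists (0%N, (N1, w1)).
  have [M [w' [M0 Yw' ws' ww']]] :=
    chain_refine K0 HY N10 (sg0 j.+1) Yw1 ws1.
  exists (M, ((N1 * M)%N, w')) => _; split => //=.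
  by split => //=; rewrite muln_gt0 N10.
pose S := fix S j := if j is j'.+1 then (f (j', S j')).2 else (N, w).
have Sgood j : good j (S j).
  elim: j => [|j IH]; first by split => //=; rewrite /sg expr0 divr1.
  by case: (Hf (j, S j) IH).
pose M j := (f (j, S j)).1.
have M0 j : (0 < M j)%N by case: (Hf (j, S j) (Sgood j)).
have SN j : (S j.+1).1 = ((S j).1 * M j)%N.
  by case: (Hf (j, S j) (Sgood j)).
have Sw j i : (i <= (S j).1 * M j)%N ->
    mdist ((S j).2 (i %/ M j)%N) ((S j.+1).2 i) <= K * sg j.
  by case: (Hf (j, S j) (Sgood j)) => _ _ _; exact.
pose u (t : R) j := (S j).2 (Num.truncn (t * (S j).1%:R)).
have trN (t : R) j : 0 <= t <= 1 -> (Num.truncn (t * (S j).1%:R) <= (S j).1)%N.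
  move=> /andP[t0 t1]; rewrite -(ler_nat R).
  have /truncn_itv/andP[tS _] : 0 <= t * (S j).1%:R by rewrite mulr_ge0.
  apply: le_trans tS _.
  by rewrite ler_piMl.
have uu (t : R) j : 0 <= t <= 1 -> mdist (u t j) (u t j.+1) <= K * sg j.
  move=> t01; have /andP[t0 t1] := t01.
  rewrite /u -(@truncn_mulr_divn (t * (S j).1%:R) (M j))//; last first.
    by rewrite mulr_ge0.
  have -> : t * (S j).1%:R * (M j)%:R = t * (S j.+1).1%:R.
    by rewrite SN natrM mulrA.
  by apply: Sw; rewrite -SN; exact: trN.
have /choice[c Hc] : forall t : R, exists l, 0 <= t <= 1 ->
    forall j, mdist (u t j) l <= 2 * (K * sg j).
  move=> t; case: (boolP (0 <= t <= 1)) => t01; last by exists (w 0%N).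
  have [||l Hl] := @compact_geometric_limit _ _ (u t) (fun j => K * sg j) Xc.
  - by move=> j; exact: uu.
  - by move=> j; rewrite sgS mulrA.
  by exists l.
exists c; split; last first.
  by move=> t t01; have := Hc t t01 0%N; rewrite /u /= /sg expr0 divr1.
apply/subspace_continuousP => t /=; rewrite in_itv /= => t01.
apply/cvg_ballP => e e0.
(* Twice [2 * (K * sg j)] from the curve to the [j]-th chain, and [sg j] for one step of that
   chain. *)
have [j Hj] : exists j, (4 * K + 1) * sg j < e.
  exists (Num.truncn ((4 * K + 1) * s / e)); rewrite /sg mulrA.
  set z := _ * s; rewrite ltr_pdivrMr ?exprn_gt0// -ltr_pdivrMl// mulrC.
  apply: lt_le_trans (truncnS_gt _) _; rewrite -natrX ler_nat.
  exact: ltn_expl.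
have [SN0 _ Ss] := Sgood j.
have SR0 : 0 < (S j).1%:R :> R by rewrite ltr0n.
have step (t1 t2 : R) : 0 <= t1 <= 1 -> 0 <= t2 <= 1 ->
    `|t1 - t2| < ((S j).1%:R)^-1 -> mdist (u t1 j) (u t2 j) <= sg j.
  move=> ht1 ht2 d12.
  have d12' : `|t1 * (S j).1%:R - t2 * (S j).1%:R| < 1.
    by rewrite -mulrBl normrM (gtr0_norm SR0) -ltr_pdivlMr// mul1r.
  have a1 := truncn_near d12'; rewrite distrC in d12'.
  have a2 := truncn_near d12'.
  have b1 := trN t1 j ht1; have b2 := trN t2 j ht2.
  rewrite /u; move: a1 a2 b1 b2.
  set n1 := Num.truncn _; set n2 := Num.truncn _ => a1 a2 b1 b2.
  case: (ltngtP n1 n2) => n12; last by rewrite n12 mdistxx ltW.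
    have -> : n2 = n1.+1 by apply/eqP; rewrite eqn_leq a2 n12.
    by apply: Ss; exact: leq_trans b2.
  have -> : n1 = n2.+1 by apply/eqP; rewrite eqn_leq a1 n12.
  by rewrite metric_sym; apply: Ss; exact: leq_trans b1.
apply/nbhs_ballP; exists ((S j).1%:R)^-1 => /=; first by rewrite invr_gt0.
move=> t' tt' t'01; rewrite ballEmdist /=; rewrite /= in_itv /= in t'01.
have := step t t' t01 t'01 tt'.
have := Hc t t01 j; have := Hc t' t'01 j.
have := metric_triangle (c t) (u t j) (c t').
have := metric_triangle (u t j) (u t' j) (c t').
rewrite (metric_sym (c t) (u t j)); lra.
Qed.
End Curves.

(** * Moduli and coverings *)

Section Sums.
Context {R : realType}.

Lemma ler_powR2r (p x y : R) : 0 <= p -> 0 <= x -> x <= y -> x `^ p <= y `^ p.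
Proof.
move=> p0 x0 xy; apply: ge0_ler_powR => //; rewrite nnegrE//.
exact: le_trans xy.
Qed.

(** The sum is at most [N] times its largest term; this covers exponents below 1 as well. *)
Lemma powR_sum_le (I : finType) (P : pred I) (N : nat) (a : I -> R) (p : R) :
  0 < p -> (forall i, 0 <= a i) -> (#|P| <= N)%N ->
  (\sum_(i | P i) a i) `^ p <= N%:R `^ p * \sum_(i | P i) a i `^ p.
Proof.
move=> p0 a0 PN; case: (pickP P) => [i0 Pi0|P0]; last first.
  by rewrite !big_pred0// powR0 ?gt_eqF// mulr0.
have [j Pj jmax] : exists2 j, P j & forall i, P i -> a i <= a j.
  have [j Pj jm] := @arg_maxP _ R I i0 P a Pi0.
  by exists j => // i Pi; exact: jm.
have : \sum_(i | P i) a i <= N%:R * a j.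
  apply: (@le_trans _ _ (\sum_(i | P i) a j)); first exact: ler_sum.
  by rewrite sumr_const -[X in X <= _]mulr_natl ler_wpM2r// ler_nat.
have s0 : 0 <= \sum_(i | P i) a i by apply: sumr_ge0.
move=> /(ler_powR2r (ltW p0) s0) /le_trans; apply; rewrite powRM// ler_wpM2l ?powR_ge0//.
by rewrite (bigD1 j)//= lerDl sumr_ge0// => i _; exact: powR_ge0.
Qed.

Lemma powR_smear_le (I J : finType) (Q : I -> pred J) (N1 N2 : nat)
    (a : J -> R) (p : R) : 0 < p -> (forall j, 0 <= a j) ->
  (forall i, (#|Q i| <= N1)%N) -> (forall j, (#|[pred i | Q i j]| <= N2)%N) ->
  \sum_i (\sum_(j | Q i j) a j) `^ p
    <= N1%:R `^ p * N2%:R * \sum_j a j `^ p.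
Proof.
move=> p0 a0 Q1 Q2.
apply: (@le_trans _ _ (\sum_i (N1%:R `^ p * \sum_(j | Q i j) a j `^ p))).
  by apply: ler_sum => i _; exact: powR_sum_le.
rewrite -mulr_sumr -mulrA ler_wpM2l ?powR_ge0//.
rewrite (exchange_big_dep predT)//= mulr_sumr; apply: ler_sum => j _.
rewrite sumr_const -[X in X <= _]mulr_natl ler_wpM2r ?powR_ge0// ler_nat.
exact: Q2.
Qed.
End Sums.

Section Limits.
Context {R : realType}.
Local Open Scope ereal_scope.

Lemma limn_einf_eq0P (u : (\bar R)^nat) : (forall n, 0 <= u n) ->
  limn_einf u = 0 <-> forall (e : R) (k0 : nat), (0 < e)%R ->
    exists2 k, (k0 <= k)%N & u k < e%:E.
Proof.
move=> u0.
have -> : limn_einf u = ereal_sup (range (einfs u)).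
  by rewrite limn_einf_lim; apply: cvg_lim => //; exact: cvg_einfs_sup.
have es0 n : 0 <= einfs u n by apply: le_ereal_inf_tmp => _ [k _ <-].
split => [E e k0 e0|H].
  have : einfs u k0 < e%:E.
    apply: (@le_lt_trans _ _ 0); last by rewrite lte_fin.
    by rewrite -E; apply: ereal_sup_ubound; exists k0.
  by move=> /ereal_inf_lt[_ [k /= kk <-] uk]; exists k.
apply/eqP; rewrite eq_le; apply/andP; split; last first.
  by apply: (le_trans (es0 0%N)); apply: ereal_sup_ubound; exists 0%N.
apply: ge_ereal_sup => _ [k0 _ <-].
apply/lee_addgt0Pr => e e0; rewrite add0e.
have [k kk uk] := H e k0 e0; apply: (le_trans _ (ltW uk)).
by apply: ereal_inf_lbound; exists k.
Qed.
End Limits.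

Section Modulus.
Context {R : realType}.

Lemma modulus_le (V : finType) (p : R) (G : set {set V}) (rho : V -> R) :
  (forall v, 0 <= rho v) ->
  (forall g, G g -> 1 <= \sum_(v in g) rho v) ->
  (modulus p G <= (\sum_v rho v `^ p)%:E)%E.
Proof. by move=> r0 rG; apply: ereal_inf_lbound; exists rho. Qed.

Lemma nnsup_ge0 (S : set (\bar R)) : (0 <= nnsup S)%E.
Proof. by apply: ereal_sup_ubound; left. Qed.

Lemma nnsup_le (S : set (\bar R)) (e : \bar R) : (0 <= e)%E ->
  (forall s, S s -> (s <= e)%E) -> (nnsup S <= e)%E.
Proof. by move=> e0 Se; apply: ge_ereal_sup => s [->//|]; exact: Se. Qed.

Lemma nnsup_ub (S : set (\bar R)) s : S s -> (s <= nnsup S)%E.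
Proof. by move=> Ss; apply: ereal_sup_ubound; right. Qed.
End Modulus.

Section Coverings.
Context {R : realType} {X : metricType R} {kappa b : R}.
Hypotheses (kappa_gt1 : 1 < kappa) (b_gt1 : 1 < b).
Variable U : coverings X kappa b.

Lemma scale_gt0 n : 0 < b ^- n.
Proof. by rewrite invr_gt0 exprn_gt0// (lt_trans ltr01). Qed.

Lemma scaleD n k : b ^- (n + k) = b ^- n * b ^- k.
Proof. by rewrite exprD invfM. Qed.

Lemma scale_small e : 0 < e -> exists k0, forall k, (k0 <= k)%N -> b ^- k < e.
Proof.
move=> e0; have b1 : `|b^-1| < 1.
  by rewrite ger0_norm ?invr_ge0 ?(le_trans ler01 (ltW b_gt1))// invf_lt1// (lt_trans ltr01).
have /cvgrPdist_lt /(_ e e0) [k0 _ H] := cvg_expr b1.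
exists k0 => k /H /=; rewrite sub0r normrN exprVn ger0_norm// ltW//.
exact: scale_gt0.
Qed.

Lemma cell_dist n (A : cells U n) x : (0 < n)%N -> cell A x ->
  mdist (cell_center A) x < kappa * b ^- n.
Proof. by move=> n0 /(cell_outer n0); rewrite ballEmdist. Qed.

Lemma cell_exists n x : (0 < n)%N -> exists A : cells U n, cell A x.
Proof.
move=> n0; have : [set: X] x by [].
by rewrite -(cell_cover U n0) => -[A _ Ax]; exists A.
Qed.

(** Otherwise the center of [A'] would lie in both inner balls, which are disjoint. *)
Lemma center_sep n (A A' : cells U n) : (0 < n)%N -> A != A' ->
  kappa^-1 * b ^- n <= mdist (cell_center A) (cell_center A').
Proof.
move=> n0 AA'; rewrite leNgt; apply/negP => h.
have /eqP := AA'; apply; apply: (@cell_disjoint _ _ _ _ U n n0 A A' I I).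
exists (cell_center A'); split; first by rewrite ballEmdist.
by apply: ballxx; rewrite mulr_gt0 ?scale_gt0// invr_gt0 (lt_trans ltr01).
Qed.

Lemma cell_count : doubling X -> forall Q : R, exists N : nat, (0 < N)%N /\
  forall n x, (0 < n)%N ->
  (#|[pred A : cells U n | (mdist x (cell_center A) <= Q * b ^- n)%R]| <= N)%N.
Proof.
move=> XD Q; have [N [N0 HN]] := doubling_packing XD (Q * kappa).
have k0 : 0 < kappa by rewrite (lt_trans ltr01).
exists N; split => // n x n0; apply: (HN _ _ _ (kappa^-1 * b ^- n)).
- by rewrite mulr_gt0 ?scale_gt0// invr_gt0.
- by rewrite mulrA mulfK ?gt_eqF.
- by move=> A A'; exact: center_sep.
Qed.
End Coverings.

Section Weights.
Context {R : realType} {X : metricType R} {kappa b : R}.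
Hypotheses (kappa_gt1 : 1 < kappa) (b_gt1 : 1 < b).
Variable U : coverings X kappa b.

Let kappa_gt0 : 0 < kappa. Proof. exact: lt_trans kappa_gt1. Qed.
Let b_gt0 : 0 < b. Proof. exact: lt_trans b_gt1. Qed.
Let scale0 n := scale_gt0 b_gt1 n.

(** The level [N] is a variable with an equation, so that the same cells can be reached as
    [n + (m + k)] and as [(n + m) + k] without transport between types. *)
Lemma path_weights (lambda p e : R) k :
  (sup_modulus_paths U lambda p k < e%:E)%E ->
  forall n N (B : cells U n), (0 < n)%N -> N = (n + k)%N ->
  exists rho : cells U N -> R, [/\ forall A, 0 <= rho A,
    \sum_A rho A `^ p <= e &
    forall A s, path (@nerve_edge R X kappa b U lambda N) A s ->
      cell B (cell_center A) -> ~ dilate 2 B (cell_center (last A s)) ->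
      1 <= \sum_(D in A :: s) rho D].
Proof.
move=> Me n N B n0 ->.
have : (modulus p (path_family lambda B k) < e%:E)%E.
  by apply: le_lt_trans Me; apply: nnsup_ub; exists n, B.
move=> /ereal_inf_lt[_ [rho [rho0 rhoG] <-] rhoe].
exists rho; split => //; first by rewrite -lee_fin ltW.
move=> A s As BA BAs.
rewrite (eq_bigl (mem [set D in A :: s]%SET)); last by move=> D; rewrite /= !inE.
by apply: rhoG; exists A, s; split => // D; rewrite !inE.
Qed.

Lemma curve_weights (L p e : R) k :
  (sup_modulus_curves U L p k < e%:E)%E ->
  forall n N (B : cells U n), (0 < n)%N -> N = (n + k)%N ->
  exists rho : cells U N -> R, [/\ forall A, 0 <= rho A,
    \sum_A rho A `^ p <= e &
    forall g, curve_family L B g ->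
      1 <= \sum_(D | `[< cell D `&` g !=set0 >]) rho D].
Proof.
move=> Me n N B n0 ->.
have : (modulus p (curve_cells_family L B k) < e%:E)%E.
  by apply: le_lt_trans Me; apply: nnsup_ub; exists n, B.
move=> /ereal_inf_lt[_ [rho [rho0 rhoG] <-] rhoe].
exists rho; split => //; first by rewrite -lee_fin ltW.
move=> g Bg.
rewrite (eq_bigl (mem [set D | `[< cell D `&` g !=set0 >]]%SET)); last first.
  by move=> D; rewrite /= !inE.
by apply: rhoG; exists g => // D; rewrite inE; split => /asboolP.
Qed.

Lemma ler_sum_cover (I J : finType) (S : pred I) (P : pred J)
    (Q : I -> pred J) (a : J -> R) : (forall j, 0 <= a j) ->
  (forall j, P j -> exists2 i, S i & Q i j) ->
  \sum_(j | P j) a j <= \sum_(i | S i) \sum_(j | Q i j) a j.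
Proof.
move=> a0 PQ; rewrite (exchange_big_dep predT)//=.
rewrite big_mkcond /=; apply: ler_sum => j _; case: ifP => [/PQ[i Si Qij]|_].
  by rewrite (bigD1 i) ?Si//= lerDl sumr_ge0.
by apply: sumr_ge0.
Qed.

(** [nerve_edge] excludes loops, while consecutive points of a curve often lie in the same cell. *)
Lemma stutter_path (T : eqType) (e : rel T) x s :
  path (fun y z => (y == z) || e y z) x s ->
  exists s', [/\ path e x s', last x s' = last x s &
                 {subset x :: s' <= x :: s}].
Proof.
elim: s x => [|y s IH] x /=; first by exists [::]; split.
move=> /andP[xy /IH[s' [es' ls' ss']]].
case/orP: xy => [/eqP ->|exy].
  by exists s'; split => // z /ss' h; rewrite in_cons h orbT.
exists (y :: s'); split => //=; first by rewrite exy.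
move=> z; rewrite inE => /orP[/eqP ->|/ss' h]; first exact: mem_head.
by rewrite in_cons h orbT.
Qed.

Lemma mkseq_path (T : Type) (e : rel T) (A : nat -> T) M :
  (forall i, (i < M)%N -> e (A i) (A i.+1)) ->
  path e (A 0%N) (mkseq (fun i => A i.+1) M) /\
  last (A 0%N) (mkseq (fun i => A i.+1) M) = A M.
Proof.
elim: M => [//|M IH] He; have [|p1 l1] := IH.
  by move=> i iM; apply: He; exact: ltnW.
by rewrite mkseqS rcons_path last_rcons p1 l1 He.
Qed.

Lemma closure_ball_le (x z : X) r : closure (ball x r) z -> mdist x z <= r.
Proof.
move=> cz; apply/ler_addgt0Pl => d d0.
have [y [xy zy]] := cz (ball z d) (nbhsx_ballx z d d0).
move: xy zy; rewrite !ballEmdist /= => xy zy.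
have := metric_triangle x y z; rewrite (metric_sym y z); lra.
Qed.

Lemma scaleD_le n k : b ^- (n + k) <= b ^- n.
Proof.
rewrite scaleD ler_piMr ?(ltW (scale0 _))// invf_le1 ?exprn_gt0//.
by rewrite exprn_ege1// ltW.
Qed.

(** A curve of [B] starts in a ball of ratio [1 + b^-1], hence possibly outside [B], and leaves one
    of ratio [L >= 2]. Cells [B'] that are [m] levels finer fit into the gap: the curve crosses the
    annulus of the [B'] containing its first cell center, and adding up the weights of the boundedly
    many [B'] near [B] costs a constant. *)
Lemma sup_modulus_curves_le (lambda L p : R) : doubling X -> 32 <= lambda ->
  2 <= L -> 0 < p -> exists C m, 0 < C /\ forall k e,
    (sup_modulus_paths U lambda p k < e%:E)%E ->
    (sup_modulus_curves U L p (m + k) <= (C * e)%:E)%E.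
Proof.
move=> XD lambda32 L2 p0.
have bV1 : 0 < 1 - b^-1 by rewrite subr_gt0 invf_lt1.
(* The gap [1 - b^-1] absorbs five radii of level [n + m]: one from the start point to the center of
   its cell, one from there to the center of [B'], two for the dilation of [B'], one from the last
   cell center to the end point. *)
have [m Hm] : exists m, 5 * b ^- m <= 1 - b^-1.
  have [m /(_ m (leqnn _)) Hm] :=
    scale_small b_gt1 (divr_gt0 bV1 (ltr0n R 5)).
  by exists m; move: Hm; rewrite ltr_pdivlMr// mulrC => /ltW.
have [N1 [N10 HN1]] := cell_count kappa_gt1 b_gt1 U XD (5 * kappa * b ^+ m).
exists (N1%:R `^ p * N1%:R), m; split.
  by rewrite mulr_gt0 ?powR_gt0 ?ltr0n.
move=> k e Me; have e0 : 0 < e.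
  by rewrite -lte_fin; apply: le_lt_trans Me; exact: nnsup_ge0.
apply: nnsup_le => [|_ [n [B [n0 ->]]]].
  by rewrite lee_fin mulr_ge0 ?mulr_ge0 ?powR_ge0// ltW.
pose N := (n + (m + k))%N.
have nm0 : (0 < n + m)%N by rewrite addn_gt0 n0.
have N0 : (0 < N)%N by rewrite addn_gt0 n0.
have NE : N = (n + m + k)%N by rewrite /N addnA.
have /choice[rho Hrho] : forall B' : cells U (n + m), exists rho, _ :=
  fun B' => path_weights Me B' nm0 NE.
pose near (B' : cells U (n + m)) :=
  mdist (cell_center B) (cell_center B') <= 5 * kappa * b ^+ m * b ^- (n + m).
have near_count : (#|[pred B' : cells U (n + m) | near B']| <= N1)%N.
  exact: HN1.
pose rh A := \sum_(B' | near B') rho B' A.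
have rh0 A : 0 <= rh A.
  by apply: sumr_ge0 => B' _; case: (Hrho B').
apply: le_trans (modulus_le _ rh0 _) _; last first.
  rewrite lee_fin.
  apply: (@le_trans _ _
    (\sum_(A : cells U N) (N1%:R `^ p * \sum_(B' | near B') rho B' A `^ p))).
    apply: ler_sum => A _; apply: powR_sum_le => // B'.
    by case: (Hrho B').
  rewrite -mulr_sumr -mulrA ler_wpM2l ?powR_ge0// exchange_big /=.
  apply: (@le_trans _ _ (\sum_(B' | near B') e)).
    by apply: ler_sum => B' _; case: (Hrho B').
  rewrite sumr_const -[X in X <= _]mulr_natl ler_wpM2r ?(ltW e0)//.
  by rewrite ler_nat.
move=> dl [g [c [cc [s [t [s01 t01 cs ct]]]] <-] Hdl].
have gc : connected (c @` `[0, 1]).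
  by apply: connected_continuous_connected cc; exact: segment_connected.
have [M [w [w0 wM gw ws]]] := connected_chain gc (scale0 N)
  (ex_intro2 _ _ s s01 erefl) (ex_intro2 _ _ t t01 erefl).
have /choice[A HA] : forall i, exists A : cells U N, cell A (w i).
  by move=> i; exact: cell_exists.
have Awd i : mdist (cell_center (A i)) (w i) < kappa * b ^- N.
  exact: cell_dist.
have [|ep el] := @mkseq_path _
  (fun y z => (y == z) || @nerve_edge R X kappa b U lambda N y z) A M.
  (* Centers of cells containing consecutive points are within three radii, which [lambda]
     dominates. *)
  move=> i iM; case: eqP => //= /eqP AA; rewrite /nerve_edge AA /=.
  apply/asboolP; exists (cell_center (A i.+1)); split; last first.
    apply: ballxx; rewrite !mulr_gt0//; lra.
  rewrite /dilate ballEmdist /=.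
  have := metric_triangle (cell_center (A i)) (w i) (cell_center (A i.+1)).
  have := metric_triangle (w i) (w i.+1) (cell_center (A i.+1)).
  rewrite (metric_sym (w i.+1) (cell_center _)).
  have := Awd i; have := Awd i.+1; have := ws i iM; have := scale0 N.
  move: (b ^- N) => r; move=> r0 *.
  have : 3 * (kappa * r) <= lambda * kappa * r.
    by rewrite -mulrA ler_wpM2r ?mulr_ge0 ?ltW//; lra.
  have : 1 * r < kappa * r by rewrite ltr_pM2r.
  lra.
have [s' [es' ls' ss']] := stutter_path ep.
have A0d := Awd 0%N; have AMd := Awd M; rewrite w0 in A0d; rewrite wM in AMd.
have [B' HB'] := cell_exists U (cell_center (A 0%N)) nm0.
have B'd := cell_dist nm0 HB'.
have csd := closure_ball_le cs.
have ctd : L * kappa * b ^- n <= mdist (cell_center B) (c t).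
  by rewrite leNgt; apply/negP => h; apply: ct; rewrite /dilate ballEmdist.
have rN : b ^- N <= b ^- (n + m) by rewrite NE scaleD_le.
have rnm : 5 * b ^- (n + m) <= (1 - b^-1) * b ^- n.
  have := scale0 n; rewrite scaleD => rn; rewrite mulrCA mulrC.
  by rewrite ler_wpM2r// ltW.
have key1 : 5 * kappa * b ^- (n + m) <= (1 - b^-1) * kappa * b ^- n.
  rewrite mulrAC [X in _ <= X]mulrAC ler_wpM2r// ltW//.
have key2 : kappa * b ^- N <= kappa * b ^- (n + m).
  by rewrite ler_wpM2l// ltW.
have key3 : 2 * kappa * b ^- n <= L * kappa * b ^- n.
  by rewrite -!mulrA ler_wpM2r// mulr_ge0 ?ltW.
have key4 : 0 < kappa * b ^- n by rewrite mulr_gt0.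
have key6 : b^-1 * kappa * b ^- n <= 1 * kappa * b ^- n.
  by rewrite -!mulrA ler_wpM2r ?(ltW key4)//; lra.
have tr1 := metric_triangle (cell_center B) (c s) (cell_center B').
have tr2 := metric_triangle (c s) (cell_center (A 0%N)) (cell_center B').
rewrite (metric_sym (c s) (cell_center (A 0%N))) in tr2.
rewrite (metric_sym (cell_center (A 0%N)) (cell_center B')) in tr2.
have BB' : near B'.
  rewrite /near scaleD [X in _ <= X](_ : _ = 5 * (kappa * b ^- n)).
    lra.
  rewrite -mulrA [b ^+ m * _]mulrC -[in LHS](mulrA (b ^- n)).
  by rewrite mulVf ?gt_eqF ?exprn_gt0// mulr1 mulrA.
have out : ~ dilate 2 B' (cell_center (last (A 0%N) s')).
  rewrite ls' el /dilate ballEmdist /= => h.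
  have tr3 := metric_triangle (cell_center B) (cell_center B') (c t).
  have := metric_triangle (cell_center B') (cell_center (A M)) (c t).
  lra.
have [rB0 _ /(_ _ _ es' HB' out) rB1] := Hrho B'.
apply: (le_trans rB1).
apply: (@le_trans _ _ (\sum_(D in A 0%N :: s') rh D)).
  apply: ler_sum => D _; rewrite /rh (bigD1 B')//= lerDl.
  by apply: sumr_ge0 => B'' _; case: (Hrho B'').
rewrite big_mkcond [X in _ <= X]big_mkcond; apply: ler_sum => D _.
case: ifP => [/ss' Ds|_]; last by case: ifP.
suff -> : D \in dl by [].
apply/Hdl; move: Ds; rewrite inE => /orP[/eqP ->|].
  by exists (w 0%N); split.
by move=> /mapP[i _ ->]; exists (w i.+1); split.
Qed.

End Weights.

(** * Weights for paths with large jumps *)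

Section DiscreteFromCurves.
Context {R : realType} {X : metricType R} {kappa b : R}.
Hypotheses (kappa_gt1 : 1 < kappa) (b_gt1 : 1 < b).
Variable U : coverings X kappa b.

Let kappa_gt0 : 0 < kappa. Proof. exact: lt_trans kappa_gt1. Qed.
Let b_gt0 : 0 < b. Proof. exact: lt_trans b_gt1. Qed.
Let scale0 n := scale_gt0 b_gt1 n.

Lemma separated_path (V : eqType) (c : V -> X) (W : set X) (s d : R) A t :
  (s%:E <= set_dist W (~` W))%E -> d < s ->
  path (fun A A' => mdist (c A) (c A') <= d) A t -> W (c A) ->
  forall A', A' \in A :: t -> W (c A').
Proof.
move=> Ws ds; elim: t A => [|A1 t IH] A /=.
  by move=> _ WA A'; rewrite inE => /eqP ->.
move=> /andP[AA1 pt] WA A'; rewrite inE => /orP[/eqP ->//|].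
apply: IH => //; apply: contrapT => nW; move: AA1; apply/negP.
rewrite -ltNge; apply: lt_le_trans ds _; rewrite -lee_fin.
by apply: le_trans Ws _; apply: ereal_inf_lbound; exists (c A), (c A1).
Qed.

(* Omitting the last vertex of the path from the sum is what lets consecutive
   crossings of a longer path be charged to disjoint sets of vertices. *)
Lemma discrete_weights (L Lam p : R) : compact [set: X] -> doubling X ->
  uniformly_linearly_connected_components X ->
  uniformly_separated_components X -> 0 <= L -> 0 <= Lam -> 0 < p ->
  exists C m k0, 0 < C /\ forall k e, (k0 <= k)%N ->
    (sup_modulus_curves U L p k < e%:E)%E ->
    forall n N (B : cells U n), (0 < n)%N -> N = (n + (m + k))%N ->
    exists rho : cells U N -> R, [/\ forall A, 0 <= rho A,
      \sum_A rho A `^ p <= C * e &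
      forall A s, path (fun A A' : cells U N =>
          mdist (cell_center A) (cell_center A') <= Lam * b ^- N) A s ->
        cell B (cell_center A) -> ~ dilate 2 B (cell_center (last A s)) ->
        1 <= \sum_(D in belast A s) rho D].
Proof.
move=> Xc XD [Kl [Kl1 HKl]] [Ks [Ks1 HKs]] L0 Lam0 p0.
(* [D] is a positive scale below the diameter as soon as there are two points. Separation is
   available only up to the diameter, whence [k0]. *)
have [D D0 HD] : exists2 D, 0 < D &
    forall x y : X, x <> y -> (D%:E <= diam [set: X])%E.
  have [[[x y] /eqP xy]|nxy] := pselect (exists xy : X * X, xy.1 <> xy.2).
    exists (mdist x y); first by rewrite mdist_gt0.
    by move=> _ _ _; exact: diam_ge.
  by exists 1 => // x y xy; case: nxy; exists (x, y).
have Ks0 : 0 < Ks by rewrite (lt_le_trans ltr01).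
pose K := Kl + 1.
have K0 : 0 < K by rewrite /K; lra.
(* In units of the mesh [r]: the clopen sets are taken at scale [C1], so that their separation
   [C1 / Ks] exceeds the jumps [Lam]; [sg] bounds the steps of the shadow path in [Y], [C2] the
   distance from the curve to a suitable center of the path, and [C3] that from the center of a cell
   met by the curve. *)
pose C1 := Ks * Lam + 1.
have C10 : 0 < C1 by rewrite ltr_wpDl// mulr_ge0 ?(ltW Ks0).
pose sg := Lam + 2 * C1.
have sg0 : 0 < sg by rewrite /sg; lra.
pose C2 := (2 * K + 1) * sg + C1.
have C20 : 0 < C2 by rewrite addr_gt0// mulr_gt0//; lra.
pose C3 := kappa + C2.
have L1k : 0 < (L + 1) * kappa + 2 * C2.
  by rewrite addr_gt0// mulr_gt0//; lra.
(* The shadow of a crossing of [B] travels at least [kappa * b ^- n] less two errors [C2]; [m] makes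
   this enough to leave the dilation by [L] of a cell of level [n + m]. *)
have [m /(_ m (leqnn _)) Hm] := scale_small b_gt1 (divr_gt0 kappa_gt0 L1k).
rewrite ltr_pdivlMr// in Hm.
have [k0 Hk0] := scale_small b_gt1 (divr_gt0 D0 C10).
have [N1 [N10 HN1]] :=
  cell_count kappa_gt1 b_gt1 U XD ((2 * kappa + C2) * b ^+ m).
have [N2 [N20 HN2]] := cell_count kappa_gt1 b_gt1 U XD C3.
exists (N2%:R `^ p * N2%:R * (N1%:R `^ p * N1%:R)), m, k0; split.
  by rewrite !mulr_gt0 ?powR_gt0 ?ltr0n.
move=> k e k0k Me n N B n0 NE; have e0 : 0 < e.
  by rewrite -lte_fin; apply: le_lt_trans Me; exact: nnsup_ge0.
have nm0 : (0 < n + m)%N by rewrite addn_gt0 n0.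
have N0 : (0 < N)%N by rewrite NE addn_gt0 n0.
have NE' : N = (n + m + k)%N by rewrite NE addnA.
have /choice[rho Hrho] : forall B' : cells U (n + m), exists rho, _ :=
  fun B' => curve_weights Me B' nm0 NE'.
pose near (B' : cells U (n + m)) :=
  mdist (cell_center B) (cell_center B')
    <= (2 * kappa + C2) * b ^+ m * b ^- (n + m).
have near_count : (#|[pred B' : cells U (n + m) | near B']| <= N1)%N.
  exact: HN1.
pose rh A := \sum_(B' | near B') rho B' A.
have rh0 A : 0 <= rh A.
  by apply: sumr_ge0 => B' _; case: (Hrho B').
have rhp : \sum_A rh A `^ p <= N1%:R `^ p * N1%:R * e.
  apply: (@le_trans _ _
    (\sum_(A : cells U N) (N1%:R `^ p * \sum_(B' | near B') rho B' A `^ p))).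
    apply: ler_sum => A _; apply: powR_sum_le => // B'.
    by case: (Hrho B').
  rewrite -mulr_sumr -mulrA ler_wpM2l ?powR_ge0// exchange_big /=.
  apply: (@le_trans _ _ (\sum_(B' | near B') e)).
    by apply: ler_sum => B' _; case: (Hrho B').
  rewrite sumr_const -[X in X <= _]mulr_natl ler_wpM2r ?(ltW e0)//.
  by rewrite ler_nat.
pose Q (A : cells U N) (E : cells U N) :=
  mdist (cell_center A) (cell_center E) <= C3 * b ^- N.
exists (fun A => \sum_(E | Q A E) rh E); split.
- by move=> A; apply: sumr_ge0.
- rewrite -(mulrA _ _ e).
  apply: (@le_trans _ _ (N2%:R `^ p * N2%:R * \sum_E rh E `^ p)).
    apply: powR_smear_le => // A; first exact: HN2.
    rewrite (eq_card (B := [pred E | Q A E])); first exact: HN2.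
    by move=> E; rewrite !inE /Q metric_sym.
  by rewrite ler_wpM2l// mulr_ge0 ?powR_ge0.
move=> A s ps BA nB.
set r := b ^- N in ps *.
have r0 : 0 < r by exact: scale0.
have Bd := cell_dist n0 BA.
have BAs : 2 * kappa * b ^- n <= mdist (cell_center B) (cell_center (last A s)).
  by rewrite leNgt; apply/negP => h; apply: nB; rewrite /dilate ballEmdist.
have kbn : 0 < kappa * b ^- n by rewrite mulr_gt0.
have AAs : kappa * b ^- n <= mdist (cell_center A) (cell_center (last A s)).
  have := metric_triangle (cell_center B) (cell_center A)
    (cell_center (last A s)); lra.
have s_gt0 : (0 < size s)%N.
  case: (s) AAs => //=; rewrite mdistxx; lra.
have rk : r <= b ^- k by rewrite /r NE' addnC; exact: scaleD_le.
have [CW [CWT HCW]] : exists Cs : set (set X), \bigcup_(W in Cs) W = [set: X] /\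
    forall W, Cs W -> [/\ open W, closed W,
      ((C1 * r / Ks)%:E <= set_dist W (~` W))%E &
      exists x : X, let Y := connected_component [set: X] x in
        Y `<=` W /\ W `<=` thickening (C1 * r) Y].
  apply: HKs; first by rewrite mulr_gt0.
  apply: le_trans (HD (cell_center A) (cell_center (last A s)) _); last first.
    by move=> h; move: AAs; rewrite h mdistxx; lra.
  rewrite lee_fin mulrC -ler_pdivlMr//; apply: le_trans rk _.
  by apply: ltW; exact: Hk0.
have [W CWW WA] : (\bigcup_(W in CW) W) (cell_center A) by rewrite CWT.
have [_ _ Wsep [x0]] := HCW W CWW; set Y := connected_component _ x0.
move=> [YW WY].
have Lams : Lam * r < C1 * r / Ks.
  by rewrite ltr_pdivlMr// mulrAC ltr_pM2r// /C1 mulrC; lra.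
have Wall := separated_path Wsep Lams ps WA.
have YC : chain_connected K Y := linearly_connected_chain_connected Kl1 (HKl x0).
have /choice[y Hy] : forall E : cells U N, exists y, W (cell_center E) ->
    Y y /\ mdist y (cell_center E) < C1 * r.
  move=> E; have [/WY[y Yy]|nW] := pselect (W (cell_center E)).
    by rewrite ballEmdist => h; exists y.
  by exists x0.
pose v i := nth A (A :: s) i.
have vin i : v i \in A :: s.
  rewrite /v; case: (ltnP i (size (A :: s))) => h; first exact: mem_nth.
  by rewrite nth_default// mem_head.
have Yv i : Y (y (v i)) /\ mdist (y (v i)) (cell_center (v i)) < C1 * r.
  by apply: Hy; exact: Wall.
have vstep i : (i < size s)%N -> mdist (y (v i)) (y (v i.+1)) <= sg * r.
  move=> si; have := pathP A ps i si; rewrite -/(v i) (_ : nth A s i = v i.+1)//.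
  have := (Yv i).2; have := (Yv i.+1).2.
  have := metric_triangle (y (v i)) (cell_center (v i)) (y (v i.+1)).
  have := metric_triangle (cell_center (v i)) (cell_center (v i.+1)) (y (v i.+1)).
  rewrite (metric_sym (cell_center (v i.+1)) (y _)) /sg; lra.
have [c [cc Hc]] := curve_near_chain Xc (ltW K0) YC s_gt0
  (mulr_gt0 sg0 r0) (fun i => (Yv i).1) vstep.
have c0 := Hc 0; rewrite mul0r truncn0 lexx ler01 in c0.
have c1 := Hc 1; rewrite mul1r natrK lexx ler01 in c1.
have {c0} c0 := c0 isT; have {c1} c1 := c1 isT.
have vE : v (size s) = last A s by rewrite /v -last_nth.
have sgr : 0 < sg * r by rewrite mulr_gt0.
have C2E : C2 * r = 2 * (K * (sg * r)) + sg * r + C1 * r by rewrite /C2; lra.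
have c0A : mdist (c 0) (cell_center A) <= C2 * r.
  have := (Yv 0%N).2; have := metric_triangle (c 0) (y (v 0%N)) (cell_center A).
  rewrite (metric_sym (c 0) (y _)) /=; rewrite /v /= in c0 *; lra.
have c1A : mdist (c 1) (cell_center (last A s)) <= C2 * r.
  have := (Yv (size s)).2.
  have := metric_triangle (c 1) (y (v (size s))) (cell_center (last A s)).
  rewrite (metric_sym (c 1) (y _)) vE; rewrite vE in c1; lra.
have [B' HB'] := cell_exists U (c 0) nm0.
have B'd := cell_dist nm0 HB'.
have bnm : b ^- (n + m) <= b ^- n by exact: scaleD_le.
have rnm : r <= b ^- (n + m) by rewrite /r NE'; exact: scaleD_le.
have key1 : C2 * r <= C2 * b ^- (n + m) by rewrite ler_wpM2l// ltW.
have key2 : C2 * b ^- (n + m) <= C2 * b ^- n by rewrite ler_wpM2l// ltW.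
have key3 : kappa * b ^- (n + m) <= kappa * b ^- n by rewrite ler_wpM2l// ltW.
have key4 : b ^- (n + m) * ((L + 1) * kappa + 2 * C2) <= kappa * b ^- n.
  by rewrite scaleD -mulrA [X in _ <= X]mulrC ler_pM2l// ltW.
have BB' : near B'.
  rewrite /near scaleD [X in _ <= X](_ : _ = (2 * kappa + C2) * b ^- n).
    have := metric_triangle (cell_center B) (cell_center A) (cell_center B').
    have := metric_triangle (cell_center A) (c 0) (cell_center B').
    rewrite (metric_sym (cell_center A) (c 0)).
    rewrite (metric_sym (c 0) (cell_center B')); lra.
  rewrite -mulrA [b ^+ m * _]mulrC -[in LHS](mulrA (b ^- n)).
  by rewrite mulVf ?gt_eqF ?exprn_gt0// mulr1.
have Bc : curve_family L B' (c @` `[0, 1]).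
  exists c => //; split => //; exists 0, 1; split.
  - by rewrite in_itv /= lexx ler01.
  - by rewrite in_itv /= lexx ler01.
  - apply: subset_closure; rewrite /dilate ballEmdist /=.
    apply: lt_le_trans B'd _; rewrite -mulrA ler_peMl//.
      by rewrite mulr_ge0 ?ltW.
    by rewrite lerDl invr_ge0 ltW.
  rewrite /dilate ballEmdist /= => h.
  have := metric_triangle (cell_center A) (c 0) (cell_center (last A s)).
  have := metric_triangle (c 0) (cell_center B') (cell_center (last A s)).
  have := metric_triangle (cell_center B') (c 1) (cell_center (last A s)).
  rewrite (metric_sym (cell_center A) (c 0)).
  rewrite (metric_sym (c 0) (cell_center B')); lra.
have [rB0 _ /(_ _ Bc) rB1] := Hrho B'; apply: (le_trans rB1).
apply: (@le_trans _ _
  (\sum_(E | `[< cell E `&` c @` `[0, 1] !=set0 >]) rh E)).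
  apply: ler_sum => E _; rewrite /rh (bigD1 B')//= lerDl.
  by apply: sumr_ge0 => B'' _; case: (Hrho B'').
apply: (ler_sum_cover (S := [pred A' | A' \in belast A s])) => // E /asboolP.
move=> [z [Ez [t /= t01 tz]]]; rewrite -{z}tz in Ez.
rewrite in_itv /= in t01; have ct := Hc t t01.
have Ed := cell_dist N0 Ez.
set i := Num.truncn _ in ct.
have iS : (i <= size s)%N.
  have /andP[t0 t1] := t01.
  have /truncn_itv/andP[ts _] : 0 <= t * (size s)%:R by rewrite mulr_ge0.
  by rewrite -(ler_nat R); apply: le_trans ts _; rewrite ler_piMl.
(* At [t = 1] the index is [size s], the vertex left out of the sum; its predecessor serves instead,
   at the cost of one step [sg]. *)
have [j jS jc] : exists2 j, (j < size s)%N &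
    mdist (y (v j)) (c t) <= 2 * (K * (sg * r)) + sg * r.
  move: iS; rewrite leq_eqVlt => /orP[/eqP iS|iS]; last first.
    by exists i => //; lra.
  have js : ((size s).-1 < size s)%N by rewrite prednK.
  exists (size s).-1 => //; have := vstep _ js; rewrite prednK// -iS.
  have := metric_triangle (y (v i.-1)) (y (v i)) (c t); lra.
exists (v j) => /=.
  rewrite (_ : v j = nth A (belast A s) j) ?mem_nth ?size_belast//.
  by rewrite /v lastI nth_rcons size_belast jS.
rewrite /Q /C3; have := (Yv j).2.
have := metric_triangle (cell_center (v j)) (y (v j)) (cell_center E).
have := metric_triangle (y (v j)) (c t) (cell_center E).
rewrite (metric_sym (cell_center (v j)) (y _)).
rewrite (metric_sym (c t) (cell_center E)); rewrite -/r in Ed *; lra.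
Qed.
End DiscreteFromCurves.

(** * Comparison of the two critical exponents *)

Section CriticalExponents.
Context {R : realType} {X : metricType R} {kappa b : R}.
Hypotheses (kappa_gt1 : 1 < kappa) (b_gt1 : 1 < b).
Variable U : coverings X kappa b.

Let kappa_gt0 : 0 < kappa. Proof. exact: lt_trans kappa_gt1. Qed.

Lemma limn_einf_transfer (u v : (\bar R)^nat) (C : R) (m k0 : nat) :
  (forall n, (0 <= u n)%E) -> (forall n, (0 <= v n)%E) -> 0 < C ->
  (forall k e, (k0 <= k)%N -> (u k < e%:E)%E ->
     (v (m + k)%N <= (C * e)%:E)%E) ->
  limn_einf u = 0%E -> limn_einf v = 0%E.
Proof.
move=> u0 v0 C0 uv /(limn_einf_eq0P u0) Hu; apply/(limn_einf_eq0P v0).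
move=> e k1 e0; have e1 : 0 < e / (2 * C) by rewrite divr_gt0// mulr_gt0.
have [k] := Hu _ (maxn k0 k1) e1; rewrite geq_max => /andP[kk0 kk1] uk.
exists (m + k)%N; first exact: leq_trans (leq_addl _ _).
apply: le_lt_trans (uv _ _ kk0 uk) _; rewrite lte_fin.
by rewrite invfM mulrCA (mulrCA C) divff ?gt_eqF// mulr1; lra.
Qed.

Lemma Q_X_le_Q_N (lambda L : R) : doubling X -> 32 <= lambda -> 2 <= L ->
  (Q_X U L <= Q_N U lambda)%E.
Proof.
move=> XD lambda32 L2; apply: le_ereal_inf => _ [p [p0 Hp] <-].
exists p; [split; first exact: p0|by []].
have [C [m [C0 HC]]] :=
  sup_modulus_curves_le kappa_gt1 b_gt1 U XD lambda32 L2 p0.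
apply: (limn_einf_transfer (m := m) (k0 := 0) _ _ C0 _ Hp).
- by move=> n; exact: nnsup_ge0.
- by move=> n; exact: nnsup_ge0.
- by move=> k e _; exact: HC.
Qed.

Lemma Q_N_le_Q_X (lambda L : R) : compact [set: X] -> doubling X ->
  uniformly_linearly_connected_components X ->
  uniformly_separated_components X -> 0 <= lambda -> 0 <= L ->
  (Q_N U lambda <= Q_X U L)%E.
Proof.
move=> Xc XD Xl Xs lambda0 L0; apply: le_ereal_inf => _ [p [p0 Hp] <-].
exists p; [split; first exact: p0|by []].
(* Cells joined by an edge have centers within [2 * lambda * kappa] times the scale. *)
have Lam0 : 0 <= 2 * lambda * kappa by rewrite !mulr_ge0// ltW.
have [C [m [k0 [C0 HC]]]] :=
  discrete_weights kappa_gt1 b_gt1 U Xc XD Xl Xs L0 Lam0 p0.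
apply: (limn_einf_transfer (m := m) (k0 := k0) _ _ C0 _ Hp).
- by move=> n; exact: nnsup_ge0.
- by move=> n; exact: nnsup_ge0.
move=> k e kk0 Me; have e0 : 0 < e.
  by rewrite -lte_fin; apply: le_lt_trans Me; exact: nnsup_ge0.
apply: nnsup_le => [|_ [n [B [n0 ->]]]]; first by rewrite lee_fin mulr_ge0 ?ltW.
have [rho [rho0 rhoe rho1]] := HC _ _ kk0 Me n _ B n0 erefl.
apply: le_trans (modulus_le _ rho0 _) _; last by rewrite lee_fin; exact: rhoe.
move=> g [A [s [As BA nB gE]]].
apply: (le_trans (rho1 A s _ BA nB)).
  apply: sub_path As => E E' /andP[_ /asboolP[z [Ez E'z]]].
  move: Ez E'z; rewrite /dilate !ballEmdist /=.
  have := metric_triangle (cell_center E) z (cell_center E').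
  rewrite (metric_sym z); lra.
rewrite big_mkcond [X in _ <= X]big_mkcond; apply: ler_sum => D _.
case: ifP => [Ds|_]; last by case: ifP.
by rewrite gE lastI mem_rcons in_cons Ds orbT.
Qed.
End CriticalExponents.

Section LinearlyConnectedSpace.
Context {R : realType} {X : metricType R}.

Lemma linearly_connected_components : linearly_connected X ->
  uniformly_linearly_connected_components X.
Proof.
move=> [K [K1 HK]]; exists K; split => // x.
rewrite connected_component_id//.
by case: HK.
Qed.

(** The covering is X alone: its distance to the empty complement is infinite, and [0 < r <= diam]
    provides a point. *)
Lemma linearly_connected_separated : linearly_connected X ->
  uniformly_separated_components X.
Proof.
move=> [K [K1 [XT _]]]; exists 1; split => // r r0 rd.
have [x _] : [set: X] !=set0.
  apply/set0P/negP => /eqP X0; move: rd; apply/negP; rewrite -ltNge.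
  apply: (@le_lt_trans _ _ 0%E); last by rewrite lte_fin.
  by apply: nnsup_le => // s [x _]; have : [set: X] x by []; rewrite X0.
exists [set setT]; split; first by rewrite bigcup_set1.
move=> _ ->; split.
- exact: openT.
- exact: closedT.
- by apply: le_ereal_inf_tmp => s [y [z [_ + _]]]; rewrite setCT.
exists x => /=; rewrite connected_component_id//.
by split => // y _; exists y => //; exact: ballxx.
Qed.
End LinearlyConnectedSpace.

(** * Ahlfors regular distances and paths of cells *)

Section Ahlfors.
Context {R : realType} {T : metricType R}.

Lemma borel_measurable_open (x0 : T) (A : set T) : open A ->
  measurable (A : set (borel x0)).
Proof. by move=> oA; apply: sub_sigma_algebra. Qed.

Lemma compact_ball_cover (r : R) : compact [set: T] -> 0 < r ->
  exists s : seq T, [set: T] `<=` \bigcup_(y in [set` s]) ball y r.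
Proof.
move=> /compact_near_coveringP Tc r0.
(* The filter of sequences ordered by inclusion turns the near-covering form of compactness into a
   finite subcover. *)
pose F := filter_from [set: seq T]
  (fun s => [set s' : seq T | {subset s <= s'}]).
have FF : Filter F.
  apply: filter_from_filter => [|s1 s2 _ _]; first by exists [::].
  exists (s1 ++ s2) => // s' /= h; split => x xs; apply: h;
    by rewrite mem_cat xs ?orbT.
have [|s _ Hs] :=
    Tc (seq T) F (fun s x => (\bigcup_(y in [set` s]) ball y r) x) FF.
  move=> x _; exists (ball x r, [set s | {subset [:: x] <= s}]).
    by split; [exact: nbhsx_ballx|exists [:: x]].
  by move=> [y s] /= [xy xs]; exists x => //; apply: xs; exact: mem_head.
by exists s; apply: (Hs s).
Qed.

(** Beyond a fixed distance [d0] the upper bound follows from the finiteness of the total mass,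
    itself due to compactness; so it holds at every radius, whereas the lower bound stops at the
    diameter. *)
Lemma ahlfors_bounds (q : R) : compact [set: T] ->
  (exists x y : T, x != y) -> 0 < q -> ahlfors_regular_of_dim T q ->
  exists (x0 : T) (mu : {measure set (borel x0) -> \bar R}) (K1 K2 : R),
  [/\ 0 < K1, 0 < K2,
    forall x (r : R), 0 < r -> (r%:E <= diam [set: T])%E ->
      ((K1 * r `^ q)%:E <= mu (ball x r))%E,
    forall x (r : R), 0 < r -> (mu (ball x r) <= (K2 * r `^ q)%:E)%E &
    (0 < mu setT)%E].
Proof.
move=> Tc [y0 [y1 y01]] q0 [x0 [mu [_ [K [K1 HK]]]]].
have K0 : 0 < K by exact: lt_le_trans K1.
pose d0 := mdist y0 y1.
have d00 : 0 < d0 by rewrite mdist_gt0.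
have d0d : (d0%:E <= diam [set: T])%E by exact: diam_ge.
have mball x r : measurable (ball x r : set (borel x0)).
  by apply: borel_measurable_open; exact: mball_open.
have low x r : 0 < r -> (r%:E <= diam [set: T])%E ->
    ((K^-1 * r `^ q)%:E <= mu (ball x r))%E.
  move=> r0 rd; have /andP[+ _] := HK x r r0 rd.
  by rewrite EFinM -lee_pdivlMr ?powR_gt0.
have up x r : 0 < r -> (r%:E <= diam [set: T])%E ->
    (mu (ball x r) <= (K * r `^ q)%:E)%E.
  move=> r0 rd; have /andP[_ ] := HK x r r0 rd.
  by rewrite EFinM -lee_pdivrMr ?powR_gt0.
have [M [M0 HM]] : exists M : R, 0 < M /\ (mu setT <= M%:E)%E.
  have [s Hs] := compact_ball_cover Tc d00.
  have Hs' : forall s' : seq T, exists M : R, 0 < M /\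
      (mu (\bigcup_(y in [set` s']) ball y d0) <= M%:E)%E.
    elim=> [|y s' [M [M0 HM]]].
      by exists 1; split => //; rewrite set_nil bigcup_set0 measure0 lee_fin.
    exists (K * d0 `^ q + M); split.
      by rewrite addr_gt0// mulr_gt0// powR_gt0.
    have -> : [set` y :: s'] = y |` [set` s'].
      apply/seteqP; split => z /=; rewrite in_cons; last first.
        by move=> [->|->]; rewrite ?eqxx ?orbT.
      by move=> /orP[/eqP|]; [left|right].
    rewrite bigcup_setU1.
    apply: (@le_trans _ _
      (mu (ball y d0) + mu (\bigcup_(z in [set` s']) ball z d0))%E).
      apply: measureU2 => //; apply: borel_measurable_open.
      by apply: bigcup_open => *; exact: mball_open.
    by rewrite EFinD; apply: leeD => //; exact: up.
  have [M [M0 HM]] := Hs' s; exists M; split => //.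
  apply: le_trans HM; apply: le_measure => //; rewrite inE.
    exact: measurableT.
  by apply: borel_measurable_open; apply: bigcup_open => *; exact: mball_open.
exists x0, mu, K^-1, (K + M / d0 `^ q); split => //.
- by rewrite invr_gt0.
- by rewrite addr_gt0// divr_gt0// powR_gt0.
- move=> x r r0; have [rd|rd] := leP r d0.
    apply: le_trans (up x r r0 _) _; first by apply: le_trans d0d; rewrite lee_fin.
    by rewrite lee_fin ler_wpM2r ?powR_ge0// lerDl divr_ge0 ?powR_ge0// ltW.
  apply: (@le_trans _ _ M%:E).
    by apply: le_trans HM; apply: le_measure; rewrite ?inE//; exact: measurableT.
  rewrite lee_fin mulrDl -[leLHS]add0r lerD// ?mulr_ge0 ?powR_ge0 ?(ltW K0)//.
  rewrite -mulrA ler_peMr ?(ltW M0)// mulrC ler_pdivlMr ?powR_gt0// mul1r.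
  by apply: ler_powR2r; exact: ltW.
apply: (@lt_le_trans _ _ (mu (ball y0 d0))).
  by apply: lt_le_trans (low y0 d0 d00 d0d); rewrite lte_fin mulr_gt0 ?invr_gt0 ?powR_gt0.
by apply: le_measure; rewrite ?inE//; exact: measurableT.
Qed.

(** Mass distribution principle: if [s < q], a covering with small [s]-sum is enlarged to balls of
    radius at most 1, for which the [q]-th power of the radius is at most its [s]-th power, and the
    total mass would vanish. *)
Lemma hausdorff_measure0_dim (q s : R) : compact [set: T] ->
  (exists x y : T, x != y) -> 0 < q -> ahlfors_regular_of_dim T q ->
  0 < s -> hausdorff_measure s [set: T] = 0%E -> q <= s.
Proof.
move=> Tc Txy q0 /(ahlfors_bounds Tc Txy q0).
move=> [x0 [mu [K1 [K2 [K10 K20 _ up mu0]]]]] s0 Hs.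
rewrite leNgt; apply/negP => sq; move: mu0; apply/negP; rewrite -leNgt.
apply/lee_addgt0Pr => e; rewrite -[_ < e]/((0 : R) < e) => e0; rewrite add0e.
pose d := Num.min (1 / 2) (e / (2 * K2)).
have eK0 : 0 < e / (2 * K2) by rewrite divr_gt0// mulr_gt0.
have d0 : 0 < d by rewrite lt_min eK0 andbT; lra.
have d1 : 2 * d <= 1.
  have : d <= 1 / 2 by rewrite /d ge_min lexx.
  lra.
have de : K2 * (2 * d) <= e.
  have : d <= e / (2 * K2) by rewrite /d ge_min lexx orbT.
  by rewrite ler_pdivlMr ?mulr_gt0//; lra.
have : (hausdorff_content s 1 [set: T] < d%:E)%E.
  apply: (@le_lt_trans _ _ 0%E); last by rewrite lte_fin.
  by rewrite -Hs; apply: ereal_sup_ubound; exists 1; rewrite /= ?ltr01.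
move=> /ereal_inf_lt[_ [F [TF F1] <-] Fd].
pose D i := fine (diam (F i)).
have dge0 i : (0 <= diam (F i))%E := nnsup_ge0 _.
have dfin i : diam (F i) \is a fin_num.
  by rewrite ge0_fin_numE//; apply: le_lt_trans (F1 i) _; rewrite ltry.
have DE i : poweR (diam (F i)) s = (D i `^ s)%:E.
  by rewrite -(fineK (dfin i)) poweR_EFin.
have sumD : (\sum_(0 <= i <oo) (D i `^ s)%:E < d%:E)%E.
  by rewrite (eq_eseriesr (fun i _ => esym (DE i))).
have Ds i : D i `^ s <= d.
  rewrite -lee_fin; apply: le_trans (ltW sumD).
  rewrite (@nneseriesD1 _ _ i)//; last by move=> *; rewrite lee_fin powR_ge0.
  by apply: leeDl; apply: nneseries_ge0 => *; rewrite lee_fin powR_ge0.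
(* The summable excess makes the radius positive and strictly larger than the diameter, even for
   one-point sets; [2 * d <= 1] keeps [w i] at most 1. *)
pose w i := D i `^ s + d / (2 ^ i.+1)%:R.
have dw i : 0 < d / (2 ^ i.+1)%:R by rewrite divr_gt0// ltr0n expn_gt0.
have w0 i : 0 < w i by rewrite ltr_wpDl// powR_ge0.
have w1 i : w i <= 1.
  have := Ds i; have : d / (2 ^ i.+1)%:R <= d.
    by rewrite ler_pdivrMr ?ltr0n ?expn_gt0// ler_peMr ?(ltW d0)// ler1n expn_gt0.
  rewrite /w; lra.
pose rr i := w i `^ s^-1.
have rr0 i : 0 < rr i by rewrite powR_gt0.
have rrs i : rr i `^ s = w i by rewrite /rr -powRrM mulVf ?gt_eqF// powRr1 ?ltW.
have rrq i : rr i `^ q <= w i.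
  rewrite -[leRHS](rrs i); apply: ger_powR; last exact: ltW.
  rewrite rr0 /=; have sV : 0 <= s^-1 by rewrite invr_ge0 ltW.
  by have := ler_powR2r sV (ltW (w0 i)) (w1 i); rewrite powR1.
have Dr i : D i < rr i.
  have D0 : 0 <= D i by rewrite fine_ge0.
  rewrite -[D i](_ : (D i `^ s) `^ s^-1 = _); last first.
    by rewrite -powRrM divff ?gt_eqF// powRr1.
  by rewrite gt0_ltr_powR ?invr_gt0// ?nnegrE ?powR_ge0 ?(ltW (w0 i))// ltrDl.
have /choice[G HG] : forall i, exists G : set T, [/\ F i `<=` G, open G &
    (mu G <= (K2 * w i)%:E)%E].
  move=> i; have [F0|/set0P[x Fx]] := eqVneq (F i) set0.
    exists set0; split; first by rewrite F0.
      exact: open0.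
    by rewrite measure0 lee_fin mulr_ge0 ?ltW.
  exists (ball x (rr i)); split.
  - move=> y Fy; rewrite ballEmdist /=; apply: le_lt_trans (Dr i).
    by rewrite -lee_fin /D fineK//; exact: diam_ge.
  - exact: mball_open.
  - apply: le_trans (up x _ (rr0 i)) _.
    by rewrite lee_fin ler_wpM2l ?(ltW K20).
have mG i : measurable (G i : set (borel x0)).
  by apply: borel_measurable_open; case: (HG i).
apply: (@le_trans _ _ (\sum_(0 <= i <oo) mu (G i))%E).
  apply: measure_sigma_subadditive => //.
  by move=> x /TF[i _ Fx]; exists i => //; case: (HG i) => /(_ _ Fx).
apply: (@le_trans _ _ (\sum_(0 <= i <oo) (K2%:E * (w i)%:E))%E).
  apply: lee_nneseries => [i _ _|i _]; first exact: measure_ge0.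
  by rewrite -EFinM; case: (HG i).
rewrite nneseriesZl; last by move=> i _; rewrite lee_fin ltW.
apply: (@le_trans _ _ (K2%:E * (2 * d)%:E)%E); last by rewrite -EFinM lee_fin.
rewrite lee_pmul2l ?lte_fin//.
apply: (@le_trans _ _ (\sum_(0 <= i <oo) (D i `^ s)%:E + d%:E)%E).
  under eq_eseriesr do rewrite /w EFinD.
  apply: epsilon_trick; last exact: ltW.
  by move=> i; rewrite lee_fin powR_ge0.
rewrite mulr_natl mulr2n EFinD leeD2r//; exact: ltW.
Qed.
End Ahlfors.

Lemma ratio_bound (R : realType) (K1 K2 c1 c2 c3 S : R) :
  0 < K1 -> 0 < c1 -> 0 < c2 -> K1 * (S / c1) <= K2 * (c3 * c2) ->
  S / c2 <= K2 / K1 * (c1 * c3).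
Proof.
move=> K10 c10 c20 h; rewrite ler_pdivrMr//.
have : S / c1 <= K2 * (c3 * c2) / K1 by rewrite ler_pdivlMr// mulrC.
rewrite ler_pdivrMr// => /le_trans; apply; lra.
Qed.

Section PowerSums.
Context {R : realType} {I : finType}.
Implicit Types (P : pred I) (u : I -> R).

(** The excess [p - q] of the exponent is spent on the factor [z], which will be small. *)
Lemma sum_powR_le P u (p q z : R) : q < p ->
  (forall i, P i -> 0 < u i /\ u i <= z) ->
  \sum_(i | P i) u i `^ p <= z `^ (p - q) * \sum_(i | P i) u i `^ q.
Proof.
move=> qp Pu; rewrite mulr_sumr; apply: ler_sum => i /Pu[u0 uz].
have -> : u i `^ p = u i `^ (p - q) * u i `^ q.
  rewrite -powRD ?subrK//; apply/implyP => _; exact: lt0r_neq0.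
apply: ler_wpM2r; first exact: powR_ge0.
by apply: ler_powR2r => //; [rewrite subr_ge0|]; exact: ltW.
Qed.

Lemma sum_powR_div P u (q c : R) : 0 < c -> (forall i, 0 <= u i) ->
  \sum_(i | P i) (u i / c) `^ q = (\sum_(i | P i) u i `^ q) / c `^ q.
Proof.
move=> c0 u0; rewrite mulr_suml; apply: eq_bigr => i _.
rewrite powRM ?invr_ge0 ?(ltW c0)//; congr (_ * _).
by rewrite -[c^-1]powR_inv1 ?(ltW c0)// -powRrM mulN1r powRN.
Qed.
End PowerSums.

Section Quasisymmetry.
Context {R : realType} {X : metricType R}.

Lemma distance_ge0 (theta : distance R X) x y : 0 <= theta x y.
Proof. exact: (@mdist_ge0 R (remetric theta) x y). Qed.

Lemma distance_gt0 (theta : distance R X) x y : x != y -> 0 < theta x y.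
Proof. by rewrite -(@mdist_gt0 R (remetric theta) x y). Qed.

Lemma increasing_lt (eta : R -> R) :
  {in `[0, +oo[ &, {homo eta : s t / s < t}} ->
  forall s t : R, 0 <= s -> s < t -> eta s < eta t.
Proof.
move=> einc s t s0 st; apply: einc => //; rewrite in_itv /= ?s0//.
by rewrite (le_trans s0 (ltW st)).
Qed.

(** Both facts come from surjectivity: only 0 can be sent to 0, and below the preimage of [e] the
    values are less than [e]. *)
Lemma increasing_bij_small (eta : R -> R) :
  set_bij `[0, +oo[ `[0, +oo[ eta ->
  {in `[0, +oo[ &, {homo eta : s t / s < t}} ->
  eta 0 = 0 /\ forall e, 0 < e -> exists2 u, 0 < u &
    forall t, 0 <= t -> t < u -> eta t < e.
Proof.
move=> [efun _ esur] /increasing_lt einc.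
have surj (e : R) : 0 <= e -> exists2 u : R, 0 <= u & eta u = e.
  move=> e0; have [|u] := esur e; first by rewrite /= in_itv /= andbT.
  by rewrite /= in_itv /= andbT => u0 eu; exists u.
have E0 : eta 0 = 0.
  have [u u0 eu] := surj 0 (lexx _).
  move: (u0); rewrite le_eqVlt => /orP[/eqP u00|u1]; first by rewrite [in LHS]u00.
  have := einc 0 u (lexx _) u1; rewrite eu.
  have := efun 0; rewrite /= !in_itv /= lexx => /(_ isT).
  by rewrite andbT leNgt => /negP.
split=> // e e0; have [u u0 eu] := surj e (ltW e0).
exists u; last by move=> t t0 tu; rewrite -eu; exact: einc.
rewrite lt_neqAle u0 andbT; apply/eqP => u00.
by move: e0; rewrite -eu -u00 E0 ltxx.
Qed.

Lemma measure_finType_bigcup d (S : measurableType d)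
    (mu : {measure set S -> \bar R}) (I : finType) (P : pred I)
    (F : I -> set S) :
  (forall i, P i -> measurable (F i)) -> trivIset [set` P] F ->
  mu (\bigcup_(i in [set` P]) F i) = (\sum_(i | P i) mu (F i))%E.
Proof.
move=> mF tF; have PE : [set` enum P] = [set` P].
  by apply/seteqP; split => i /=; rewrite mem_enum.
have -> : (\sum_(i | P i) mu (F i) = \sum_(i <- enum P) mu (F i))%E.
  by rewrite big_enum.
by rewrite fsbig_seq ?enum_uniq// PE measure_fin_bigcup.
Qed.

Lemma measure_finType_disjoint d (S : measurableType d)
    (mu : {measure set S -> \bar R}) (I : finType) (P : pred I)
    (F : I -> set S) (A : set S) :
  (forall i, P i -> measurable (F i)) -> measurable A ->
  trivIset [set` P] F -> (forall i, P i -> F i `<=` A) ->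
  (\sum_(i | P i) mu (F i) <= mu A)%E.
Proof.
move=> mF mA tF FA; rewrite -measure_finType_bigcup//.
apply: le_measure; rewrite ?inE//.
  by apply: fin_bigcup_measurable => //; exact: finite_finset.
by move=> x [i Pi]; exact: FA.
Qed.

(** Jumps are added only up to the first vertex outside [I], because [g] controls them only
    inside. *)
Lemma jump_sum (theta : distance R X) (V : eqType) (c : V -> X)
    (I : pred V) (e : rel V) (g : V -> R) A s :
  (forall D, 0 <= g D) ->
  (forall D D', I D -> e D D' -> theta (c D) (c D') <= g D) ->
  I A -> ~~ I (last A s) -> path e A s ->
  exists D, ~~ I D /\ theta (c A) (c D) <= \sum_(E <- A :: s) g E.
Proof.
move=> g0 ge; elim: s A => [|A1 s IH] A IA /=; first by rewrite IA.
move=> nI /andP[AA1 ps]; have [I1|nI1] := boolP (I A1); last first.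
  exists A1; split => //; apply: le_trans (ge _ _ IA AA1) _.
  by rewrite big_cons lerDl sumr_ge0.
have [D [nD h]] := IH A1 I1 nI ps; exists D; split => //.
apply: le_trans (distance_triangle _ (c A1) _ _) _.
by rewrite big_cons lerD// ge.
Qed.

Variables (theta : distance R X) (eta : R -> R).
Hypotheses (eta_bij : set_bij `[0, +oo[ `[0, +oo[ eta)
  (eta_inc : {in `[0, +oo[ &, {homo eta : s t / s < t}})
  (eta_qs : forall x a c : X, x <> c ->
     theta x a / theta x c <= eta (mdist x a / mdist x c)).

Lemma eta_pos t : 0 < t -> 0 < eta t.
Proof.
move=> t0; have [E0 _] := increasing_bij_small eta_bij eta_inc.
by rewrite -E0; exact: (increasing_lt eta_inc).
Qed.

Lemma qs_le x a c t : 0 < t -> x != c -> mdist x a <= t * mdist x c ->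
  theta x a <= eta t * theta x c.
Proof.
move=> t0 xc h; have := eta_qs a (elimN eqP xc).
rewrite ler_pdivrMr ?distance_gt0// => /le_trans; apply.
rewrite ler_wpM2r ?distance_ge0//.
have xc0 : 0 < mdist x c by rewrite mdist_gt0.
rewrite -ler_pdivrMr// in h; move: h; rewrite le_eqVlt => /orP[/eqP ->//|h].
by apply/ltW/(increasing_lt eta_inc) => //; rewrite divr_ge0 ?mdist_ge0.
Qed.
End Quasisymmetry.

(** Uniform perfectness gives the center of [B] a companion [zB] and that of each fine cell [D] a
    companion [z D]; the [theta]-distances [T] and [s D] to them replace the diameters. Jumps are at
    most [E1 * s D], so a crossing has weight at least 1; disjoint [theta]-balls around the centers
    bound the sum of the [q]-th powers of [s D / T]; and [s D / T] tends to 0 uniformly, so the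
    [p]-th powers have a small sum. *)
Lemma qs_limn_einf_paths (R : realType) (X : metricType R) (kappa b : R)
    (U : coverings X kappa b) (theta : distance R X) (eta : R -> R)
    (lambda p q K1 K2 : R) (x0 : remetric theta)
    (mu : {measure set (borel x0) -> \bar R}) :
  1 < kappa -> 1 < b ->
  set_bij `[0, +oo[ `[0, +oo[ eta ->
  {in `[0, +oo[ &, {homo eta : s t / s < t}} ->
  (forall x a c : X, x <> c ->
     theta x a / theta x c <= eta (mdist x a / mdist x c)) ->
  uniformly_perfect X -> 0 < lambda -> 0 < q -> q < p -> 0 < K1 -> 0 < K2 ->
  (forall (x : remetric theta) (r : R), 0 < r ->
     (r%:E <= diam [set: remetric theta])%E ->
     ((K1 * r `^ q)%:E <= mu (ball x r))%E) ->
  (forall (x : remetric theta) (r : R), 0 < r ->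
     (mu (ball x r) <= (K2 * r `^ q)%:E)%E) ->
  limn_einf (sup_modulus_paths U lambda p) = 0%E.
Proof.
move=> kappa_gt1 b_gt1 eta_bij eta_inc eta_qs.
move=> [KP [KP1 HKP]] lambda0 q0 qp K10 K20 low up.
have kappa_gt0 : 0 < kappa by exact: lt_trans kappa_gt1.
have scale0 n : 0 < b ^- n by exact: scale_gt0.
have eta_gt0 t : 0 < t -> 0 < eta t by exact: eta_pos.
have qs_le x a c t : 0 < t -> x != c -> mdist x a <= t * mdist x c ->
    theta x a <= eta t * theta x c by exact: qs_le.
have KP0 : 0 < KP by exact: lt_trans KP1.
have p0 : 0 < p by exact: lt_trans qp.
(* [E1] compares a jump along an edge with [s D]; [E2] shrinks a [theta]-ball into the inner ball of
   its cell; [E4] compares [T] with the [theta]-size of a crossing; [E5] bounds the distance from a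
   fine center to [cB] or [zB]; [E6] gives a [theta]-ball containing all the small ones. *)
pose E1 := eta (2 * lambda * kappa * kappa * KP).
pose E2 := eta 1 + 1.
pose E4 := eta 1 + eta 2.
pose E5 := eta (2 * KP) + 1.
pose E6 := eta (3 * KP) + 1.
have E10 : 0 < E1 by apply: eta_gt0; rewrite !mulr_gt0.
have e10 : 0 < eta 1 by exact: eta_gt0.
have e20 : 0 < eta 2 by exact: eta_gt0.
have e2K0 : 0 < eta (2 * KP) by apply: eta_gt0; rewrite mulr_gt0.
have e3K0 : 0 < eta (3 * KP) by apply: eta_gt0; rewrite mulr_gt0.
have E20 : 0 < E2 by rewrite addr_gt0.
have E40 : 0 < E4 by rewrite addr_gt0.
have E50 : 0 < E5 by rewrite addr_gt0.
have E60 : 0 < E6 by rewrite addr_gt0.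
pose Cst := (E4 * E1) `^ p * (K2 / K1 * (E2 * E6) `^ q).
have Cst0 : 0 < Cst by rewrite /Cst; pos.
pose t k := 2 * KP / kappa / kappa * b ^- k.
have t0 k : 0 < t k by rewrite /t; have := scale0 k; pos.
have pq0 : 0 < p - q by rewrite subr_gt0.
apply/limn_einf_eq0P => [k|e k0 e0]; first exact: nnsup_ge0.
(* Chosen so that [Cst] times the [(p - q)]-th power of [e' * E5] is [e / 2]. *)
pose e' := (e / 2 / Cst) `^ (p - q)^-1 / E5.
have e'0 : 0 < e' by rewrite divr_gt0// powR_gt0// !divr_gt0.
have [_ /(_ e' e'0)[u u0 Hu]] := increasing_bij_small eta_bij eta_inc.
have [k1 Hk1] : exists k1, forall k, (k1 <= k)%N -> eta (t k) < e'.
  have c0 : 0 < 2 * KP / kappa / kappa by pos.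
  have [k1 Hk1] := scale_small b_gt1 (divr_gt0 u0 c0).
  exists k1 => k /Hk1; rewrite ltr_pdivlMr// => h.
  by apply: Hu; [exact: ltW|rewrite /t mulrC].
exists (maxn k0 k1); first exact: leq_maxl.
move: (maxn k0 k1) (leq_maxr k0 k1) => k /Hk1 etak.
apply: (@le_lt_trans _ _ (e / 2)%:E); last by rewrite lte_fin; lra.
apply: nnsup_le => [|_ [n [B [n0 ->]]]]; first by rewrite lee_fin; lra.
set N := (n + k)%N.
have N0 : (0 < N)%N by rewrite addn_gt0 n0.
pose rn := b ^- n; pose r := b ^- N.
have rn0 : 0 < rn by exact: scale0.
have r0 : 0 < r by exact: scale0.
have rE : r = rn * b ^- k by rewrite /r scaleD.
have rrn : r <= rn by exact: scaleD_le.
have krn : 0 < kappa * rn by rewrite mulr_gt0.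
pose cB := cell_center B.
(* If [kappa * rn] exceeds the diameter, no path from [B] leaves its double, and the zero weight is
   admissible. *)
have [diamB|diamB] := leP (kappa * rn)%:E (diam [set: X]); last first.
  apply: le_trans (modulus_le (rho := fun=> 0) _ _ _) _ => //.
    move=> gamma [A [s [_ BA nB _]]]; exfalso; move: diamB; apply/negP.
    rewrite -leNgt.
    apply: le_trans (diam_ge (x := cell_center A)
      (y := cell_center (last A s)) _ _) => //; rewrite lee_fin.
    have := cell_dist n0 BA.
    have : 2 * kappa * b ^- n <= mdist cB (cell_center (last A s)).
      by rewrite leNgt; apply/negP => h; apply: nB; rewrite /dilate ballEmdist.
    have := metric_triangle cB (cell_center A) (cell_center (last A s)).
    rewrite -/cB -/rn; glra.
  rewrite lee_fin big1; first by lra.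
  by move=> v _; rewrite powR0// gt_eqF.
have [zB []] := HKP cB _ krn diamB.
rewrite !ballEmdist /= => zB1 /negP; rewrite -leNgt => zB2.
have zB3 : 0 < KP^-1 * (kappa * rn) by pos.
have zBne : cB != zB by rewrite -mdist_gt0; exact: lt_le_trans zB2.
have zB4 : kappa * rn <= KP * mdist cB zB by rewrite -ler_pdivrMl.
pose T := theta cB zB.
have T0 : 0 < T by exact: distance_gt0.
have kr : 0 < kappa^-1 * r by pos.
have krr : kappa^-1 * r <= kappa * rn.
  have kk : kappa^-1 <= kappa.
    by apply: (@le_trans _ _ 1); [rewrite invf_le1// ltW|exact: ltW].
  by apply: ler_pM => //; [rewrite invr_ge0 ltW|exact: ltW].
have /choice[z Hz] : forall D : cells U N, exists z,
    mdist (cell_center D) z < kappa^-1 * r /\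
    kappa^-1 * r <= KP * mdist (cell_center D) z.
  move=> D; have [|z []] := HKP (cell_center D) _ kr.
    by apply: le_trans diamB; rewrite lee_fin.
  rewrite !ballEmdist /= => z1 /negP; rewrite -leNgt => z2.
  by exists z; split => //; rewrite -ler_pdivrMl.
pose s D := theta (cell_center D) (z D).
have s_ge0 D : 0 <= s D by exact: distance_ge0.
have zne D : cell_center D != z D.
  rewrite -mdist_gt0 -(pmulr_rgt0 _ KP0); apply: lt_le_trans kr _.
  exact: (Hz D).2.
have s_gt0 D : 0 < s D by exact: distance_gt0.
pose I (D : cells U N) := mdist cB (cell_center D) < 2 * kappa * rn.
have IT D : I D -> theta cB (cell_center D) <= eta (2 * KP) * T.
  move=> ID; apply: qs_le => //; first by rewrite mulr_gt0.
  by rewrite -mulrA; move: ID zB4; rewrite /I; glra.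
have sT D : I D -> s D <= eta (t k) * E5 * T.
  move=> ID; have hT := IT D ID.
  (* [cB] and [zB] are at least [KP^-1 * (kappa * rn)] apart, so one of them is at half that
     distance or more from the center of [D]. *)
  have [y hy1 hy2] : exists2 y, KP^-1 * (kappa * rn) / 2
      <= mdist (cell_center D) y & theta (cell_center D) y <= E5 * T.
    have [h|h] := leP (KP^-1 * (kappa * rn) / 2) (mdist (cell_center D) cB).
      by exists cB => //; move: hT T0; rewrite distance_sym /E5; glra.
    exists zB.
      have := metric_triangle cB (cell_center D) zB.
      move: h zB2; rewrite (metric_sym cB (cell_center D)); glra.
    apply: le_trans (distance_triangle _ cB _ _) _.
    by move: hT T0; rewrite (distance_sym _ _ cB) -/T /E5; glra.
  rewrite -mulrA; apply: (@le_trans _ _ (eta (t k) * theta (cell_center D) y)).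
    apply: qs_le => //; first by rewrite -mdist_gt0; apply: lt_le_trans hy1; move: zB3; glra.
    apply: le_trans (ltW (Hz D).1) _.
    apply: (@le_trans _ _ (t k * (KP^-1 * (kappa * rn) / 2))).
      rewrite le_eqVlt; apply/orP; left; apply/eqP; rewrite rE /t.
      have : KP * KP^-1 = 1 by rewrite divff ?gt_eqF.
      have : kappa * kappa^-1 = 1 by rewrite divff ?gt_eqF.
      move: (KP^-1) (kappa^-1) (b ^- k) => a1 a2 a3 h1 h2.
      transitivity ((KP * a1) * (kappa * a2) * a2 * (rn * a3)); last by glra.
      by rewrite h1 h2; glra.
    by rewrite ler_wpM2l// ltW.
  by rewrite ler_wpM2l// ltW// eta_gt0.
pose g D := if I D then E1 * s D else 0.
have g0 D : 0 <= g D by rewrite /g; case: ifP => // _; rewrite mulr_ge0 ?(ltW E10).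
pose rho D := E4 / T * g D.
have rho0 D : 0 <= rho D by rewrite /rho mulr_ge0 ?divr_ge0 ?(ltW E40) ?(ltW T0).
apply: le_trans (modulus_le _ rho0 _) _.
  move=> gamma [A [s0 [As BA nB gE]]].
  (* Repetitions are removed because the modulus counts each vertex once. *)
  have [s1 [As1 us1 ls1 ss1]] : exists s1, [/\
      path (@nerve_edge R X kappa b U lambda N) A s1, uniq (A :: s1),
      last A s1 = last A s0 & {subset s1 <= s0}].
    by case: (shortenP As) => s1 *; exists s1.
  have BAd := cell_dist n0 BA; rewrite -/cB -/rn in BAd.
  have IA : I A by move: BAd krn; rewrite /I; glra.
  have nIs : ~~ I (last A s1).
    apply/negP => h; apply: nB; rewrite -ls1 /dilate ballEmdist /=.
    exact: h.
  have [|D [nID hD]] := jump_sum (theta := theta) (c := @cell_center _ _ _ _ U N)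
    g0 _ IA nIs As1.
    move=> D D' ID /andP[_ /asboolP[y [Dy D'y]]]; rewrite /g ID.
    apply: qs_le => //; first by rewrite !mulr_gt0.
    move: Dy D'y; rewrite /dilate !ballEmdist /= -/r => Dy D'y.
    have := metric_triangle (cell_center D) y (cell_center D').
    rewrite (metric_sym y) => tr.
    apply: (@le_trans _ _ (2 * lambda * kappa * kappa * (kappa^-1 * r))).
      rewrite -[leRHS](_ : 2 * lambda * kappa * r = _); first by move: tr Dy D'y; glra.
      by rewrite -!mulrA (mulrA kappa kappa^-1) divff ?gt_eqF// mul1r.
    rewrite -[leRHS]mulrA; apply: ler_wpM2l; last exact: (Hz D).2.
    by apply: ltW; pos.
  apply: (@le_trans _ _ (\sum_(E in A :: s1) rho E)); last first.
    rewrite big_mkcond [leRHS]big_mkcond; apply: ler_sum => E _.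
    case: ifP => [|_]; last by case: ifP.
    rewrite in_cons gE => /orP[/eqP ->|/ss1 h]; first by rewrite mem_head.
    by rewrite in_cons h orbT.
  rewrite -big_uniq// -mulr_sumr.
  apply: (@le_trans _ _ (E4 / T * theta (cell_center A) (cell_center D))).
    2: by apply: ler_wpM2l hD; apply: divr_ge0; exact: ltW.
  rewrite mulrAC ler_pdivlMr// mul1r /E4 mulrDl.
  rewrite /I -leNgt in nID.
  have tr := metric_triangle cB (cell_center A) (cell_center D).
  have AD : cell_center A != cell_center D by rewrite -mdist_gt0; move: tr nID BAd krn; glra.
  apply: le_trans (distance_triangle _ (cell_center A) _ _) _.
  rewrite (distance_sym _ cB); apply: lerD; apply: qs_le => //.
    by rewrite (metric_sym (cell_center A) cB); move: tr nID BAd krn; glra.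
  have := metric_triangle (cell_center A) cB zB.
  move: tr nID BAd zB1; rewrite (metric_sym (cell_center A) cB); glra.
have mball (x : remetric theta) (c : R) : measurable (ball x c : set (borel x0)).
  by apply: borel_measurable_open; exact: mball_open.
have subb D w : theta (cell_center D) w < s D / E2 ->
    mdist (cell_center D) w < kappa^-1 * r.
  rewrite ltr_pdivlMr// => h; rewrite ltNge; apply/negP => h2.
  have : s D <= eta 1 * theta (cell_center D) w.
    apply: qs_le => //; first by rewrite -mdist_gt0; exact: lt_le_trans h2.
    by rewrite mul1r (le_trans (ltW (Hz D).1)).
  have := distance_ge0 theta (cell_center D) w.
  by move: h; rewrite /E2; glra.
have sumq : \sum_(D | I D) (s D / T) `^ q <= K2 / K1 * (E2 * E6) `^ q.
  have : (\sum_(D | I D) (K1 * (s D / E2) `^ q)%:E <=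
          (K2 * (E6 * T) `^ q)%:E)%E.
    apply: (@le_trans _ _ (mu (ball (cB : remetric theta) (E6 * T)))); last first.
      by apply: up; rewrite mulr_gt0.
    apply: (@le_trans _ _ (\sum_(D | I D)
        mu (ball (cell_center D : remetric theta) (s D / E2)))%E).
      apply: lee_sum => D ID; apply: low; first by rewrite divr_gt0.
      apply: (@le_trans _ _ (s D)%:E).
        by rewrite lee_fin ler_pdivrMr// ler_peMr// /E2; move: e10; glra.
      exact: (@diam_ge R (remetric theta) setT).
    apply: measure_finType_disjoint => //.
      move=> D D' _ _ [w []]; rewrite !ballEmdist => h1 h2.
      apply: (@cell_disjoint _ _ _ _ U N N0 D D' Logic.I Logic.I).
      by exists w; split; rewrite ballEmdist; apply: subb.
    move=> D ID w; rewrite !ballEmdist => h.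
    apply: (@le_lt_trans _ _ (eta (3 * KP) * T)); last first.
      by rewrite ltr_pM2r// /E6; glra.
    apply: qs_le => //; first by rewrite mulr_gt0.
    have := metric_triangle cB (cell_center D) w; have := subb D w h.
    rewrite -mulrA; move: ID zB4 krr krn; rewrite /I; glra.
  rewrite sumEFin lee_fin -mulr_sumr => h.
  rewrite !sum_powR_div// in h *; rewrite !powRM ?(ltW E60) ?(ltW T0) ?(ltW E20)// in h *.
  have Tq : 0 < T `^ q by exact: powR_gt0.
  have Eq : 0 < E2 `^ q by exact: powR_gt0.
  exact: ratio_bound h.
rewrite lee_fin.
apply: (@le_trans _ _ ((E4 * E1) `^ p * ((e' * E5) `^ (p - q) *
    \sum_(D | I D) (s D / T) `^ q))).
  rewrite (bigID I) /= [X in _ + X]big1 ?addr0; last first.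
    by move=> D /negbTE ID; rewrite /rho /g ID mulr0 powR0// gt_eqF.
  apply: (@le_trans _ _ ((E4 * E1) `^ p * \sum_(D | I D) (s D / T) `^ p)).
    rewrite mulr_sumr; apply: ler_sum => D ID; rewrite /rho /g ID.
    have -> : E4 / T * (E1 * s D) = E4 * E1 * (s D / T) by glra.
    by rewrite powRM ?mulr_ge0 ?(ltW E40) ?(ltW E10) ?invr_ge0 ?(ltW T0).
  apply: ler_wpM2l; first exact: powR_ge0.
  apply: sum_powR_le => // D ID; split; first by rewrite divr_gt0.
  rewrite ler_pdivrMr//; apply: le_trans (sT D ID) _.
  by do 2 (rewrite ler_pM2r; last by []); exact: ltW.
apply: (@le_trans _ _ ((E4 * E1) `^ p * ((e' * E5) `^ (p - q) *
    (K2 / K1 * (E2 * E6) `^ q)))).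
  by rewrite ler_wpM2l ?powR_ge0// ler_wpM2l ?powR_ge0.
rewrite /e' divfK ?gt_eqF// -powRrM mulVf ?gt_eqF// powRr1; last first.
  by rewrite !divr_ge0 ?(ltW e0)// ltW.
rewrite mulrCA -/Cst divfK ?gt_eqF//.
Qed.

Lemma Q_N_le_hausdorff_dim (R : realType) (X : metricType R) (kappa b : R)
    (U : coverings X kappa b) (theta : distance R X) (lambda : R) :
  1 < kappa -> 1 < b -> 0 < lambda -> compact [set: X] ->
  uniformly_perfect X -> (exists x y : X, x != y) ->
  ahlfors_regular (remetric theta) ->
  @quasisymmetric R X (remetric theta) idfun ->
  (Q_N U lambda <= hausdorff_dim [set: remetric theta])%E.
Proof.
move=> kappa1 b1 lambda0 Xc Xp Xxy [q [q0 qAR]] [[idc _] [eta [ebij einc _ eqs]]].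
have Tc : compact [set: remetric theta].
  rewrite -[setT](_ : (idfun : X -> remetric theta) @` setT = _).
    by apply: continuous_compact => //; exact: continuous_subspaceT.
  by rewrite image_id.
apply: le_ereal_inf_tmp => _ [s [s0 Hs] <-].
have qs : q <= s by exact: (hausdorff_measure0_dim Tc Xxy q0 qAR s0 Hs).
apply/lee_addgt0Pr => e e0; rewrite -EFinD.
have [x0 [mu [K1 [K2 [K10 K20 low up _]]]]] := ahlfors_bounds Tc Xxy q0 qAR.
apply: ereal_inf_lbound; exists (s + e) => //; split; first by rewrite addr_gt0.
apply: (@qs_limn_einf_paths _ _ _ _ U theta eta lambda (s + e) q K1 K2 x0 mu)
  => //.
by apply: (le_lt_trans qs); rewrite ltrDl.
Qed.

Lemma Q_N_le_conformal_dim (R : realType) (X : metricType R) (kappa b : R)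
    (U : coverings X kappa b) (lambda : R) :
  1 < kappa -> 1 < b -> 0 < lambda -> compact [set: X] ->
  uniformly_perfect X -> (exists x y : X, x != y) ->
  (Q_N U lambda <= ahlfors_regular_conformal_dim X)%E.
Proof.
move=> k1 b1 l0 Xc Xp Xxy; apply: le_ereal_inf_tmp => _ [theta [AR QS] <-].
exact: Q_N_le_hausdorff_dim.
Qed.

(** * Masses on the levels of the covering *)

(* The kernel charges the weights, plus a floor that is much smaller on the rim
   of the ball of radius 3r than near its center; what remains of the mass goes
   to one cell close to the center. *)
Lemma kernel_exists (R : realType) (X : metricType R) (V W : finType)
    (cV : V -> X) (cW : W -> X) (w : V -> W -> R) (star : V -> W) (r : R)
    (N : nat) (f f' : R) :
  0 < r -> (0 < N)%N -> f = (4 * N%:R)^-1 -> f' = f / (2 * N%:R) ->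
  (forall B A, 0 <= w B A) -> (forall B, \sum_A w B A <= 1 / 2) ->
  (forall B A, 2 * r < mdist (cV B) (cW A) -> w B A = 0) ->
  (forall B, mdist (cV B) (cW (star B)) <= r) ->
  (forall B, (#|[pred A | (mdist (cV B) (cW A) <= 3 * r)%R]| <= N)%N) ->
  exists P : V -> W -> R, [/\
    forall B A, 0 <= P B A,
    forall B, \sum_A P B A = 1,
    forall B A, w B A <= P B A,
    forall B A, 2 * r < mdist (cV B) (cW A) -> P B A <= f' &
    [/\ forall B A, 3 * r < mdist (cV B) (cW A) -> P B A = 0,
      forall B A, mdist (cV B) (cW A) <= 3 * r -> f' <= P B A &
      forall B A, mdist (cV B) (cW A) <= r -> f <= P B A]].
Proof.
move=> r0 N0 fE f'E w0 wsum wsupp star_near count.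
have NR : 0 < N%:R :> R by rewrite ltr0n.
have N1 : 1 <= N%:R :> R by rewrite ler1n.
have f0 : 0 < f by rewrite fE; pos.
have f'0 : 0 < f' by rewrite f'E; pos.
have Nf : N%:R * f = 4^-1.
  by rewrite fE invfM mulrCA divff ?mulr1// gt_eqF.
have Nf' : N%:R * f' = f / 2.
  rewrite f'E invfM; have : N%:R * N%:R^-1 = 1 :> R by rewrite divff ?gt_eqF.
  move: (N%:R^-1) => n1 h; transitivity ((N%:R * n1) * f / 2); first by glra.
  by rewrite h; glra.
pose near t B A := mdist (cV B) (cW A) <= t * r.
have near_sum (t g : R) B : t <= 3 -> 0 <= g ->
    \sum_A (if near t B A then g else 0) <= N%:R * g.
  move=> t3 g0; rewrite -big_mkcond sumr_const -[leLHS]mulr_natl.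
  rewrite ler_wpM2r// ler_nat; apply: leq_trans (count B).
  apply: subset_leq_card; apply/fintype.subsetP => A; rewrite !inE /near => h.
  by apply: le_trans h _; rewrite ler_wpM2r// ltW.
(* The weights take at most 1/2, the floor [f'] at most [f / 2 <= 1 / 8] and the floor [f] at most
   1/4, so a nonnegative rest remains for [star B]. *)
pose P0 B A := w B A + (if near 3 B A then f' else 0)
  + (if near 1 B A then f else 0).
have P00 B A : 0 <= P0 B A.
  by rewrite /P0; have := w0 B A; case: ifP => _; case: ifP => _; move: f0 f'0; glra.
have P0w B A : w B A <= P0 B A.
  by rewrite /P0; case: ifP => _; case: ifP => _; move: f0 f'0; glra.
have P01 B : \sum_A P0 B A <= 1.
  rewrite /P0 !big_split /=; have := wsum B.
  have := near_sum 3 f' B (lexx _) (ltW f'0).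
  have := near_sum 1 f B _ (ltW f0); rewrite Nf Nf'.
  have : f <= 4^-1 by rewrite -Nf ler_peMl// ltW.
  have h13 : 1 <= 3 :> R by lra.
  move: (\sum_A _) (\sum_A _) (\sum_A _) => a1 a2 a3 h1 /(_ h13).
  by move: h1; glra.
pose P B A := P0 B A + if A == star B then 1 - \sum_A' P0 B A' else 0.
have PP0 B A : P0 B A <= P B A.
  by rewrite /P; case: ifP => _; have := P01 B; glra.
have far B A : r < mdist (cV B) (cW A) -> P B A = P0 B A.
  move=> h; rewrite /P ifF ?addr0//; apply/negP => /eqP AE.
  by move: h; rewrite AE ltNge star_near.
have n1 B A : r < mdist (cV B) (cW A) -> near 1 B A = false.
  by move=> h; rewrite /near mul1r leNgt h.
exists P; split.
- by move=> B A; exact: le_trans (PP0 B A).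
- move=> B; rewrite /P big_split /= -big_mkcond big_pred1_eq.
  by rewrite addrC subrK.
- by move=> B A; exact: le_trans (PP0 B A).
- move=> B A h; have h1 : r < mdist (cV B) (cW A) by move: h r0; glra.
  rewrite far// /P0 wsupp// n1//; case: ifP => _; move: f'0; glra.
split.
- move=> B A h; have h1 : r < mdist (cV B) (cW A) by move: h r0; glra.
  have h2 : 2 * r < mdist (cV B) (cW A) by move: h r0; glra.
  by rewrite far// /P0 wsupp// n1// /near leNgt h /= !addr0.
- move=> B A h; apply: le_trans (PP0 B A); rewrite /P0 /near h.
  by have := w0 B A; case: ifP => _; move: f0 f'0; glra.
- move=> B A h; apply: le_trans (PP0 B A); rewrite /P0 /near mul1r h.
  by have := w0 B A; case: ifP => _; move: f0 f'0; glra.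
Qed.

(** The constant [K = 2 / f'] reproduces itself. Sources within [3 * r] of [A'] give [A'] at least
    the fraction [f'] of their mass, so they contribute to [A] at most [f'^-1 = K / 2] times the
    mass of [A']. The others give [A] at most the fraction [f'] each, at most [N] of them give
    anything, and their masses are at most [K] times that of a cell [B'] near [A']; as
    [N * f' = f / 2], they account for the other [K / 2]. *)
Lemma harnack_step (R : realType) (X : metricType R) (V W : finType)
    (cV : V -> X) (cW : W -> X) (P : V -> W -> R) (mu : V -> R) (r r' H : R)
    (N : nat) (f f' K : R) :
  0 < r -> (0 < N)%N -> 0 < f -> f' = f / (2 * N%:R) -> K = 2 / f' ->
  5 <= H -> H * r' <= r ->
  (forall B A, 0 <= P B A) -> (forall B, \sum_A P B A = 1) ->
  (forall B A, 2 * r < mdist (cV B) (cW A) -> P B A <= f') ->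
  (forall B A, 3 * r < mdist (cV B) (cW A) -> P B A = 0) ->
  (forall B A, mdist (cV B) (cW A) <= 3 * r -> f' <= P B A) ->
  (forall B A, mdist (cV B) (cW A) <= r -> f <= P B A) ->
  (forall A, exists B, mdist (cV B) (cW A) <= r) ->
  (forall A, (#|[pred B | (mdist (cV B) (cW A) <= 3 * r)%R]| <= N)%N) ->
  (forall B, 0 < mu B) ->
  (forall B B', mdist (cV B) (cV B') <= H * r -> mu B <= K * mu B') ->
  forall A A', mdist (cW A) (cW A') <= H * r' ->
    \sum_B mu B * P B A <= K * \sum_B mu B * P B A'.
Proof.
move=> r0 N0 f0 f'E KE H5 Hr P0 P1 Pfar Psupp Pf' Pf cover count mu0 muK A A' AA'.
have NR : 0 < N%:R :> R by rewrite ltr0n.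
have f'0 : 0 < f' by rewrite f'E; pos.
have K0 : 0 < K by rewrite KE; pos.
have PA1 B E : P B E <= 1.
  by rewrite -(P1 B) (bigD1 E)//= lerDl sumr_ge0.
have AA'r : mdist (cW A) (cW A') <= r by exact: le_trans Hr.
set S := \sum_B mu B * P B A'.
rewrite (bigID (fun B => mdist (cV B) (cW A') <= 3 * r)) /=.
have S1 : \sum_(B | mdist (cV B) (cW A') <= 3 * r) mu B * P B A <= f'^-1 * S.
  rewrite /S mulr_sumr big_mkcond; apply: ler_sum => B _; case: ifP => h.
    rewrite mulrCA ler_wpM2l ?(ltW (mu0 B))//; apply: le_trans (PA1 B A) _.
    by rewrite mulrC ler_pdivlMr// mul1r Pf'.
  apply: mulr_ge0; first by rewrite invr_ge0 ltW.
  by apply: mulr_ge0 => //; exact: ltW.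
have [B' B'A'] := cover A'.
have SB' : f * mu B' <= S.
  apply: (@le_trans _ _ (mu B' * P B' A')).
    by rewrite mulrC ler_wpM2l ?(ltW (mu0 _))// Pf.
  rewrite /S (bigD1 B')//= lerDl; apply: sumr_ge0 => B _.
  by apply: mulr_ge0 => //; exact: ltW.
have S2 : \sum_(B | ~~ (mdist (cV B) (cW A') <= 3 * r)) mu B * P B A
    <= K / 2 * S.
  apply: (@le_trans _ _
    (\sum_(B | mdist (cV B) (cW A) <= 3 * r) K * mu B' * f')).
    rewrite big_mkcond [leRHS]big_mkcond; apply: ler_sum => B _.
    have c0 : 0 <= K * mu B' * f' by apply: ltW; have muB := mu0 B'; pos.
    case: ifPn => h; last by case: ifP.
    rewrite -ltNge in h; case: ifPn => h2; last first.
      by rewrite Psupp ?mulr0// ltNge.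
    have tr1 := metric_triangle (cV B) (cW A) (cW A').
    apply: ler_pM => //; first exact: ltW.
      apply: muK; have tr2 := metric_triangle (cV B) (cW A) (cV B').
      have tr3 := metric_triangle (cW A) (cW A') (cV B').
      (* Three radii to [A], one to [A'], one to [B']. *)
      have h5 : 5 * r <= H * r by rewrite ler_pM2r.
      rewrite (metric_sym (cW A') (cV B')) in tr3.
      by move: tr2 tr3 h5 h2 AA'r B'A'; glra.
    by apply: Pfar; move: tr1 h AA'r; glra.
  rewrite sumr_const -[leLHS]mulr_natl.
  apply: (@le_trans _ _ (N%:R * (K * mu B' * f'))).
    rewrite ler_wpM2r ?ler_nat ?count//.
    by apply: ltW; have muB := mu0 B'; pos.
  have -> : N%:R * (K * mu B' * f') = K / 2 * (f * mu B').
    rewrite f'E invfM.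
    have : N%:R * N%:R^-1 = 1 :> R by rewrite divff ?gt_eqF.
    move: (N%:R^-1) => n1 h.
    transitivity ((N%:R * n1) * (K * mu B' * f / 2)); first by glra.
    by rewrite h; glra.
  by rewrite ler_wpM2l// divr_ge0// ltW.
apply: le_trans (lerD S1 S2) _.
rewrite -mulrDl le_eqVlt; apply/orP; left; apply/eqP; congr (_ * _).
by rewrite KE; glra.
Qed.

(** Choice for dependent families, as the type of cells changes with the level. *)
Lemma dependent_function_choice (I : Type) (T : I -> Type)
    (Q : forall i, T i -> Prop) :
  (forall i, exists t, Q i t) -> exists f, forall i, Q i (f i).
Proof.
by move=> H; exists (fun i => sval (cid (H i))) => i; exact: svalP.
Qed.

(** Level 0 carries the uniform mass, for which the comparison is trivial; [harnack_step] propagates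
    it with the same constant. *)
Lemma doubling_mass (R : realType) (X : metricType R) (V : nat -> finType)
    (c : forall j, V j -> X) (r : nat -> R) (H : R) (N : nat)
    (w : forall j, V j -> V j.+1 -> R) :
  [set: X] !=set0 -> (forall j, 0 < r j) -> (0 < N)%N -> 5 <= H ->
  (forall j, H * r j.+1 <= r j) ->
  (forall j x, exists A : V j, mdist (c j A) x <= r j) ->
  (forall j x, (#|[pred A : V j.+1 | (mdist x (c _ A) <= 3 * r j)%R]| <= N)%N) ->
  (forall j x, (#|[pred B : V j | (mdist x (c _ B) <= 3 * r j)%R]| <= N)%N) ->
  (forall j B A, 0 <= w j B A) -> (forall j B, \sum_A w j B A <= 1 / 2) ->
  (forall j B A, 2 * r j < mdist (c _ B) (c _ A) -> w j B A = 0) ->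
  exists (mu : forall j, V j -> R) (P : forall j, V j -> V j.+1 -> R) (f K : R),
  [/\ 0 < f, 0 < K,
    [/\ forall j A, 0 < mu j A, forall j, \sum_A mu j A = 1,
      forall A A', mu 0%N A = mu 0%N A' &
      forall j A A', mdist (c j A) (c j A') <= H * r j ->
        mu j A <= K * mu j A'],
    [/\ forall j B A, 0 <= P j B A, forall j B, \sum_A P j B A = 1,
      forall j B A, 3 * r j < mdist (c _ B) (c _ A) -> P j B A = 0 &
      forall j A, mu j.+1 A = \sum_B mu j B * P j B A] &
    (forall j B A, w j B A * mu j B <= mu j.+1 A) /\
    forall j B A, mdist (c _ B) (c _ A) <= 3 * r j -> f * mu j B <= mu j.+1 A].
Proof.
move=> [x0 _] r0 N0 H5 Hr cover count1 count0 w0 wsum wsupp.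
have NR : 0 < N%:R :> R by rewrite ltr0n.
have N1 : 1 <= N%:R :> R by rewrite ler1n.
have rS j : r j.+1 <= r j.
  apply: le_trans (Hr j); rewrite ler_peMl// ?(ltW (r0 _))//.
  by move: H5; glra.
pose f := (4 * N%:R : R)^-1; pose f' := f / (2 * N%:R).
have f0 : 0 < f by rewrite /f; pos.
have f'0 : 0 < f' by rewrite /f'; pos.
have exstar j : exists star : V j -> V j.+1,
    forall B, mdist (c _ B) (c _ (star B)) <= r j.
  have /choice[s Hs] : forall B : V j, exists A : V j.+1,
      mdist (c _ A) (c _ B) <= r j.+1 by move=> B; exact: cover.
  by exists s => B; rewrite metric_sym; exact: le_trans (Hs B) (rS j).
have [star Hstar] := dependent_function_choice exstar.
have [P HP] := dependent_function_choice (fun j =>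
  kernel_exists (r0 j) N0 (erefl f) (erefl f') (w0 j) (wsum j)
  (wsupp j) (Hstar j) (fun B => count1 j (c j B))).
pose mu := fix mu j : V j -> R := match j return V j -> R with
  | 0%N => fun=> (#|V 0%N|%:R)^-1
  | j'.+1 => fun A => \sum_B mu j' B * P j' B A end.
have muS j A : mu j.+1 A = \sum_B mu j B * P j B A by [].
have V0 : (0 < #|V 0%N|)%N by apply/card_gt0P; have [A _] := cover 0%N x0; exists A.
have mu0 j : forall A, 0 < mu j A.
  elim: j => [|j IH] A; first by rewrite invr_gt0 ltr0n.
  have [P0 _ _ _ [_ _ Pf]] := HP j.
  have [B BA] := cover j (c _ A).
  rewrite muS (bigD1 B)//=; apply: ltr_wpDr.
    by apply: sumr_ge0 => B' _; rewrite mulr_ge0 ?(ltW (IH _)).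
  by apply: mulr_gt0 => //; apply: lt_le_trans f0 (Pf _ _ BA).
pose K := 2 / f'.
have K0 : 0 < K by rewrite /K; pos.
have K1 : 1 <= K.
  rewrite ler_pdivlMr// mul1r.
  have : N%:R * f = 4^-1.
    by rewrite /f invfM mulrCA divff ?mulr1// gt_eqF.
  have : f <= N%:R * f by rewrite ler_peMl// (ltW f0).
  have : f' <= f.
    by rewrite /f' ler_pdivrMr ?mulr_gt0// ler_peMr ?(ltW f0)//; move: N1; glra.
  by glra.
have ge0P j B A : 0 <= mu j B * P j B A.
  by have [P0 _ _ _ _] := HP j; rewrite mulr_ge0 ?(ltW (mu0 _ _)).
exists mu, P, f', K; split => //.
- split => //.
  + elim=> [|j IH].
      by rewrite /= sumr_const -[LHS]mulr_natl divff// pnatr_eq0 -lt0n.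
    rewrite /= exchange_big /=; rewrite -[RHS]IH; apply: eq_bigr => B _.
    by rewrite -mulr_sumr; have [_ -> _ _ _] := HP j; rewrite mulr1.
  + elim=> [|j IH] A A' AA'; first by rewrite /= ler_peMl ?invr_ge0.
    have [P0 P1 Pw Pfar [Psupp Pf' Pf]] := HP j.
    apply: (harnack_step (r0 j) N0 f0 (erefl f') (erefl K) H5 (Hr j) P0 P1
      Pfar Psupp Pf' Pf (fun E => cover j _) _ (mu0 j) IH AA') => E.
    rewrite (eq_card (B := [pred B | mdist (c _ E) (c _ B) <= 3 * r j])).
      exact: count0.
    by move=> B; rewrite !inE metric_sym.
- by split => //; [move=> j|move=> j|move=> j]; case: (HP j) => // _ _ _ _ [].
have muP j B A : mu j B * P j B A <= mu j.+1 A.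
  by rewrite muS (bigD1 B)//= lerDl sumr_ge0.
split => [j B A|j B A h].
  apply: le_trans (muP j B A); rewrite mulrC ler_wpM2l ?(ltW (mu0 _ _))//.
  by have [_ _ Pw _ _] := HP j.
apply: le_trans (muP j B A); rewrite mulrC ler_wpM2l ?(ltW (mu0 _ _))//.
by have [_ _ _ _ [_ Pf' _]] := HP j; exact: Pf'.
Qed.

(** * Random coding of the masses and their limit *)

Section InverseCdf.
Context {R : realType}.

(** Intervals of lengths [q A], laid end to end in the order of [enum_rank], tile [0, 1[; [pick]
    reads the interval containing [u]. *)
Lemma inverse_cdf (W : finType) (q : W -> R) : (forall A, 0 <= q A) ->
  \sum_A q A = 1 -> exists (F : W -> R) (pick : R -> W),
  [/\ forall A, 0 <= F A, forall A, F A + q A <= 1 &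
    forall u, 0 <= u -> u < 1 -> forall A,
      pick u = A <-> F A <= u /\ u < F A + q A].
Proof.
move=> q0 q1.
pose G (n : nat) := \sum_(A | (enum_rank A < n)%N) q A.
pose F (A : W) := G (enum_rank A).
have GS A : G (enum_rank A).+1 = F A + q A.
  rewrite /F /G [LHS](bigD1 A) ?ltnSn//= addrC; congr (_ + _).
  apply: eq_bigl => A'; rewrite ltnS leq_eqVlt.
  case: (eqVneq A' A) => [->|AA']; first by rewrite ltnn andbF.
  by rewrite andbT (inj_eq val_inj) (inj_eq enum_rank_inj) (negbTE AA').
have Gmono m n : (m <= n)%N -> G m <= G n.
  move=> mn; rewrite /G big_mkcond [leRHS]big_mkcond; apply: ler_sum => A _.
  case: ifP => [h|_]; first by rewrite (leq_trans h mn).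
  by case: ifP.
have G0 : G 0%N = 0 by rewrite /G big_pred0.
have G1 : G #|W| = 1.
  by rewrite -q1; apply: eq_bigl => A; rewrite ltn_ord.
have ex (u : R) : 0 <= u -> u < 1 -> exists A, F A <= u /\ u < F A + q A.
  move=> u0 u1; have exn : exists n, u < G n by exists #|W|; rewrite G1.
  case: (ex_minnP exn) => [[|n]]; first by rewrite G0 ltNge u0.
  move=> un nmin.
  have nW : (n < #|W|)%N by apply: nmin; rewrite G1.
  exists (enum_val (Ordinal nW)); rewrite -GS /F enum_valK /=; split => //.
  by rewrite leNgt; apply/negP => /nmin; rewrite ltnn.
have /choice[pick Hpick] : forall u : R, exists A, 0 <= u -> u < 1 ->
    F A <= u /\ u < F A + q A.
  move=> u; have [u0|u0] := leP 0 u; last first.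
    have [A _] := ex 0 (lexx _) ltr01.
    by exists A.
  have [u1|u1] := ltP u 1; first by have [A hA] := ex u u0 u1; exists A.
  by have [A _] := ex 0 (lexx _) ltr01; exists A.
exists F, pick; split.
- by move=> A; apply: sumr_ge0.
- by move=> A; rewrite -GS -G1; apply: Gmono; exact: ltn_ord.
move=> u u0 u1 A; split => [<-|[h1 h2]]; first exact: Hpick.
have [g1 g2] := Hpick u u0 u1; apply: enum_rank_inj; apply: val_inj.
apply/eqP; rewrite eqn_leq; apply/andP; split; rewrite leqNgt; apply/negP => h.
  have := Gmono _ _ h; rewrite GS -/(F _) => h3.
  by have := lt_le_trans h2 (le_trans h3 g1); rewrite ltxx.
have := Gmono _ _ h; rewrite GS -/(F _) => h3.
by have := lt_le_trans g2 (le_trans h3 h1); rewrite ltxx.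
Qed.
End InverseCdf.

(* [g] sends Lebesgue measure on [0, 1[ to the product of [mu] with Lebesgue
   measure: the second component is the randomness left for further choices. *)
Definition codes (R : realType) (V : finType) (mu : V -> R) (g : R -> V * R) :=
  (forall t, 0 <= t < 1 -> 0 <= (g t).2 < 1) /\
  forall B a b, 0 <= a -> a <= b -> b <= 1 ->
    let S := [set t | [/\ 0 <= t < 1, (g t).1 = B & a <= (g t).2 < b]] in
    measurable S /\ lebesgue_measure S = (mu B * (b - a))%:E.

(** The second component selects the next cell by the inverse distribution function of [P B]; its
    position in the selected interval, rescaled to [0, 1[, is again uniform and independent of the
    choice. *)
Lemma code_step (R : realType) (V W : finType) (mu : V -> R)
    (P : V -> W -> R) (g : R -> V * R) : codes mu g ->
  (forall B A, 0 <= P B A) -> (forall B, \sum_A P B A = 1) ->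
  exists g' : R -> W * R, codes (fun A => \sum_B mu B * P B A) g' /\
    forall t, 0 <= t < 1 -> 0 < P (g t).1 (g' t).1.
Proof.
move=> [g01 gS] P0 P1.
have /choice[F /choice[pick HF]] : forall B, exists F pick, _ :=
  fun B => inverse_cdf (P0 B) (P1 B).
pose g' t := let A := pick (g t).1 (g t).2 in
  (A, ((g t).2 - F (g t).1 A) / P (g t).1 A).
have Ppos t : 0 <= t < 1 -> 0 < P (g t).1 (g' t).1.
  move=> /g01/andP[u0 u1]; rewrite /g' /=.
  have [_ _ /(_ _ u0 u1 _)/iffLR/(_ erefl)[]] := HF (g t).1.
  by move: (P _ _) (F _ _) => *; lra.
exists g'; split => //; split.
  move=> t t01; have Pt := Ppos t t01; have /andP[u0 u1] := g01 t t01.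
  have [_ _ /(_ _ u0 u1 _)/iffLR/(_ erefl)[h1 h2]] := HF (g t).1.
  rewrite /g' /= in Pt *; rewrite divr_ge0 ?subr_ge0//= ?(ltW Pt)//.
  by rewrite ltr_pdivrMr// mul1r; move: h2; lra.
move=> A a b a0 ab b1 S'.
pose S B := [set t | [/\ 0 <= t < 1, (g t).1 = B &
  F B A + P B A * a <= (g t).2 < F B A + P B A * b]].
have SB B : measurable (S B) /\
    lebesgue_measure (S B) = (mu B * (P B A * (b - a)))%:E.
  have [F0 F1 _] := HF B.
  have [|||mS ES] := gS B (F B A + P B A * a) (F B A + P B A * b).
  - by rewrite addr_ge0// mulr_ge0.
  - by rewrite lerD2l ler_wpM2l.
  - apply: le_trans (F1 A); by rewrite lerD2l ler_piMr.
  split => //; apply: eq_trans ES _; congr (_ %:E); lra.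
have -> : S' =
    \bigcup_(B in [set` [pred B : V | true]]) S B.
  apply/seteqP; split => [t [t01 tA ab']|t [B _ [t01 tB FB]]].
    exists (g t).1 => //; split => //; have Pt := Ppos t t01.
    move: Pt ab'; rewrite tA /g' /=; rewrite /g' /= in tA; rewrite tA => Pt.
    by rewrite ler_pdivlMr// ltr_pdivrMr// => /andP[h1 h2]; apply/andP; split; lra.
  have /andP[u0 u1] := g01 t t01.
  have /andP[FB1 FB2] := FB; have PB := P0 B A.
  have [_ _ /(_ _ u0 u1 A)/iffRL pA] := HF B.
  have Pa : 0 <= P B A * a by rewrite mulr_ge0.
  have Pb : P B A * b <= P B A by rewrite ler_piMr.
  have tA : (g' t).1 = A.
    rewrite /g' /= tB; apply: pA; split; lra.
  have Pt := Ppos t t01; rewrite tA tB in Pt.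
  split => //; rewrite /g' /= in tA *; rewrite tA tB.
  by rewrite ler_pdivlMr// ltr_pdivrMr//; apply/andP; split; lra.
split.
  by apply: fin_bigcup_measurable => [|B _]; [exact: finite_finset|case: (SB B)].
rewrite measure_finType_bigcup; last 2 first.
- by move=> B _; case: (SB B).
- by move=> B B' _ _ [t [[_ <- _] [_ <- _]]].
rewrite mulr_suml -sumEFin; apply: eq_bigr => B _.
by have [_ E] := SB B; apply: eq_trans E _; rewrite mulrA.
Qed.

(** A Markov chain with kernels [P], run on a single uniform variable. Transitions have positive
    probability for every [t], not just almost every one, so that limits of centers exist everywhere
    on [0, 1[. *)
Lemma code_exists (R : realType) (V : nat -> finType) (mu : forall j, V j -> R)
    (P : forall j, V j -> V j.+1 -> R) :
  (forall A, 0 <= mu 0%N A) -> \sum_A mu 0%N A = 1 ->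
  (forall j B A, 0 <= P j B A) -> (forall j B, \sum_A P j B A = 1) ->
  (forall j A, mu j.+1 A = \sum_B mu j B * P j B A) ->
  exists code : forall j, R -> V j,
  (forall j A, let S := [set t | 0 <= t < 1 /\ code j t = A] in
    measurable S /\ lebesgue_measure S = (mu j A)%:E) /\
  forall j t, 0 <= t < 1 -> 0 < P j (code j t) (code j.+1 t).
Proof.
move=> mu00 mu01 P0 P1 muS.
have base : codes (fun _ : unit => 1) (fun t : R => (tt, t)).
  split => // -[] a b a0 ab b1 /=.
  have -> : [set t : R | [/\ 0 <= t < 1, tt = tt & a <= t < b]] =
      [set` `[a, b[].
    apply/seteqP; split => t /=; rewrite in_itv /=; first by case.
    move=> /andP[h1 h2]; split => //; last by rewrite h1.
    by rewrite (le_trans a0 h1) (lt_le_trans h2 b1).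
  split; first exact: measurable_itv.
  rewrite lebesgue_measure_itv /= lte_fin; case: ltgtP ab => // [_|->] _.
    by rewrite mul1r EFinD.
  by rewrite subrr mulr0.
have [g0 [cg0 _]] := code_step base (fun _ => mu00) (fun _ => mu01).
have {}cg0 : codes (mu 0%N) g0.
  rewrite (_ : mu 0%N = fun A => \sum_(B : unit) 1 * mu 0%N A)//.
  by apply/funext => A; rewrite (bigD1 tt)//= mul1r big1 ?addr0// => -[].
have ex_codes j : exists g, codes (mu j) g.
  elim: j => [|j [g cg]]; first by exists g0.
  have [g' [cg' _]] := code_step cg (P0 j) (P1 j); exists g'.
  rewrite (_ : mu j.+1 = fun A => \sum_B mu j B * P j B A)//.
  by apply/funext => A; exact: muS.
(* The step is made total, with an arbitrary value off [codes], so that a [fix] can iterate it. *)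
have [G HG] : exists G : forall j, (R -> V j * R) -> (R -> V j.+1 * R),
    forall j g, codes (mu j) g -> codes (mu j.+1) (G j g) /\
      forall t, 0 <= t < 1 -> 0 < P j (g t).1 (G j g t).1.
  apply: (@dependent_function_choice nat
    (fun j => (R -> V j * R) -> (R -> V j.+1 * R))
    (fun j Gj => forall g, codes (mu j) g -> codes (mu j.+1) (Gj g) /\
      forall t, 0 <= t < 1 -> 0 < P j (g t).1 (Gj g t).1)) => j.
  have [gj cgj] := ex_codes j.+1; pose x0 := (gj 0).1.
  have /choice[Gj HGj] : forall g : R -> V j * R, exists g' : R -> V j.+1 * R,
      codes (mu j) g -> codes (mu j.+1) g' /\
      forall t, 0 <= t < 1 -> 0 < P j (g t).1 (g' t).1.
    move=> g; have [cg|ncg] := pselect (codes (mu j) g); last first.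
      by exists (fun=> (x0, 0)).
    have [g' [cg' Pg']] := code_step cg (P0 j) (P1 j).
    exists g' => _; split => //.
    rewrite (_ : mu j.+1 = fun A => \sum_B mu j B * P j B A)//.
    by apply/funext => A; exact: muS.
  by exists Gj.
pose g := fix g j : R -> V j * R := match j return R -> V j * R with
  | 0%N => g0 | j'.+1 => G j' (g j') end.
have cg j : codes (mu j) (g j).
  by elim: j => [//|j IH]; case: (HG j (g j) IH).
exists (fun j t => (g j t).1); split; last first.
  by move=> j t t01; have [_ ] := HG j (g j) (cg j); apply.
move=> j A S; have [g01 gS] := cg j.
have := gS A 0 1 (lexx _) ler01 (lexx _) => /=.
rewrite subr0 mulr1; suff -> : [set t | [/\ 0 <= t < 1, (g j t).1 = A &
  0 <= (g j t).2 < 1]] = S by [].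
by apply/seteqP; split => [t []|t [t01 tA]] //; split => //; exact: g01.
Qed.

Section MeasureImage.
Context {d1 d2} {T1 : measurableType d1} {T2 : measurableType d2}
  {R : realType}.
Variables (mu : {measure set T1 -> \bar R}) (f : T1 -> T2).
Hypothesis mf : measurable_fun setT f.

Let f_mixin := isMeasurableFun.Build _ _ _ _ _ mf.
Let f_mfun : {mfun _ >-> _} := HB.pack f f_mixin.

Lemma image_measure_exists : exists nu : {measure set T2 -> \bar R},
  forall A, nu A = mu (f @^-1` A).
Proof.
pose nu : {measure set T2 -> \bar R} := pushforward mu f_mfun.
by exists (nu mf).
Qed.
End MeasureImage.

Lemma halving_small (R : realType) (r : nat -> R) :
  (forall j, 0 < r j) -> (forall j, r j.+1 <= r j / 2) ->
  forall e, 0 < e -> exists j, r j < e.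
Proof.
move=> r0 rh e e0.
have rj j : r j <= r 0%N / 2 ^+ j.
  elim: j => [|j IH]; first by rewrite expr0 divr1.
  by rewrite exprSr invfM mulrA; move: (rh j) IH; glra.
exists (Num.truncn (r 0%N / e)); apply: le_lt_trans (rj _) _.
rewrite ltr_pdivrMr ?exprn_gt0// -ltr_pdivrMl// mulrC.
apply: lt_le_trans (truncnS_gt _) _; rewrite -natrX ler_nat.
exact: ltn_expl.
Qed.

(** [nu] is the law of the image under [g] of the limit of the random centers. Transitions of
    positive probability move by at most [3 * r j], so the limit is within [6 * r j] of the cell
    coded at level [j], and both inequalities compare subsets of [0, 1[. Through [g] the law can be
    read for another distance on X. *)
Lemma limit_measure (R : realType) (X : metricType R) (V : nat -> finType)
    (c : forall j, V j -> X) (r : nat -> R) (mu : forall j, V j -> R)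
    (P : forall j, V j -> V j.+1 -> R) (T : topologicalType) (g : X -> T)
    (x0 : T) :
  compact [set: X] -> continuous g ->
  (forall j, 0 < r j) -> (forall j, r j.+1 <= r j / 2) ->
  (forall A, 0 <= mu 0%N A) -> \sum_A mu 0%N A = 1 ->
  (forall j B A, 0 <= P j B A) -> (forall j B, \sum_A P j B A = 1) ->
  (forall j A, mu j.+1 A = \sum_B mu j B * P j B A) ->
  (forall j B A, 3 * r j < mdist (c _ B) (c _ A) -> P j B A = 0) ->
  exists nu : {measure set (borel x0) -> \bar R},
  [/\ nu setT = 1%E,
    forall j (Q : pred (V j)) (E : set (borel x0)), measurable E ->
      (forall A x, Q A -> mdist (c j A) x <= 6 * r j -> E (g x)) ->
      ((\sum_(A | Q A) mu j A)%:E <= nu E)%E &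
    forall j (Q : pred (V j)) (E : set (borel x0)), measurable E ->
      (forall A x, E (g x) -> mdist (c j A) x <= 6 * r j -> Q A) ->
      (nu E <= (\sum_(A | Q A) mu j A)%:E)%E].
Proof.
move=> Xc gc r0 rh mu00 mu01 P0 P1 muS Psupp.
have [code [Scode Pcode]] := code_exists mu00 mu01 P0 P1 muS.
pose D := [set t : R | 0 <= t < 1].
have DE : D = [set` `[0, 1[] by apply/seteqP; split => t /=; rewrite in_itv.
have mD : measurable D by rewrite DE; exact: measurable_itv.
have /choice[f Hf] : forall t : R, exists l, D t ->
    forall j, mdist (c j (code j t)) l <= 6 * r j.
  move=> t; have [Dt|nDt] := pselect (D t); last by exists (c _ (code 0%N 0)).
  have [||l Hl] := @compact_geometric_limit _ _ (fun j => c j (code j t))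
      (fun j => 3 * r j) Xc.
  - move=> j; rewrite leNgt; apply/negP => /Psupp P00.
    by have := Pcode j t Dt; rewrite P00 ltxx.
  - by move=> j; move: (rh j); glra.
  by exists l => _ j; move: (Hl j); glra.
pose S j A := [set t : R | 0 <= t < 1 /\ code j t = A].
have mS j A : measurable (S j A) by case: (Scode j A).
(* Off [0, 1[, which the restricted measure ignores, a constant keeps [F] measurable. *)
pose F (t : R) : borel x0 := if 0 <= t < 1 then g (f t) else g (f 0).
have FD t : D t -> F t = g (f t) by rewrite /F /D /= => ->.
have mF : measurable_fun setT (F : measurableTypeR R -> borel x0).
  apply: (@measurability _ _ (measurableTypeR R) (borel x0) setT F
    (open : set (set (based x0)))) => // _ [W oW <-].
  rewrite setTI.
  have oV : open (g @^-1` W).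
    by apply: open_comp => // x _; exact: gc.
  (* A limit in an open set is detected at a finite level: the coded cell has its whole ball of
     radius [6 * r j] inside the preimage. *)
  have -> : F @^-1` W = (\bigcup_j \bigcup_(A in [set` [pred A : V j |
      `[< forall x, mdist (c j A) x <= 6 * r j -> W (g x) >]]]) S j A) `|`
      (if pselect (W (g (f 0))) then ~` D else set0).
    apply/seteqP; split => t.
      move=> Ot; have [Dt|nDt] := pselect (D t); last first.
        right; move: Ot; rewrite /preimage /= /F.
        case: ifP => // _ h; by case: pselect.
      left; move: Ot; rewrite /preimage /= FD// => Ot.
      have : nbhs (f t) (g @^-1` W) by exact: open_nbhs_nbhs.
      move=> /nbhs_ballP[e /= e0 He].
      have [j Hj] := halving_small r0 rh (divr_gt0 e0 (ltr0n R 12)).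
      exists j => //; exists (code j t) => //=.
      apply/asboolP => x hx; apply: He; rewrite ballEmdist /=.
      have := Hf t Dt j; have := metric_triangle (f t) (c j (code j t)) x.
      by rewrite (metric_sym (f t) (c _ _)); move: hx Hj; glra.
    case=> [[j _ [A /= /asboolP WA [Dt tA]]]|].
      by rewrite /preimage /= FD//; apply: WA; rewrite -tA; exact: Hf.
    case: pselect => // h nDt; rewrite /preimage /= /F ifF//.
    by apply/negP.
  apply: measurableU.
    apply: bigcup_measurable => j _.
    by apply: fin_bigcup_measurable => [|A _]; [exact: finite_finset|exact: mS].
  by case: pselect => h; [exact: measurableC|exact: measurable0].
have [nu Hnu] := image_measure_exists
  (mrestr lebesgue_measure mD : {measure set (measurableTypeR R) -> \bar R}) mF.
have {}Hnu E : nu E = lebesgue_measure (F @^-1` E `&` D) by rewrite Hnu.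
have sumS j (Q : pred (V j)) :
    lebesgue_measure (\bigcup_(A in [set` Q]) S j A) = (\sum_(A | Q A) mu j A)%:E.
  rewrite measure_finType_bigcup; last 2 first.
  - by move=> A _; exact: mS.
  - by move=> A A' _ _ [t [[_ <-] [_ <-]]].
  rewrite -sumEFin; apply: eq_bigr => A _.
  by have [_ E] := Scode j A; apply: eq_trans E _.
have mSQ j (Q : pred (V j)) : measurable (\bigcup_(A in [set` Q]) S j A).
  by apply: fin_bigcup_measurable => [|A _]; [exact: finite_finset|exact: mS].
have mFE E : measurable E -> measurable (F @^-1` E `&` D).
  by move=> mE; apply: measurableI => //; rewrite -[_ @^-1` _]setTI; exact: mF.
exists nu; split.
- rewrite Hnu preimage_setT setTI DE lebesgue_measure_itv /= lte_fin.
  by rewrite ltr01 oppr0 adde0.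
- move=> j Q E mE QE; rewrite -sumS Hnu.
  apply: le_measure; rewrite ?inE; [exact: mSQ|exact: mFE|].
  move=> t [A QA [Dt tA]]; split => //; rewrite /preimage /= FD//.
  by apply: (QE A) => //; rewrite -tA; exact: Hf.
- move=> j Q E mE QE; rewrite -sumS Hnu.
  apply: le_measure; rewrite ?inE; [exact: mFE|exact: mSQ|].
  move=> t [+ Dt]; rewrite /preimage /= FD// => Et.
  by exists (code j t) => //=; apply: QE Et _; exact: Hf.
Qed.

(** Sets squeezed between a closed and an open set of nearly equal measure form a sigma-algebra
    containing the open sets; closed sets are compact here, so inner regularity follows. *)
Lemma finite_borel_radon (R : realType) (T : metricType R) (x0 : T)
    (mu : {measure set (borel x0) -> \bar R}) : compact [set: T] ->
  (mu setT < +oo)%E -> radon mu.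
Proof.
move=> Tc muT.
have mopen (O : set T) : open O -> measurable (O : set (borel x0)).
  exact: borel_measurable_open.
have mclosed (F : set T) : closed F -> measurable (F : set (borel x0)).
  move=> cF; rewrite -(setCK F); apply: measurableC.
  by apply: mopen; exact: closed_openC.
have mufin (A : set (borel x0)) : measurable A -> (mu A < +oo)%E.
  move=> mA; apply: le_lt_trans muT; apply: le_measure; rewrite ?inE//.
pose approx (A : set T) := forall e : R, 0 < e -> exists F O : set T,
  [/\ closed F, open O, F `<=` A, A `<=` O & (mu (O `\` F) <= e%:E)%E].
have decr (F : nat -> set T) (e : R) : 0 < e ->
    (forall n, measurable (F n : set (borel x0))) ->
    (forall n, F n.+1 `<=` F n) -> (mu (\bigcap_n F n) < e%:E)%E ->
    exists n, (mu (F n) <= e%:E)%E.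
  move=> e0 mF Fd Fe.
  have mI : measurable (\bigcap_n F n : set (borel x0)).
    exact: bigcap_measurableType.
  have := @nonincreasing_cvg_mu _ _ _ mu F (mufin _ (mF 0%N)) mF mI.
  have Fh : {homo F : n m / (n <= m)%N >-> (m <= n)%O}.
    by apply/nonincreasing_seqP => n; apply/subsetPset; exact: Fd.
  move=> /(_ Fh) cv; apply: contrapT => nex.
  have : (e%:E <= mu (\bigcap_n F n))%E.
    rewrite -(cvg_lim _ cv)//; apply: lime_ge; first by apply/cvg_ex; eexists; exact: cv.
    apply: nearW => n; rewrite leNgt; apply/negP => h; apply: nex.
    by exists n; exact: ltW.
  by rewrite leNgt Fe.
have approx_open (O : set T) : open O -> approx O.
  move=> oO e e0.
  pose G n := \bigcup_(y in ~` O) ball y (n.+1%:R : R)^-1.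
  have oG n : open (G n) by apply: bigcup_open => y _; exact: mball_open.
  have [|||n Hn] := decr (fun n => O `&` G n) e e0.
  - by move=> n; apply: measurableI; exact: mopen.
  - move=> n x [Ox [y nOy yx]]; split => //; exists y => //.
    apply: le_ball yx; rewrite lef_pV2 ?posrE ?ltr0n// ler_nat.
    exact: leqW.
  - rewrite (_ : \bigcap_n _ = set0) ?measure0 ?lte_fin//.
    rewrite -subset0 => x Hx; have [Ox _] := Hx 0%N I.
    have : nbhs x O by exact: open_nbhs_nbhs.
    move=> /nbhs_ballP[d /= d0 Hd].
    have [_ [y nOy yx]] := Hx (Num.truncn d^-1) I; apply: nOy; apply: Hd.
    apply: ball_sym; apply: le_ball yx; rewrite invf_ple ?posrE// ltW//.
    exact: truncnS_gt.
  exists (O `&` ~` G n), O; split => //.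
  - rewrite (_ : O `&` ~` G n = ~` G n); first exact: open_closedC.
    apply: setIidr => x nG; apply: contrapT => nO; apply: nG.
    by exists x => //; apply: ballxx; rewrite invr_gt0.
  - by apply: le_trans Hn; rewrite setDIr setDv set0U setDE setCK.
have sigma : sigma_algebra setT (approx : set (set (borel x0))).
  split.
  - by apply: approx_open; exact: open0.
  - move=> A HA e e0; have [F [Op [cF oO FA AO leOF]]] := HA e e0.
    exists (~` Op), (~` F); split.
    + exact: open_closedC.
    + exact: closed_openC.
    + by rewrite setTD; exact: subsetC.
    + by rewrite setTD; exact: subsetC.
    + by rewrite setDE setCK setIC -setDE.
  - move=> A HA e e0.
    have /choice[FO HFO] : forall n, exists FO : set T * set T,
        [/\ closed FO.1, open FO.2, FO.1 `<=` A n, A n `<=` FO.2 &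
          (mu (FO.2 `\` FO.1) <= (e / 2 / (2 ^ n.+1)%:R)%:E)%E].
      move=> n; have [|F [Op H]] := HA n (e / 2 / (2 ^ n.+1)%:R).
        by rewrite !divr_gt0// ltr0n expn_gt0.
      by exists (F, Op).
    pose O := \bigcup_n (FO n).2.
    (* An infinite union of closed sets need not be closed: finite unions are used, and [decr] makes
       the remainder small. *)
    pose F n := \big[setU/set0]_(i < n) (FO i).1.
    have oO : open O by apply: bigcup_open => n _; case: (HFO n).
    have cF n : closed (F n).
      by apply: closed_bigsetU => i _; case: (HFO i).
    have [|||n Hn] := decr (fun n => O `\` F n) e e0.
    + move=> n; apply: measurableD; [exact: mopen|exact: mclosed].
    + by move=> n; apply: setDS; rewrite /F big_ord_recr; exact: subsetUl.
    + apply: (@le_lt_trans _ _ (e / 2)%:E); last first.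
        by rewrite lte_fin; move: e0; glra.
      apply: (@le_trans _ _ (\sum_(0 <= i <oo) mu ((FO i).2 `\` (FO i).1))%E).
        apply: measure_sigma_subadditive.
        * move=> i; apply: measurableD; first by apply: mopen; case: (HFO i).
          by apply: mclosed; case: (HFO i).
        * apply: bigcap_measurableType => i _; apply: measurableD.
            exact: mopen.
          exact: mclosed.
        * move=> x Hx; have [[i _ Oi] _] := Hx 0%N I.
          exists i => //; split => // Fi; have [_] := Hx i.+1 I; apply.
          by rewrite /F big_ord_recr; right.
      apply: (@le_trans _ _
          (\sum_(0 <= i <oo) (0 + (e / 2 / (2 ^ i.+1)%:R)%:E))%E).
        apply: lee_nneseries => [i _ _|i _]; first exact: measure_ge0.
        by rewrite add0e; case: (HFO i).
      apply: le_trans (epsilon_trick _ _ _) _ => //.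
        by rewrite divr_ge0// ltW.
      by rewrite eseries0// add0e.
    exists (F n), O; split => //.
    + move=> x; rewrite /F -(bigcup_mkord n (fun i => (FO i).1)) => -[i _ Fi]; exists i => //.
      by case: (HFO i) => _ _ + _ _; apply.
    + move=> x [i _ Ai]; exists i => //.
      by case: (HFO i) => _ _ _ + _; apply.
have approx_all (A : set (borel x0)) : measurable A -> approx A.
  by apply: smallest_sub sigma _ A; exact: approx_open.
split; first by move=> x; exists setT; split => //; exact: openT.
move=> A mA; apply/eqP; rewrite eq_le; apply/andP; split; last first.
  apply: ge_ereal_sup => _ [K [_ cK KA] <-]; apply: le_measure; rewrite ?inE//.
  exact: mclosed.
apply/lee_addgt0Pr => e e0.
have [F [Op [cF oO FA AO leOF]]] := approx_all A mA e e0.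
have mF := mclosed _ cF; have mO := mopen _ oO.
apply: (@le_trans _ _ (mu F + e%:E)%E); last first.
  apply: leeD => //; apply: ereal_sup_ubound; exists F => //; split => //.
  exact: subclosed_compact Tc _.
apply: (@le_trans _ _ (mu (F `|` (Op `\` F)))).
  apply: le_measure; rewrite ?inE//.
    by apply: measurableU => //; exact: measurableD.
  by move=> x Ax; have [Fx|nFx] := pselect (F x); [left|right; split => //; exact: AO].
apply: (@le_trans _ _ (mu F + mu (Op `\` F))%E).
  by apply: measureU2 => //; exact: measurableD.
exact: leeD.
Qed.

(** * The distance of chains *)

Section Chains.
Context {R : realType} {X : metricType R} (V : nat -> finType)
  (c : forall j, V j -> X) (r : nat -> R) (h : forall j, V j -> R) (C0 : R).

Definition cen (B : {j & V j}) : X := c (tagged B).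
Definition rad (B : {j & V j}) : R := r (tag B).
Definition hgt (B : {j & V j}) : R := h (tagged B).
Definition cost (s : seq {j & V j}) : R := \sum_(B <- s) hgt B.

(* [s] is a chain of cells of levels at most [n], with gaps controlled by the
   radii up to a slack [d], from a starting point [x] of radius [a] to [y]. *)
Fixpoint link (d : R) (n : nat) (x : X) (a : R) (s : seq {j & V j}) (y : X) : Prop :=
  if s is B :: s' then
    [/\ (tag B <= n)%N, mdist x (cen B) <= a + C0 * rad B + d &
        link d n (cen B) (C0 * rad B) s' y]
  else mdist x y <= a + d.

Lemma link_weaken d d' n n' x a s y : d <= d' -> (n <= n')%N ->
  link d n x a s y -> link d' n' x a s y.
Proof.
move=> dd nn; elim: s x a => [|B s IH] x a /=; first by move=> h1; lra.
move=> [h1 h2 h3]; split; [exact: leq_trans nn|lra|exact: IH].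
Qed.

Lemma link_start d n x x' a a' s y : mdist x' x <= a' ->
  link d n x a s y -> link d n x' (a + a') s y.
Proof.
case: s => [|B s] /= xx'.
  by have := metric_triangle x' x y; lra.
move=> [h1 h2 h3]; split => //.
by have := metric_triangle x' x (cen B); lra.
Qed.

Lemma link_cat n n' x a s y s' z : link 0 n x a s y -> link 0 n' y 0 s' z ->
  link 0 (maxn n n') x a (s ++ s') z.
Proof.
elim: s x a => [|B s IH] x a /=.
  rewrite addr0 => xy /(link_weaken (lexx 0) (leq_maxr n n')).
  by move=> /(link_start xy); rewrite add0r.
move=> [h1 h2 h3] yz; split => //; last exact: IH.
exact: leq_trans (leq_maxl _ _).
Qed.

Lemma cost_cat s s' : cost (s ++ s') = cost s + cost s'.
Proof. by rewrite /cost big_cat. Qed.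

Lemma cost_cons B s : cost (B :: s) = hgt B + cost s.
Proof. by rewrite /cost big_cons. Qed.
End Chains.

(** Isolates the part of a chain that one coarser cell centered at [z] may replace; the three shapes
    of [t2] are the three cases of [coarsen]. *)
Lemma run_split (R : realType) (X : metricType R) (V : nat -> finType)
    (c : forall j, V j -> X) (r : nat -> R) (C0 d rB : R) (n : nat) (z y : X) :
  forall (t : seq {j & V j}) (A : V n),
  mdist z (c _ A) < rB -> link c r C0 d n (c _ A) (C0 * r n) t y ->
  exists (u : seq (V n)) (t2 : seq {j & V j}),
  [/\ t = map (Tagged V) u ++ t2, all (fun D => mdist z (c _ D) < rB) u,
    path (fun D D' => mdist (c _ D) (c _ D') <= (C0 + C0) * r n + d) A u,
    link c r C0 d n (c _ (last A u)) (C0 * r n) t2 y &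
    match t2 with
    | [::] => True
    | Q :: t3 => (tag Q < n)%N \/ exists A' : V n,
        Q = Tagged V A' /\ rB <= mdist z (c _ A') end].
Proof.
elim=> [|[q Q] t IH] A zA; first by exists [::], [::].
rewrite [link _ _ _ _ _ _ _ _ _]/= => -[qn AQ lt].
move: qn; rewrite leq_eqVlt => /orP[/eqP qn|qn]; last first.
  by exists [::], (existT _ q Q :: t); split => //=; [split => //; exact: ltnW|left].
rewrite /= in qn; subst q.
have [zQ|zQ] := ltP (mdist z (c _ Q)) rB; last first.
  exists [::], (Tagged V Q :: t); split => //=; right; exists Q; split => //.
have [u [t2 [-> au pu lu m2]]] := IH Q zQ lt.
exists (Q :: u), t2; split => //=; first by rewrite zQ.
by rewrite pu andbT; apply: le_trans AQ _; rewrite /rad /cen /=; lra.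
Qed.

Lemma cost_map_tagged (R : realType) (V : nat -> finType)
    (h : forall j, V j -> R) n (u : seq (V n)) :
  cost h (map (Tagged V) u) = \sum_(D <- u) h n D.
Proof. by rewrite /cost big_map. Qed.

(* A run of cells of level [n + 1] is replaced by the cells of level [n] that it
   crosses; its last part, which crosses nothing, is dropped and only enlarges
   the gap. *)
Lemma coarsen (R : realType) (X : metricType R) (V : nat -> finType)
    (c : forall j, V j -> X) (r : nat -> R) (h : forall j, V j -> R) (C0 : R)
    (mem : forall j, V j -> X -> Prop) (n : nat) (y : X) :
  3 <= C0 -> 0 < r n -> 0 < r n.+1 -> (2 * C0 + 10) * r n.+1 <= r n ->
  (forall j B, 0 <= h j B) ->
  (forall x, exists B : V n, mem n B x) ->
  (forall B x, mem n B x -> mdist (c n B) x < r n) ->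
  (forall (B : V n) A u A', mem n B (c n.+1 A) ->
    path (fun D D' => mdist (c n.+1 D) (c n.+1 D') <= (2 * C0 + 5) * r n.+1)
      A (rcons u A') ->
    (forall D, D \in A :: u -> mdist (c n B) (c n.+1 D) < 2 * r n) ->
    2 * r n <= mdist (c n B) (c n.+1 A') ->
    h n B <= \sum_(D <- A :: u) h n.+1 D) ->
  forall m s x a, (size s <= m)%N ->
  link c r C0 (5 * r n.+1) n.+1 x a s y ->
  exists s', link c r C0 (5 * r n) n x a s' y /\ cost h s' <= cost h s.
Proof.
move=> C03 rn0 rn10 rr h0 cover memd cross.
have C0r : 3 * r n <= C0 * r n by rewrite ler_pM2r.
have C0r1 : 0 <= C0 * r n.+1 by apply: mulr_ge0; move: C03 rn10; glra.
have rr' : 2 * (C0 * r n.+1) + 10 * r n.+1 <= r n by move: rr; glra.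
elim=> [|m IH] [|[q Q] t] x a sz //=.
- by move=> xy; exists [::]; split => //=; move: xy rr' C0r1 rn10; glra.
- by move=> xy; exists [::]; split => //=; move: xy rr' C0r1 rn10; glra.
have {}sz : (size t <= m)%N by [].
move=> [qn xQ lt]; move: qn; rewrite leq_eqVlt => /orP[/eqP qn|qn]; last first.
  have [t' [lt' ct']] := IH t _ _ sz lt.
  exists (existT _ q Q :: t'); split; last by rewrite !cost_cons lerD2l.
  split => //; move: xQ rr' C0r1 rn10; glra.
rewrite /= in qn; subst q; rewrite /cen /rad /= in xQ lt.
have [B BQ] := cover (c _ Q); have BQd := memd _ _ BQ.
have BQ2 : mdist (c n B) (c n.+1 Q) < 2 * r n by move: BQd rn0; glra.
have [u [t2 [tE au pu lu m2]]] := run_split BQ2 lt.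
have lastB : mdist (c n B) (c n.+1 (last Q u)) < 2 * r n.
  by case: (lastP u) au => [//|u' D]; rewrite last_rcons all_rcons => /andP[].
have t2sz : (size t2 <= m)%N.
  by rewrite tE size_cat in sz; apply: leq_trans sz; exact: leq_addl.
have ctE : cost h (Tagged V Q :: t) = \sum_(D <- Q :: u) h _ D + cost h t2.
  by rewrite tE -cat_cons cost_cat -[_ :: map _ _]/(map (Tagged V) (Q :: u))
    cost_map_tagged.
have sumu : 0 <= \sum_(D <- Q :: u) h _ D by apply: sumr_ge0.
have tr1 := metric_triangle x (c n.+1 Q) (c n B).
rewrite (metric_sym (c n.+1 Q)) in tr1.
case: t2 m2 lu t2sz tE ctE => [_|[q2 Q2] t3].
  (* The chain ends inside the run: the run is dropped and the slack [5 * r n] reaches [y]. *)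
  rewrite /= => ly _ tE ctE; exists [::]; split; last first.
    rewrite -[existT _ _ _]/(Tagged V Q) ctE {1}/cost big_nil.
    by rewrite /cost big_nil addr0.
  have := metric_triangle x (c n.+1 (last Q u)) y.
  have := metric_triangle x (c n B) (c n.+1 (last Q u)).
  by rewrite /=; move: ly xQ tr1 BQd lastB rr' C0r1 rn10; glra.
move=> [q2n|[A' [QE A'B]]].
  (* A cell of level at most [n] follows: the run is dropped again, its extent going into the
     gap. *)
  rewrite [link _ _ _ _ _ _ _ _ _]/= => -[_ lQ lt3] t3sz tE ctE.
  have [t' [lt' ct']] := IH t3 _ _ (ltnW t3sz) lt3.
  exists (existT _ q2 Q2 :: t'); split; last first.
    rewrite -[existT _ n.+1 Q]/(Tagged V Q) ctE !cost_cons.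
    by move: sumu ct'; glra.
  split => //.
  have := metric_triangle x (c n.+1 (last Q u)) (cen c (existT _ q2 Q2)).
  have := metric_triangle x (c n B) (c n.+1 (last Q u)).
  by move: lQ xQ tr1 BQd lastB rr' C0r1 rn10; glra.
move=> lu t3sz tE ctE.
move: QE => /= QE; rewrite QE in lu tE ctE t3sz.
have /= [_ lA' lt3] := lu; rewrite /cen /rad /= in lA' lt3.
(* The run leaves the double of [B], and [B] replaces it. The exit cell [A'] stays in the remaining
   chain and is not paid for here, so successive runs use disjoint parts of the chain. *)
have lB : link c r C0 (5 * r n.+1) n.+1 (c n B) (C0 * r n) (Tagged V A' :: t3) y.
  split => //; rewrite /cen /rad /=.
  have := metric_triangle (c n B) (c n.+1 (last Q u)) (c n.+1 A').
  by move: lA' lastB C0r rr' rn10 C0r1; glra.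
have [t' [lt' ct']] := IH _ _ _ t3sz lB.
exists (Tagged V B :: t'); split.
  split => //; rewrite /cen /rad /=.
  by move: tr1 xQ BQd C0r C0r1 rr' rn10; glra.
rewrite -[existT _ n.+1 Q]/(Tagged V Q) ctE cost_cons lerD//.
apply: (cross B Q u A') => //.
  rewrite rcons_path; apply/andP; split.
    by apply: sub_path pu => D D'; move=> h1; move: h1; glra.
  by move: lA'; glra.
by move=> D; rewrite inE => /orP[/eqP ->//|]; move/allP: au; exact.
Qed.

(** Coarsening down to level [j] leaves a slack of [5 * r j], too small to join [x] to [y] without
    any cell; the first cell that remains costs no more than the whole chain. *)
Lemma chain_lower (R : realType) (X : metricType R) (V : nat -> finType)
    (c : forall j, V j -> X) (r : nat -> R) (h : forall j, V j -> R) (C0 : R)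
    (mem : forall j, V j -> X -> Prop) :
  3 <= C0 -> (forall j, 0 < r j) ->
  (forall j, (2 * C0 + 10) * r j.+1 <= r j) ->
  (forall j B, 0 <= h j B) ->
  (forall j x, exists B : V j, mem j B x) ->
  (forall j B x, mem j B x -> mdist (c j B) x < r j) ->
  (forall n (B : V n) A u A', mem n B (c n.+1 A) ->
    path (fun D D' => mdist (c n.+1 D) (c n.+1 D') <= (2 * C0 + 5) * r n.+1)
      A (rcons u A') ->
    (forall D, D \in A :: u -> mdist (c n B) (c n.+1 D) < 2 * r n) ->
    2 * r n <= mdist (c n B) (c n.+1 A') ->
    h n B <= \sum_(D <- A :: u) h n.+1 D) ->
  forall j N x y s, 5 * r j < mdist x y -> link c r C0 0 N x 0 s y ->
  exists i B, [/\ (i <= j)%N, mdist x (c i B) <= (C0 + 5) * r i &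
                  h i B <= cost h s].
Proof.
move=> C03 r0 rr h0 cover memd cross j N x y s xy ls.
have rS n : r n.+1 <= r n.
  apply: le_trans (rr n); rewrite ler_peMl ?(ltW (r0 _))//.
  by move: C03; glra.
have rmono i : (i <= j)%N -> r j <= r i.
  move=> ij; rewrite -(subnKC ij); elim: (j - i)%N => [|k IH]; first by rewrite addn0.
  by rewrite addnS; exact: le_trans (rS _) IH.
have down k : forall s, link c r C0 (5 * r (j + k)%N) (j + k) x 0 s y ->
    exists s', link c r C0 (5 * r j) j x 0 s' y /\ cost h s' <= cost h s.
  elim: k => [|k IH] s1; first by rewrite addn0 => l1; exists s1.
  rewrite addnS => l1.
  have [s2 [l2 c2]] := coarsen C03 (r0 (j + k)%N) (r0 _) (rr _) h0 (cover _)
    (memd _) (@cross _) (leqnn _) l1.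
  have [s3 [l3 c3]] := IH s2 l2.
  by exists s3; split => //; exact: le_trans c3 c2.
have [s' [ls' cs']] : exists s', link c r C0 (5 * r j) j x 0 s' y /\
    cost h s' <= cost h s.
  apply: (down N); apply: link_weaken ls; last exact: leq_addl.
  by rewrite mulr_ge0 ?(ltW (r0 _)).
case: s' ls' cs' => [|[i B] s'] /=; first by rewrite add0r leNgt xy.
move=> [ij xB _] cs'; exists i, B; split => //.
  by have := rmono i ij; move: xB; rewrite /cen /rad /=; glra.
apply: le_trans cs'; rewrite cost_cons lerDl /cost big_seq.
by apply: sumr_ge0 => E _; exact: h0.
Qed.

Section ChainDistance.
Context {R : realType} {X : metricType R} (V : nat -> finType)
  (c : forall j, V j -> X) (r : nat -> R) (h : forall j, V j -> R) (C0 : R).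
Hypotheses (h_ge0 : forall j (B : V j), 0 <= h B)
  (linked : forall x y, exists s N, link (@c) r C0 0 N x 0 s y).

Definition chain_costs (x y : X) : set R :=
  [set v | exists N s, link (@c) r C0 0 N x 0 s y /\ v = cost (@h) s].

Definition chain_inf (x y : X) : R := inf (chain_costs x y).

Lemma cost_ge0 s : 0 <= cost (@h) s.
Proof. by rewrite /cost; apply: sumr_ge0 => E _; exact: h_ge0. Qed.

Lemma chain_costs_lb x y : lbound (chain_costs x y) 0.
Proof. by move=> _ [N [s [_ ->]]]; exact: cost_ge0. Qed.

Lemma chain_costs_nonempty x y : chain_costs x y !=set0.
Proof. by have [s [N l]] := linked x y; exists (cost (@h) s), N, s. Qed.

Lemma chain_inf_le N x y s : link (@c) r C0 0 N x 0 s y ->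
  chain_inf x y <= cost (@h) s.
Proof.
by move=> l; apply: ge_inf; [exists 0; exact: chain_costs_lb|exists N, s].
Qed.

Lemma chain_inf_ge m x y :
  (forall N s, link (@c) r C0 0 N x 0 s y -> m <= cost (@h) s) -> m <= chain_inf x y.
Proof.
move=> H; apply: lb_le_inf; first exact: chain_costs_nonempty.
by move=> _ [N [s [l ->]]]; exact: H l.
Qed.

Lemma chain_inf_xx x : chain_inf x x = 0.
Proof.
apply/eqP; rewrite eq_le; apply/andP; split; last first.
  by apply: chain_inf_ge => N s _; exact: cost_ge0.
apply: le_trans (@chain_inf_le 0%N x x [::] _) _ => /=.
  by rewrite mdistxx addr0.
by rewrite /cost big_nil.
Qed.

Lemma chain_inf_triangle y x z : chain_inf x z <= chain_inf x y + chain_inf y z.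
Proof.
apply/ler_addgt0Pr => e e0; have e2 : 0 < e / 2 by rewrite divr_gt0.
have hi x' y' : has_inf (chain_costs x' y').
  by split; [exact: chain_costs_nonempty|exists 0; exact: chain_costs_lb].
have [_ [N1 [s1 [l1 ->]]] h1] := inf_adherent e2 (hi x y).
have [_ [N2 [s2 [l2 ->]]] h2] := inf_adherent e2 (hi y z).
have := chain_inf_le (link_cat l1 l2); rewrite cost_cat.
rewrite -/(chain_inf x y) in h1; rewrite -/(chain_inf y z) in h2; lra.
Qed.

(** The maximum over both orders gives symmetry without reversing chains. *)
Definition chain_dist x y := Num.max (chain_inf x y) (chain_inf y x).

Lemma chain_dist_xx x : chain_dist x x = 0.
Proof. by rewrite /chain_dist maxxx chain_inf_xx. Qed.

Lemma chain_dist_sym x y : chain_dist x y = chain_dist y x.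
Proof. by rewrite /chain_dist maxC. Qed.

Lemma chain_dist_triangle y x z :
  chain_dist x z <= chain_dist x y + chain_dist y z.
Proof.
rewrite {1}/chain_dist ge_max; apply/andP; split.
  apply: le_trans (chain_inf_triangle y x z) _.
  by apply: lerD; rewrite /chain_dist le_max lexx.
apply: le_trans (chain_inf_triangle y z x) _; rewrite addrC.
by apply: lerD; rewrite /chain_dist le_max lexx orbT.
Qed.
End ChainDistance.

(** The inverse of one plus the sum of all inverses is a lower bound even if there are no cells. *)
Lemma finite_levels_min (R : realType) (V : nat -> finType)
    (h : forall j, V j -> R) (j : nat) : (forall j B, 0 < h j B) ->
  exists2 m, 0 < m & forall i B, (i <= j)%N -> m <= h i B.
Proof.
move=> h0; have hV i B : 0 < (h i B)^-1 by rewrite invr_gt0.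
pose S i := \sum_B (h i B)^-1.
have S0 i : 0 <= S i by apply: sumr_ge0 => B _; exact: ltW.
pose M := 1 + \sum_(i < j.+1) S i.
have M0 : 0 < M by rewrite ltr_pwDl// sumr_ge0.
exists M^-1; first by rewrite invr_gt0.
move=> i B ij; rewrite invf_ple ?posrE// /M.
have iS : (i < j.+1)%N by [].
have : S i <= \sum_(i < j.+1) S i.
  by rewrite (bigD1 (Ordinal iS))//= lerDl sumr_ge0.
have : (h i B)^-1 <= S i.
  by rewrite /S (bigD1 B)//= lerDl sumr_ge0// => B' _; exact: ltW.
by glra.
Qed.

(** Chains of one cell give the upper bound, [chain_lower] the lower one. For distinct points some
    level has [5 * r j < mdist x y], and the finitely many cells of levels up to [j] have heights
    bounded below, so [theta] separates points. *)
Lemma chain_distance (R : realType) (X : metricType R) (V : nat -> finType)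
    (c : forall j, V j -> X) (r : nat -> R) (h : forall j, V j -> R) (C0 : R)
    (mem : forall j, V j -> X -> Prop) :
  3 <= C0 -> (forall j, 0 < r j) ->
  (forall j, (2 * C0 + 10) * r j.+1 <= r j) ->
  (forall j B, 0 < h j B) ->
  (forall j x, exists B : V j, mem j B x) ->
  (forall j B x, mem j B x -> mdist (c j B) x < r j) ->
  (forall x y : X, mdist x y <= C0 * r 0%N) ->
  (forall n (B : V n) A u A', mem n B (c n.+1 A) ->
    path (fun D D' => mdist (c n.+1 D) (c n.+1 D') <= (2 * C0 + 5) * r n.+1)
      A (rcons u A') ->
    (forall D, D \in A :: u -> mdist (c n B) (c n.+1 D) < 2 * r n) ->
    2 * r n <= mdist (c n B) (c n.+1 A') ->
    h n B <= \sum_(D <- A :: u) h n.+1 D) ->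
  exists theta : distance R X,
  (forall j (A : V j) x y, mdist x (c _ A) <= C0 * r j ->
    mdist y (c _ A) <= C0 * r j -> theta x y <= h j A) /\
  (forall j x y m, 5 * r j < mdist x y ->
    (forall i (B : V i), (i <= j)%N -> mdist x (c _ B) <= (C0 + 5) * r i ->
       m <= h i B) -> m <= theta x y).
Proof.
move=> C03 r0 rr h0 cover memd diamX cross.
have hge j B : 0 <= h j B by exact: ltW.
have one j (A : V j) x y : mdist x (c _ A) <= C0 * r j ->
    mdist y (c _ A) <= C0 * r j -> link c r C0 0 j x 0 [:: Tagged V A] y.
  rewrite /= /cen /rad /= => h1 h2; split => //; first by rewrite add0r addr0.
  by rewrite addr0 metric_sym.
have linked x y : exists s N, link c r C0 0 N x 0 s y.
  by have [A _] := cover 0%N x; exists [:: Tagged V A], 0%N; exact: one.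
have lower j x y m : 5 * r j < mdist x y ->
    (forall i (B : V i), (i <= j)%N -> mdist x (c _ B) <= (C0 + 5) * r i ->
       m <= h i B) -> m <= chain_inf c r h C0 x y.
  move=> xy Hm; apply: chain_inf_ge => // N s ls.
  have [i [B [ij xB hB]]] := chain_lower C03 r0 rr hge cover memd cross xy ls.
  by apply: le_trans hB; exact: Hm.
have rh j : r j.+1 <= r j / 2.
  rewrite ler_pdivlMr// mulrC; apply: le_trans (rr j).
  by rewrite ler_pM2r//; move: C03; glra.
have eq0 x y : chain_dist c r h C0 x y = 0 -> x = y.
  move=> xy0; apply/eqP; apply/negPn/negP; rewrite -mdist_gt0 => xy.
  have [j Hj] := halving_small r0 rh (divr_gt0 xy (ltr0n R 5)).
  have [m m0 Hm] := finite_levels_min j h0.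
  have : m <= chain_inf c r h C0 x y.
    apply: (lower j) => [|i B ij _]; last exact: Hm.
    by move: Hj; glra.
  rewrite leNgt; apply/negP; rewrite negbK; apply: le_lt_trans m0.
  by rewrite -xy0 /chain_dist le_max lexx.
exists (Distance (chain_dist_xx (c := c) (r := r) (C0 := C0) hge linked) eq0
  (chain_dist_sym c r h C0) (chain_dist_triangle hge linked)); split => /=.
  move=> j A x y xA yA; rewrite /chain_dist ge_max; apply/andP; split.
    apply: le_trans (chain_inf_le hge (one _ _ _ _ xA yA)) _.
    by rewrite /cost big_seq1.
  apply: le_trans (chain_inf_le hge (one _ _ _ _ yA xA)) _.
  by rewrite /cost big_seq1.
move=> j x y m xy Hm; rewrite /chain_dist le_max; apply/orP; left.
exact: lower xy Hm.
Qed.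

(** * Comparison with the scales *)

Section PowerGauge.
Context {R : realType}.

Lemma powR_within_continuous (a : R) : 0 < a ->
  {within `[0, +oo[, continuous (fun t : R => t `^ a)}.
Proof.
move=> a0; apply/continuous_within_itvcyP; split; last first.
  by rewrite powR0 ?gt_eqF//; exact: powR_cvg0.
move=> x x0; apply: differentiable_continuous; apply/derivable1_diffP.
exact: derivable_powR.
Qed.

Lemma power_gauge (M1 M2 a1 a2 : R) : 0 < M1 -> 0 < M2 -> 0 < a1 -> 0 < a2 ->
  let eta t := M1 * t `^ a1 + M2 * t `^ a2 in
  [/\ set_bij `[0, +oo[ `[0, +oo[ eta,
      {in `[0, +oo[ &, {homo eta : s t / s < t}} &
      {within `[0, +oo[, continuous eta}].
Proof.
move=> M10 M20 a10 a20 eta.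
have eta_ge0 t : 0 <= eta t.
  by rewrite /eta addr_ge0// mulr_ge0 ?powR_ge0 ?(ltW M10) ?(ltW M20).
have eta0 : eta 0 = 0 by rewrite /eta !powR0 ?gt_eqF// !mulr0 addr0.
have cont : {within `[0, +oo[, continuous eta}.
  move=> x; apply: cvgD; apply: cvgM; try exact: cvg_cst.
    exact: (powR_within_continuous a10).
  exact: (powR_within_continuous a20).
have inc : {in `[0, +oo[ &, {homo eta : s t / s < t}}.
  move=> s t; rewrite !in_itv /= !andbT => s0 t0 st.
  by rewrite /eta ltrD// ltr_pM2l//; apply: gt0_ltr_powR.
split => //; split.
- by move=> t _; rewrite /= in_itv /= andbT.
- move=> s t; rewrite !in_setE /= => s0 t0 est; apply/eqP.
  case: ltgtP => // st; [have := inc s t s0 t0 st|have := inc t s t0 s0 st];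
    by rewrite est ltxx.
move=> v; rewrite /= in_itv /= andbT => v0.
pose w := (v / M1) `^ a1^-1.
have w0 : 0 <= w by exact: powR_ge0.
have vw : v <= eta w.
  rewrite /eta /w -powRrM mulVf ?gt_eqF//.
  have vM : 0 <= v / M1 by rewrite divr_ge0 ?(ltW M10).
  rewrite powRr1// mulrC divfK ?gt_eqF// lerDl.
  by rewrite mulr_ge0 ?powR_ge0 ?(ltW M20).
have cw : {within `[0, w], continuous eta}.
  apply: continuous_subspaceW cont => t /=; rewrite !in_itv /=.
  by move=> /andP[-> _].
have [|u] := IVT (v := v) w0 cw.
  by rewrite eta0 ge_min v0 le_max vw orbT.
rewrite in_itv /= => /andP[u0 _] eu.
by exists u => //; rewrite /= in_itv /= u0.
Qed.

Lemma powR_exists (b v : R) : 1 < b -> 0 < v ->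
  exists a, b `^ a = v.
Proof.
move=> b1 v0; have b0 : 0 < b by exact: lt_trans b1.
exists (ln v / ln b); rewrite /powR gt_eqF// divfK ?gt_eqF ?ln_gt0//.
by rewrite lnK.
Qed.
End PowerGauge.

(** The level of a pair is the first [j] with [b2 * r j < mdist x y]; there [theta x y] is
    comparable to [G j x]. A ratio of distances becomes a difference of levels, over which [G]
    changes at most by a power of [phi^-1] if [ja <= jb], and of [dl] up to [C] otherwise; written
    as powers of [bt], these give the exponents [a1] and [a2] of the gauge. *)
Lemma qs_from_scales (R : realType) (X : metricType R) (theta : distance R X)
    (r : nat -> R) (G : nat -> X -> R) (bt b1 b2 c1 phi C dl : R) :
  1 < bt -> (forall j, 0 < r j) -> (forall j, r j = bt * r j.+1) ->
  0 < b2 -> b2 <= b1 -> 0 < c1 -> 0 < phi -> phi < 1 -> 1 <= C ->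
  0 < dl -> dl < 1 ->
  (forall j x, 0 < G j x) ->
  (forall i j x, phi ^+ i * G j x <= G (i + j)%N x) ->
  (forall i j x, G (i + j)%N x <= C * dl ^+ i * G j x) ->
  (forall x y : X, mdist x y <= b1 * r 0%N) ->
  (forall j x y, mdist x y <= b1 * r j -> theta x y <= G j x) ->
  (forall j x y, b2 * r j < mdist x y -> c1 * G j x <= theta x y) ->
  @quasisymmetric R X (remetric theta) idfun.
Proof.
move=> bt1 r0 rbt b20 b21 c10 phi0 phi1 C1 dl0 dl1 G0 Glow Gup diamX up low.
have bt0 : 0 < bt by exact: lt_trans bt1.
have b10 : 0 < b1 by exact: lt_le_trans b21.
have rpow i j : r j = bt ^+ i * r (i + j)%N.
  elim: i => [|i IH]; first by rewrite expr0 mul1r.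
  by rewrite IH rbt addSn exprSr mulrA.
have rsmall e : 0 < e -> exists j, r j < e.
  move=> e0; have q1 : `|bt^-1| < 1.
    by rewrite gtr0_norm ?invr_gt0// invf_lt1.
  have er : 0 < e / r 0%N by rewrite divr_gt0.
  have /cvgrPdist_lt /(_ _ er) [j _ /(_ j (leqnn _))] := cvg_expr q1.
  rewrite /= sub0r normrN exprVn gtr0_norm ?invr_gt0 ?exprn_gt0//.
  rewrite ltr_pdivlMr// mulrC (rpow j 0%N) addn0 mulrAC divff ?mul1r.
    by exists j.
  by rewrite gt_eqF// exprn_gt0.
have scale x y : x != y -> exists j, [/\ b2 * r j < mdist x y,
    mdist x y <= b1 * bt * r j, c1 * G j x <= theta x y &
    theta x y <= phi^-1 * G j x].
  rewrite -mdist_gt0 => xy.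
  have exj : exists j, b2 * r j < mdist x y.
    have [j Hj] := rsmall _ (divr_gt0 xy b20).
    by exists j; rewrite mulrC -ltr_pdivlMr.
  case: (ex_minnP exj) => [j Hj jmin].
  have Gj : c1 * G j x <= theta x y by exact: low.
  exists j; split => //; case: j Hj jmin {Gj} => [_ _|j Hj jmin].
  - apply: le_trans (diamX x y) _; rewrite -mulrA ler_wpM2l ?(ltW b10)//.
    by rewrite ler_peMl ?(ltW bt1) ?(ltW (r0 _)).
  - rewrite -mulrA -rbt.
    apply: (@le_trans _ _ (b2 * r j)); last by rewrite ler_wpM2r ?(ltW (r0 _)).
    by rewrite leNgt; apply/negP => /jmin; rewrite ltnn.
  - apply: le_trans (up 0%N x y (diamX x y)) _.
    by rewrite ler_peMl ?(ltW (G0 _ _))// invf_ge1// ltW.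
  - have h : mdist x y <= b1 * r j.
      apply: (@le_trans _ _ (b2 * r j)); last by rewrite ler_wpM2r ?(ltW (r0 _)).
      by rewrite leNgt; apply/negP => /jmin; rewrite ltnn.
    apply: le_trans (up j x y h) _; rewrite ler_pdivlMl//.
    by have := Glow 1%N j x; rewrite expr1.
have Gsmall x e : 0 < e -> exists j, G j x < e.
  move=> e0; have q1 : `|dl| < 1 by rewrite gtr0_norm.
  have er : 0 < e / (C * G 0%N x).
    by rewrite divr_gt0// mulr_gt0// (lt_le_trans ltr01 C1).
  have /cvgrPdist_lt /(_ _ er) [j _ /(_ j (leqnn _))] := cvg_expr q1.
  rewrite /= sub0r normrN gtr0_norm ?exprn_gt0// => h; exists j.
  have := Gup j 0%N x; rewrite addn0 => /le_lt_trans; apply.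
  move: h; rewrite ltr_pdivlMr ?mulr_gt0 ?(lt_le_trans ltr01 C1)//.
  by rewrite mulrCA mulrA.
split.
  have cf : continuous (idfun : X -> remetric theta).
    move=> x W /nbhs_ballP[e /= e0 He]; have [j Hj] := Gsmall x e e0.
    suff : @nbhs _ X x W by [].
    apply/nbhs_ballP; exists (b1 * r j) => /=; first exact: mulr_gt0.
    move=> y; rewrite ballEmdist /= => xy; apply: He; rewrite ballEmdist /=.
    by apply: le_lt_trans Hj; apply: up; exact: ltW.
  split => //; exists idfun; split => // x W /nbhs_ballP[e /= e0 He].
  suff : @nbhs _ (remetric theta) x W by [].
  have [j Hj] := rsmall _ (divr_gt0 e0 b20).
  apply/nbhs_ballP; exists (c1 * G j x) => /=; first exact: mulr_gt0.
  move=> y; rewrite ballEmdist /= => xy; apply: He; rewrite ballEmdist /=.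
  rewrite ltNge; apply/negP => h.
  move: xy; apply/negP; rewrite -leNgt; apply: low; apply: lt_le_trans h.
  by rewrite mulrC -ltr_pdivlMr.
have [a1 a1E] := powR_exists bt1 (v := phi^-1) ltac:(by rewrite invr_gt0).
have [a2 a2E] := powR_exists bt1 (v := dl^-1) ltac:(by rewrite invr_gt0).
have pos_exp a v : bt `^ a = v -> 1 < v -> 0 < a.
  move=> <- h; rewrite ltNge; apply/negP => a0; move: h; apply/negP.
  rewrite -leNgt -[leRHS](powRr0 bt); apply: ler_powR => //; exact: ltW.
have a10 : 0 < a1 by apply: pos_exp a1E _; rewrite invf_gt1.
have a20 : 0 < a2 by apply: pos_exp a2E _; rewrite invf_gt1.
pose c2 := b2 / (b1 * bt).
have c20 : 0 < c2 by rewrite divr_gt0// mulr_gt0.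
pose M := phi^-1 / c1 * C.
have C0 : 0 < C by exact: lt_le_trans C1.
have M0 : 0 < M by rewrite !mulr_gt0 ?invr_gt0.
have M10 : 0 < M * c2^-1 `^ a1 by pos.
have M20 : 0 < M * c2^-1 `^ a2 by pos.
have [g1 g2 g3] := power_gauge M10 M20 a10 a20.
exists (fun t => M * c2^-1 `^ a1 * t `^ a1 + M * c2^-1 `^ a2 * t `^ a2).
split => // x a b /eqP xb.
rewrite -[leLHS]/(theta x a / theta x b).
have tge0 : 0 <= mdist x a / mdist x b by rewrite divr_ge0 ?mdist_ge0.
have c2V : 0 <= c2^-1 by rewrite invr_ge0 ltW.
have etaE u : 0 <= u -> M * c2^-1 `^ a1 * u `^ a1 + M * c2^-1 `^ a2 * u `^ a2 =
    M * ((u / c2) `^ a1 + (u / c2) `^ a2).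
  by move=> u0; rewrite !powRM//; glra.
rewrite etaE//.
have S0 t : 0 <= M * ((t / c2) `^ a1 + (t / c2) `^ a2).
  by rewrite mulr_ge0 ?(ltW M0)// addr_ge0 ?powR_ge0.
have [->|xa] := eqVneq a x.
  rewrite distance_xx mul0r.
  exact: S0.
rewrite eq_sym in xa.
have [ja [da1 da2 ga1 ga2]] := scale x a xa.
have [jb [db1 db2 gb1 gb2]] := scale x b xb.
have dxb : 0 < mdist x b by rewrite mdist_gt0.
set t := mdist x a / mdist x b.
have tlow : r ja / r jb <= t / c2.
  rewrite /t /c2 ler_pdivrMr// mulrAC ler_pdivlMr ?divr_gt0 ?mulr_gt0//.
  rewrite mulrAC ler_pdivlMr//.
  have h1 : b2 * r ja / (b1 * bt) * mdist x b <= b2 * r ja * r jb.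
    rewrite mulrAC ler_pdivrMr ?mulr_gt0// -[leRHS]mulrA ler_wpM2l//.
      by rewrite mulr_ge0 ?(ltW b20) ?(ltW (r0 _)).
    by rewrite mulrC.
  have h2 : b2 * r ja * r jb <= mdist x a * r jb.
    by rewrite ler_wpM2r ?(ltW (r0 _))// ltW.
  by move: h1 h2; glra.
have th : theta x a / theta x b <= phi^-1 / c1 * (G ja x / G jb x).
  have tb0 : 0 < theta x b by exact: distance_gt0.
  rewrite ler_pdivrMr//; apply: (le_trans ga2).
  have h : G jb x <= theta x b / c1 by rewrite ler_pdivlMr// mulrC.
  have k0 : 0 <= phi^-1 * G ja x / G jb x.
    by rewrite !mulr_ge0 ?invr_ge0 ?(ltW phi0) ?(ltW (G0 _ _)).
  have := ler_wpM2l k0 h; rewrite divfK ?gt_eqF//.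
  by move/le_trans; apply; glra.
apply: (le_trans th).
have pc0 : 0 <= phi^-1 / c1 by rewrite divr_ge0 ?invr_ge0 ?(ltW phi0) ?(ltW c10).
rewrite /M -[leRHS]mulrA; apply: ler_wpM2l => //.
have powx a' i : (bt ^+ i) `^ a' = (bt `^ a') ^+ i.
  elim: i => [|i IH]; first by rewrite !expr0 powR1.
  by rewrite !exprS powRM ?exprn_ge0 ?(ltW bt0)// IH.
have [jab|jab] := leqP ja jb.
  have := Glow (jb - ja)%N ja x; rewrite subnK// => h.
  have h1 : G ja x / G jb x <= (phi^-1) ^+ (jb - ja)%N.
    rewrite ler_pdivrMr// exprVn mulrC ler_pdivlMr ?exprn_gt0//.
    by rewrite mulrC.
  apply: (le_trans h1); rewrite -a1E -powx.
  have rr : bt ^+ (jb - ja)%N <= t / c2.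
    apply: le_trans tlow; rewrite (rpow (jb - ja)%N ja) subnK// mulfK// gt_eqF//.
  apply: (@le_trans _ _ ((t / c2) `^ a1)).
    by apply: ler_powR2r rr; [exact: ltW|rewrite exprn_ge0 ?(ltW bt0)].
  apply: (@le_trans _ _ (C * (t / c2) `^ a1)).
    by rewrite ler_peMl ?powR_ge0.
  by rewrite ler_wpM2l ?(ltW C0)// lerDl powR_ge0.
have := Gup (ja - jb)%N jb x; rewrite subnK ?(ltnW jab)// => h.
have h1 : G ja x / G jb x <= C * dl ^+ (ja - jb)%N by rewrite ler_pdivrMr.
apply: (le_trans h1); apply: ler_wpM2l; first exact: ltW.
have rr : (bt ^+ (ja - jb)%N)^-1 <= t / c2.
  apply: le_trans tlow; rewrite (rpow (ja - jb)%N jb) subnK ?(ltnW jab)//.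
  by rewrite invfM mulrA mulrAC divff ?mul1r// gt_eqF.
have -> : dl ^+ (ja - jb)%N = ((bt ^+ (ja - jb)%N)^-1) `^ a2.
  rewrite -[_^-1]powR_inv1 ?exprn_ge0 ?(ltW bt0)// -powRrM mulN1r powRN powx.
  by rewrite a2E exprVn invrK.
apply: (@le_trans _ _ ((t / c2) `^ a2)).
  by apply: ler_powR2r rr; [exact: ltW|rewrite invr_ge0 exprn_ge0 ?(ltW bt0)].
by rewrite lerDr powR_ge0.
Qed.

(** The first level with [G j x < s] gives a set inside the ball of radius [s]; the level before the
    first with [c1 * G i x < s] gives one containing it. The factor [phi] bounds the drop of [G]
    between consecutive levels. *)
Lemma ahlfors_from_scales (R : realType) (X : metricType R)
    (theta : distance R X) (r : nat -> R) (G : nat -> X -> R)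
    (p b1 b2 c1 C2 phi g0 : R) (x0 : remetric theta)
    (nu : {measure set (borel x0) -> \bar R}) :
  compact [set: remetric theta] -> 0 < p -> 0 < c1 -> 0 < C2 -> 0 < phi ->
  (forall j x, 0 < G j x) -> (forall x, G 0%N x = g0) ->
  (forall j x, phi * G j x <= G j.+1 x) ->
  (forall x e, 0 < e -> exists j, G j x < e) ->
  (forall x y : X, theta x y <= G 0%N x) ->
  (forall j (x y : X), mdist x y <= b1 * r j -> theta x y <= G j x) ->
  (forall j (x y : X), b2 * r j < mdist x y -> c1 * G j x <= theta x y) ->
  (forall j (x : X) (E : set (borel x0)), measurable E ->
    (forall y : X, mdist x y <= b1 * r j -> E y) ->
    ((G j x `^ p)%:E <= nu E)%E) ->
  (forall j (x : X) (E : set (borel x0)), measurable E ->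
    (forall y : X, E y -> mdist x y <= b2 * r j) ->
    (nu E <= (C2 * G j x `^ p)%:E)%E) ->
  nu setT = 1%E ->
  ahlfors_regular_of_dim (remetric theta) p.
Proof.
move=> Tc p0 c10 C20 phi0 G0 G0E Gphi Gsmall diamT up low nulow nuup nuT.
have g00 : 0 < g0 by rewrite -(G0E x0).
exists x0, nu; split; first by apply: finite_borel_radon => //; rewrite nuT ltry.
pose Ka := (phi^-1) `^ p; pose Kb := ((c1 * g0)^-1) `^ p.
pose Kc := C2 * ((c1 * phi)^-1) `^ p.
have Ka0 : 0 < Ka by rewrite /Ka; pos.
have Kb0 : 0 < Kb by rewrite /Kb; pos.
have Kc0 : 0 < Kc by rewrite /Kc; pos.
exists (1 + Ka + Kb + Kc); split; first by move: Ka0 Kb0 Kc0; glra.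
set K := 1 + Ka + Kb + Kc.
have K0 : 0 < K by rewrite /K; move: Ka0 Kb0 Kc0; glra.
move=> x s s0 sd.
have sp0 : 0 < s `^ p by exact: powR_gt0.
have mB : measurable (ball x s : set (borel x0)).
  by apply: borel_measurable_open; exact: mball_open.
have sg : s <= g0.
  rewrite -lee_fin; apply: le_trans sd _; apply: nnsup_le.
    by rewrite lee_fin ltW.
  move=> _ [y [z [_ _ ->]]]; rewrite lee_fin; apply: le_trans (diamT y z) _.
  by rewrite G0E.
rewrite lee_pdivlMr// lee_pdivrMr// -!EFinM; apply/andP; split.
- have exj := Gsmall x s s0.
  case: (ex_minnP exj) => [[|j] Gj jmin].
    by move: Gj; rewrite G0E ltNge sg.
  have Gj' : s <= G j x by rewrite leNgt; apply/negP => /jmin; rewrite ltnn.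
  apply: le_trans (nulow j.+1 x _ mB _).
    rewrite lee_fin; apply: (@le_trans _ _ ((phi * s) `^ p)).
      rewrite powRM ?(ltW phi0) ?(ltW s0)// ler_wpM2r ?powR_ge0//.
      rewrite invf_ple ?posrE ?powR_gt0//; apply: (@le_trans _ _ Ka).
        rewrite /Ka -[phi^-1]powR_inv1 ?(ltW phi0)// -powRrM mulN1r powRN.
        exact: lexx.
      by rewrite /K; move: Ka0 Kb0 Kc0; glra.
    apply: ler_powR2r; rewrite ?(ltW p0)// ?mulr_ge0 ?(ltW phi0) ?(ltW s0)//.
    by apply: le_trans (Gphi j x); rewrite ler_pM2l.
  move=> y xy; rewrite ballEmdist /=; apply: le_lt_trans Gj; exact: (up j.+1 x y xy).
- have exi : exists i, c1 * G i x < s.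
    have [i Hi] := Gsmall x (s / c1) (divr_gt0 s0 c10).
    by exists i; rewrite mulrC -ltr_pdivlMr.
  case: (ex_minnP exi) => [[|i] Gi imin].
    (* Already [c1 * g0 < s]: the total mass 1 is a sufficient bound. *)
    apply: (@le_trans _ _ 1%E).
      rewrite -nuT; apply: le_measure; rewrite ?inE; [exact: mB| |by []].
      exact: measurableT.
    rewrite lee_fin; apply: (@le_trans _ _ (Kb * s `^ p)).
      rewrite G0E in Gi; rewrite /Kb -powRM ?invr_ge0 ?mulr_ge0 ?(ltW c10) ?(ltW g00) ?(ltW s0)//.
      have h1 : 1 <= (c1 * g0)^-1 * s.
        by rewrite mulrC ler_pdivlMr ?mulr_gt0// mul1r ltW.
      by have := ler_powR2r (ltW p0) ler01 h1; rewrite powR1.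
    by rewrite ler_wpM2r ?powR_ge0// /K; move: Ka0 Kb0 Kc0; glra.
  have Gi' : s <= c1 * G i x by rewrite leNgt; apply/negP => /imin; rewrite ltnn.
  apply: le_trans (nuup i x _ mB _) _.
    move=> y; rewrite ballEmdist /= => xy; rewrite leNgt; apply/negP => h.
    by have := low i x y h; rewrite leNgt (lt_le_trans xy).
  rewrite lee_fin; apply: (@le_trans _ _ (Kc * s `^ p)).
    rewrite /Kc -mulrA -powRM ?invr_ge0 ?mulr_ge0 ?(ltW c10) ?(ltW phi0) ?(ltW s0)//.
    rewrite ler_wpM2l ?(ltW C20)// ler_powR2r ?(ltW p0) ?(ltW (G0 _ _))//.
    rewrite mulrC ler_pdivlMr ?mulr_gt0//.
    apply: le_trans (ltW Gi); rewrite mulrC -mulrA ler_pM2l//.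
  by rewrite ler_wpM2r ?powR_ge0// /K; move: Ka0 Kb0 Kc0; glra.
Qed.

(** Balls of radius [r j] around the cells have [theta]-diameter at most twice the [p]-th root of
    the mass. With exponent [p + e], the masses sum to 1 and the excess [e] falls on a quantity that
    tends to 0. *)
Lemma dim_from_scales (R : realType) (X : metricType R) (theta : distance R X)
    (V : nat -> finType) (c : forall j, V j -> X) (r : nat -> R)
    (mu : forall j, V j -> R) (p : R) :
  0 < p -> (forall j A, 0 < mu j A) -> (forall j, \sum_A mu j A = 1) ->
  (forall j x, exists A : V j, mdist (c j A) x <= r j) ->
  (forall j A y, mdist (c j A) y <= r j -> theta (c j A) y <= mu j A `^ p^-1) ->
  (forall e, 0 < e -> exists j, forall A, mu j A `^ p^-1 < e) ->
  (hausdorff_dim [set: remetric theta] <= p%:E)%E.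
Proof.
move=> p0 mu0 mu1 cover thetamu small.
apply/lee_addgt0Pr => e e0; rewrite -EFinD; apply: ereal_inf_lbound.
exists (p + e) => //; set s := p + e.
have s0 : 0 < s by rewrite addr_gt0.
split => //; apply/eqP; rewrite eq_le; apply/andP; split; last first.
  apply: (@le_trans _ _ (hausdorff_content s 1 [set: remetric theta])).
    apply: le_ereal_inf_tmp => _ [F _ <-].
    by apply: nneseries_ge0 => i _ _; exact: poweR_ge0.
  by apply: ereal_sup_ubound; exists 1; rewrite //= ltr01.
apply: ge_ereal_sup => _ [d d0 <-]; rewrite /= in d0.
apply/lee_addgt0Pr => w w0; rewrite add0e.
pose a := Num.min (d / 2) ((w / 2 `^ s) `^ e^-1).
have ws0 : 0 < w / 2 `^ s by rewrite divr_gt0// powR_gt0.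
have a0 : 0 < a by rewrite /a lt_min divr_gt0//= powR_gt0.
have ad : 2 * a <= d.
  have : a <= d / 2 by rewrite /a ge_min lexx.
  by glra.
have aw : 2 `^ s * a `^ e <= w.
  rewrite mulrC -ler_pdivlMr ?powR_gt0//.
  apply: (@le_trans _ _ (((w / 2 `^ s) `^ e^-1) `^ e)).
    by apply: ler_powR2r; rewrite ?(ltW e0) ?(ltW a0)// /a ge_min lexx orbT.
  by rewrite -powRrM mulVf ?gt_eqF// powRr1// ltW.
have [j Hj] := small a a0.
pose Bs (A : V j) : set (remetric theta) := [set y | mdist (c j A) y <= r j].
have dB A : (diam (Bs A) <= (2 * mu j A `^ p^-1)%:E)%E.
  apply: nnsup_le; first by rewrite lee_fin mulr_ge0// powR_ge0.
  move=> _ [y [z [yA zA ->]]]; rewrite lee_fin.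
  apply: le_trans (distance_triangle theta (c j A) y z) _.
  rewrite (distance_sym theta y); have := thetamu j A y yA.
  by have := thetamu j A z zA; glra.
pose F i := nth set0 [seq Bs A | A <- enum (V j)] i.
have F0 i : (#|V j| <= i)%N -> F i = set0.
  by move=> h; rewrite /F nth_default// size_map -cardE.
have dF0 : diam (set0 : set (remetric theta)) = 0%E.
  by apply/eqP; rewrite eq_le nnsup_ge0 andbT; apply: nnsup_le => // t [y [z [[]]]].
apply: (@le_trans _ _ (\sum_(0 <= i <oo) poweR (diam (F i)) s)%E).
  apply: ereal_inf_lbound; exists F => //; split.
    move=> y _; have [A Ay] := cover j y.
    exists (index A (enum (V j))) => //; rewrite /F (nth_map A).
      by rewrite nth_index ?mem_enum.
    by rewrite index_mem mem_enum.
  move=> i; have [h|h] := leqP #|V j| i.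
    by rewrite F0// dF0 lee_fin ltW.
  pose A0 := enum_val (Ordinal h); rewrite /F (nth_map A0) -?cardE//.
  by apply: le_trans (dB _) _; rewrite lee_fin; move: (Hj (nth A0 (enum (V j)) i)) ad; glra.
rewrite (nneseries_split 0 #|V j|); last by move=> i _; exact: poweR_ge0.
rewrite add0n [X in (_ + X)%E]eseries0 ?adde0; last first.
  move=> i h _; rewrite F0// dF0 poweR_EFin powR0// gt_eqF//.
have -> : (\sum_(0 <= i < #|V j|) poweR (diam (F i)) s =
    \sum_(A : V j) poweR (diam (Bs A)) s)%E.
  rewrite -[RHS]big_enum -(big_map Bs xpredT (fun B => poweR (diam B) s)).
  by rewrite (big_nth set0) size_map -cardE.
apply: (@le_trans _ _ (\sum_(A : V j) (2 `^ s * a `^ e * mu j A)%:E)%E).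
  apply: lee_sum => A _; set hA := mu j A `^ p^-1 in dB.
  have h0 : 0 < mu j A `^ p^-1 by exact: powR_gt0.
  apply: (@le_trans _ _ ((2 * mu j A `^ p^-1) `^ s)%:E).
    rewrite -poweR_EFin; apply: gt0_ler_poweR; rewrite ?in_itv /= ?leey ?andbT ?(ltW s0)//.
      exact: nnsup_ge0.
    by rewrite lee_fin mulr_ge0// ltW.
  rewrite lee_fin powRM ?(ltW h0)// -mulrA ler_wpM2l ?powR_ge0//.
  rewrite {1}/s addrC powRD; last by apply/implyP => _; exact: lt0r_neq0.
  rewrite -[X in _ * X <= _]powRrM mulVf ?gt_eqF// powRr1 ?(ltW (mu0 _ _))//.
  rewrite ler_wpM2r ?(ltW (mu0 _ _))// ler_powR2r ?(ltW e0) ?(ltW h0)//.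
  by apply: ltW; exact: Hj.
by rewrite sumEFin lee_fin -mulr_sumr mu1 mulr1.
Qed.

(** Decay is proved for the limit measure: [m j x], the measure of a ball of radius [8 * r j], is
    comparable to [mu j (a j x)]. It contains the disjoint balls of the next level around [x] and
    around a point [z] given by [zex], and the one around [z] keeps a fixed share. *)
Lemma mass_decay (R : realType) (X : metricType R) (V : nat -> finType)
    (c : forall j, V j -> X) (r : nat -> R) (mu : forall j, V j -> R)
    (P : forall j, V j -> V j.+1 -> R) (a : forall j, X -> V j)
    (H K f ups : R) (N : nat) (x0 : X) :
  compact [set: X] -> (forall j, 0 < r j) -> (forall j, r j.+1 <= r j / 2) ->
  (forall j A, 0 < mu j A) -> \sum_A mu 0%N A = 1 ->
  (forall j B A, 0 <= P j B A) -> (forall j B, \sum_A P j B A = 1) ->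
  (forall j A, mu j.+1 A = \sum_B mu j B * P j B A) ->
  (forall j B A, 3 * r j < mdist (c _ B) (c _ A) -> P j B A = 0) ->
  0 < K -> 15 <= H ->
  (forall j A A', mdist (c j A) (c j A') <= H * r j -> mu j A <= K * mu j A') ->
  0 < f ->
  (forall j B A, mdist (c _ B) (c _ A) <= 3 * r j -> f * mu j B <= mu j.+1 A) ->
  (forall j x, mdist (c j (a j x)) x <= r j) ->
  (forall j (x : X), exists z, ups * r j <= mdist x z /\ mdist x z <= r j) ->
  (forall j, 16 * r j.+1 <= ups * r j) ->
  (forall j x, (#|[pred A : V j | (mdist x (c _ A) <= 14 * r j)%R]| <= N)%N) ->
  exists C dl, [/\ 1 <= C, 0 < dl, dl < 1 &
    forall i j x, mu (i + j)%N (a _ x) <= C * dl ^+ i * mu j (a j x)].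
Proof.
move=> Xc r0 rh mu0 mu1 P0 P1 muS Psupp K0 H15 muK f0 muf ad zex rups count.
have muge j A : 0 <= mu j A by exact: ltW.
have idc : continuous (idfun : X -> X) by move=> x; exact: cvg_id.
have [nu [nuT nulow nuup]] :=
  limit_measure x0 Xc idc r0 rh (muge 0%N) mu1 P0 P1 muS Psupp.
have mB x s : measurable (ball x s : set (borel x0)).
  by apply: borel_measurable_open; exact: mball_open.
(* Radius 8 exceeds the 1 + 6 that locates the mass of [a j x]; cells whose mass can reach the ball
   are within 8 + 6 = 14 of [x], hence within 15 of [a j x]. *)
pose m j x := fine (nu (ball x (8 * r j))).
have nufin x s : nu (ball x s) \is a fin_num.
  rewrite ge0_fin_numE ?measure_ge0//; apply: (@le_lt_trans _ _ 1%E).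
    rewrite -nuT; apply: le_measure; rewrite ?inE; [exact: mB| |by []].
    exact: measurableT.
  by rewrite ltry.
have mE j x : nu (ball x (8 * r j)) = (m j x)%:E by rewrite /m fineK.
have mlow j x : mu j (a j x) <= m j x.
  rewrite -lee_fin -mE; have := nulow j (pred1 (a j x)) _ (mB x (8 * r j)).
  rewrite big_pred1_eq; apply => A y /eqP -> h; rewrite ballEmdist /=.
  have := metric_triangle x (c j (a j x)) y; rewrite (metric_sym x (c j _)).
  by move: h (ad j x) (r0 j); glra.
have mup j x : m j x <= N%:R * K * mu j (a j x).
  rewrite -lee_fin -mE.
  pose Q := [pred A : V j | mdist x (c j A) <= 14 * r j].
  apply: le_trans (nuup j Q _ (mB x (8 * r j)) _) _.
    move=> A y; rewrite ballEmdist /= => h1 h2.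
    have := metric_triangle x y (c j A); rewrite (metric_sym y).
    by move: h1 h2; glra.
  rewrite lee_fin; apply: (@le_trans _ _ (\sum_(A | Q A) K * mu j (a j x))).
    apply: ler_sum => A QA; apply: muK.
    have := metric_triangle (c j A) x (c j (a j x)).
    rewrite (metric_sym (c j A) x) (metric_sym x (c j (a _ _))).
    have : 15 * r j <= H * r j by rewrite ler_pM2r.
    by move: QA (ad j x); rewrite /Q /=; glra.
  rewrite sumr_const -[leLHS]mulr_natl -mulrA ler_wpM2r ?mulr_ge0 ?(ltW K0)//.
  by rewrite ler_nat; exact: count.
have m0 j x : 0 < m j x by exact: lt_le_trans (mlow j x).
pose C := 1 + N%:R * K.
have NK0 : 0 <= N%:R * K by rewrite mulr_ge0 ?(ltW K0).
have C0 : 0 < C by rewrite ltr_wpDr.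
have mup' j x : m j x <= C * mu j (a j x).
  by apply: le_trans (mup j x) _; rewrite ler_wpM2r// lerDr.
pose dl := 1 - f / C.
have fC0 : 0 < f / C by rewrite divr_gt0.
have step j x : m j.+1 x <= dl * m j x.
  have [z [z1 z2]] := zex j x.
  have disj : ball x (8 * r j.+1) `&` ball z (8 * r j.+1) = set0.
    rewrite -subset0 => y []; rewrite !ballEmdist /= => xy zy.
    have := metric_triangle x y z; rewrite (metric_sym y).
    have := rups j; move: xy zy z1 => h1 h2 h3 h4 h5.
    have : mdist x z < mdist x z by move: h1 h2 h3 h4 h5; glra.
    by rewrite ltxx.
  have sub : ball x (8 * r j.+1) `|` ball z (8 * r j.+1) `<=` ball x (8 * r j).
    move=> y []; rewrite !ballEmdist /= => h.
      by move: h (rh j) (r0 j); glra.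
    have := metric_triangle x z y; move: h z2 (rh j) (r0 j); glra.
  have : (nu (ball x (8 * r j.+1)) + nu (ball z (8 * r j.+1))
      <= nu (ball x (8 * r j)))%E.
    rewrite -measureU//; apply: le_measure => //; rewrite inE//.
    exact: measurableU.
  rewrite !mE -EFinD lee_fin => h.
  have hz : f / C * m j x <= m j.+1 z.
    apply: le_trans (mlow j.+1 z).
    apply: (@le_trans _ _ (f * mu j (a j x))).
      rewrite -mulrA ler_wpM2l ?(ltW f0)// mulrC ler_pdivrMr// mulrC.
      exact: mup'.
    apply: muf.
    have := metric_triangle (c j (a j x)) x (c _ (a j.+1 z)).
    have := metric_triangle x z (c _ (a j.+1 z)).
    rewrite (metric_sym z (c _ _)).
    by move: (ad j x) (ad j.+1 z) z2 (rh j) (r0 j); glra.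
  by rewrite /dl; move: h hz; glra.
have dl0 : 0 < dl.
  have := lt_le_trans (m0 1%N x0) (step 0%N x0).
  by rewrite (pmulr_lgt0 _ (m0 0%N x0)).
have steps i j x : m (i + j)%N x <= dl ^+ i * m j x.
  elim: i => [|i IH]; first by rewrite expr0 mul1r.
  rewrite addSn exprS -mulrA; apply: le_trans (step _ _) _.
  by rewrite ler_wpM2l// ltW.
exists C, dl; split => //.
- by rewrite lerDl.
- by rewrite /dl; move: fC0; glra.
move=> i j x; apply: le_trans (mlow _ _) _; apply: le_trans (steps i j x) _.
rewrite [C * _]mulrC -mulrA ler_wpM2l ?exprn_ge0// ltW//.
Qed.

(** * The conformal dimension of the space *)

(** The scale function [G j x] is the [p]-th root of the mass of a cell of level [j] near [x]:
    [chain_distance] compares it with [theta], [mass_decay] and [muf] control its variation, and the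
    limit measure at that scale is comparable to its [p]-th power. *)
Lemma conformal_dim_le_of_weights (R : realType) (X : metricType R)
    (V : nat -> finType) (c : forall j, V j -> X) (r : nat -> R)
    (mem : forall j, V j -> X -> Prop) (w : forall j, V j -> V j.+1 -> R)
    (p C0 H bt ups : R) (N : nat) :
  [set: X] !=set0 -> compact [set: X] -> 0 < p -> 10 < C0 -> H = C0 + 20 ->
  1 < bt -> (forall j, 0 < r j) -> (forall j, r j = bt * r j.+1) ->
  (forall j, (2 * C0 + 10) * r j.+1 <= r j) -> (forall j, H * r j.+1 <= r j) ->
  (forall j, 16 * r j.+1 <= ups * r j) -> (forall j, r j.+1 <= r j / 2) ->
  (forall x y : X, mdist x y <= (C0 - 1) * r 0%N) ->
  (forall j (x : X), exists z, ups * r j <= mdist x z /\ mdist x z <= r j) ->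
  (forall j x, exists A : V j, mem j A x) ->
  (forall j A x, mem j A x -> mdist (c j A) x < r j) -> (0 < N)%N ->
  (forall j x, (#|[pred A : V j.+1 | (mdist x (c _ A) <= 3 * r j)%R]| <= N)%N) ->
  (forall j x, (#|[pred A : V j | (mdist x (c _ A) <= 14 * r j)%R]| <= N)%N) ->
  (forall j B A, 0 <= w j B A) -> (forall j B, \sum_A w j B A <= 1 / 2) ->
  (forall j B A, 2 * r j < mdist (c _ B) (c _ A) -> w j B A = 0) ->
  (forall n (B : V n) A u A', mem n B (c n.+1 A) ->
    path (fun D D' => mdist (c n.+1 D) (c n.+1 D') <= (2 * C0 + 5) * r n.+1)
      A (rcons u A') ->
    (forall D, D \in A :: u -> mdist (c n B) (c n.+1 D) < 2 * r n) ->
    2 * r n <= mdist (c n B) (c n.+1 A') ->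
    1 <= \sum_(D <- A :: u) w n B D `^ p^-1) ->
  (ahlfors_regular_conformal_dim X <= p%:E)%E.
Proof.
move=> X0 Xc p0 C010 HE bt1 r0 rbt gap1 gapH gapu rh diamX zex cover memd N0
  count1 count0 w0 wsum wsupp wcross.
have [x0 _] := X0.
have C00 : 0 < C0 by move: C010; glra.
have coverd j x : exists A : V j, mdist (c j A) x <= r j.
  by have [A mA] := cover j x; exists A; apply: ltW; exact: memd.
have count3 j x : (#|[pred B : V j | (mdist x (c _ B) <= 3 * r j)%R]| <= N)%N.
  apply: leq_trans (count0 j x); apply: subset_leq_card.
  apply/fintype.subsetP => A; rewrite !inE => h; apply: le_trans h _.
  by rewrite ler_pM2r//; glra.
have H5 : 5 <= H by rewrite HE; move: C010; glra.
have [mu [P [f0 [K [f00 K0 [mu0 mu1 muconst muK] [P0 P1 Psupp muS] [muw muf0]]]]]] :=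
  doubling_mass X0 r0 N0 H5 gapH coverd count1 count3 w0 wsum wsupp.
(* Capping at 1/2 makes [phi < 1]. *)
pose f := Num.min f0 (1 / 2).
have f_gt0 : 0 < f by rewrite lt_min f00; apply: divr_gt0.
have f_lt1 : f < 1.
  by apply: (@le_lt_trans _ _ (1 / 2)); [rewrite ge_min lexx orbT|glra].
have muf j B A : mdist (c _ B) (c _ A) <= 3 * r j -> f * mu j B <= mu j.+1 A.
  move=> h; apply: le_trans (muf0 j B A h); rewrite ler_pM2r//.
  by rewrite ge_min lexx.
have pV0 : 0 < p^-1 by rewrite invr_gt0.
have pVp : p^-1 * p = 1 by rewrite mulVf ?gt_eqF.
pose h j A := mu j A `^ p^-1.
have h0 j A : 0 < h j A by exact: powR_gt0.
have hp j A : h j A `^ p = mu j A by rewrite /h -powRrM pVp powRr1// ltW.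
have hle u j (A : V j) : 0 <= u -> u <= mu j A -> u `^ p^-1 <= h j A.
  by move=> u0 uA; apply: ler_powR2r => //; exact: ltW.
have cross n (B : V n) A u A' : mem n B (c n.+1 A) ->
    path (fun D D' => mdist (c n.+1 D) (c n.+1 D') <= (2 * C0 + 5) * r n.+1)
      A (rcons u A') ->
    (forall D, D \in A :: u -> mdist (c n B) (c n.+1 D) < 2 * r n) ->
    2 * r n <= mdist (c n B) (c n.+1 A') ->
    h n B <= \sum_(D <- A :: u) h n.+1 D.
  (* Heights are [p]-th roots of masses, so [muw] bounds [h n.+1 D] below by [h n B] times the root
     of the weight. *)
  move=> h1 h2 h3 h4; have h5 := wcross n B A u A' h1 h2 h3 h4.
  apply: (@le_trans _ _ (h n B * \sum_(D <- A :: u) w n B D `^ p^-1)).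
    by rewrite ler_peMr// ltW.
  rewrite mulr_sumr; apply: ler_sum => D _; rewrite mulrC -powRM ?(ltW (mu0 _ _))//.
  by apply: hle => //; rewrite mulr_ge0 ?(ltW (mu0 _ _)).
have C03 : 3 <= C0 by move: C010; glra.
have diamX' (x y : X) : mdist x y <= C0 * r 0%N.
  by apply: le_trans (diamX x y) _; rewrite ler_pM2r//; glra.
have [theta [T1 T2]] :=
  chain_distance C03 r0 gap1 h0 cover memd diamX' cross.
have Ha0 j : exists aj : X -> V j, forall x, mdist (c j (aj x)) x <= r j.
  by have [aj Haj] := choice (coverd j); exists aj.
have [a Ha] := dependent_function_choice Ha0.
have H15 : 15 <= H by rewrite HE; move: C010; glra.
have [C [dl [C1 dl0 dl1 decay]]] :=
  mass_decay x0 Xc r0 rh mu0 (mu1 0%N) P0 P1 muS Psupp K0 H15 muK f00 muf0 Ha zex gapu count0.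
have C_gt0 : 0 < C by exact: lt_le_trans C1.
pose G j x := h j (a j x).
pose g0 := h 0%N (a 0%N x0).
have G00 x : G 0%N x = g0 by rewrite /G /g0 /h (muconst _ (a 0%N x0)).
pose phi := f `^ p^-1.
have phi0 : 0 < phi by exact: powR_gt0.
have pow1 : (1 : R) `^ p^-1 = 1 by rewrite powR1.
have phi1 : phi < 1.
  by rewrite -[ltRHS]pow1 gt0_ltr_powR// nnegrE ltW.
have Gstep j x : phi * G j x <= G j.+1 x.
  rewrite -powRM ?(ltW f_gt0) ?(ltW (mu0 _ _))//.
  apply: hle; first by rewrite mulr_ge0 ?(ltW f_gt0) ?(ltW (mu0 _ _)).
  apply: muf; have := metric_triangle (c j (a j x)) x (c j.+1 (a j.+1 x)).
  rewrite (metric_sym x (c _ _)); have := Ha j x; have := Ha j.+1 x; have := rh j.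
  by have := r0 j; glra.
have Glow i j x : phi ^+ i * G j x <= G (i + j)%N x.
  elim: i => [|i IH]; first by rewrite expr0 mul1r.
  rewrite exprS -mulrA addSn; apply: le_trans (Gstep _ _).
  by rewrite ler_pM2l.
pose C' := C `^ p^-1.
pose dl' := dl `^ p^-1.
have C'1 : 1 <= C' by rewrite -[leLHS]pow1 ge0_ler_powR// ?nnegrE ?ltW.
have C'0 : 0 < C' by exact: lt_le_trans C'1.
have dl'0 : 0 < dl' by exact: powR_gt0.
have dl'1 : dl' < 1 by rewrite -[ltRHS]pow1 gt0_ltr_powR// nnegrE ltW.
have Gup i j x : G (i + j)%N x <= C' * dl' ^+ i * G j x.
  have -> : C' * dl' ^+ i * G j x = (C * dl ^+ i * mu j (a j x)) `^ p^-1.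
    have dli : 0 <= dl ^+ i by rewrite exprn_ge0// ltW.
    rewrite !powRM ?mulr_ge0 ?(ltW C_gt0) ?(ltW (mu0 _ _))//; congr (_ * _ * _).
    rewrite -powR_mulrn ?powR_ge0// -powRrM mulrC powRrM powR_mulrn//.
    exact: ltW.
  by apply: ler_powR2r => //; [exact: ltW|exact: (ltW (mu0 _ _))].
have up j (x y : X) : mdist x y <= (C0 - 1) * r j -> theta x y <= G j x.
  move=> xy; apply: T1.
    rewrite metric_sym; apply: le_trans (Ha j x) _.
    by rewrite ler_peMl ?ltW//; move: C010; glra.
  have := metric_triangle y x (c j (a j x)); rewrite (metric_sym y x).
  by rewrite (metric_sym x (c _ _)); have := Ha j x; move: xy; glra.
(* A cell of level [i <= j] near [x] has at least [K^-1] times the mass of [a i x], which is at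
   least [C^-1] times that of [a j x]. *)
pose c1 := (C * K)^-1 `^ p^-1.
have c10 : 0 < c1 by rewrite powR_gt0// invr_gt0 mulr_gt0.
have low j (x y : X) : 5 * r j < mdist x y -> c1 * G j x <= theta x y.
  move=> xy; apply: T2 xy _ => i B ij xB.
  rewrite -powRM ?invr_ge0 ?mulr_ge0 ?(ltW C_gt0) ?(ltW K0) ?(ltW (mu0 _ _))//.
  apply: hle; first by rewrite mulr_ge0 ?invr_ge0 ?mulr_ge0 ?(ltW C_gt0) ?(ltW K0) ?(ltW (mu0 _ _)).
  rewrite ler_pdivrMl ?mulr_gt0//.
  have := decay (j - i)%N i x; rewrite subnK// => h1; apply: le_trans h1 _.
  apply: (@le_trans _ _ (C * mu i (a i x))).
    rewrite ler_pM2r//; apply: ler_piMr; first exact: ltW.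
    by apply: exprn_ile1; exact: ltW.
  rewrite -mulrA ler_pM2l//; apply: muK.
  have := metric_triangle (c i (a i x)) x (c i B).
  by have := Ha i x; move: xB; rewrite HE; have := r0 i; glra.
have diamG (x y : X) : theta x y <= G 0%N x by exact: up (diamX x y).
have b21 : (5 : R) <= C0 - 1 by move: C010; glra.
have QS : @quasisymmetric R X (remetric theta) idfun.
  apply: (qs_from_scales (theta := theta) (G := G) bt1 r0 rbt (ltr0n R 5) b21
    c10 phi0 phi1 C'1 dl'0 dl'1) => //.
  by move=> j x; exact: h0.
have [[idc _] _] := QS.
have Tc : compact [set: remetric theta].
  rewrite -[setT](_ : (idfun : X -> remetric theta) @` setT = _).
    by apply: continuous_compact => //; exact: continuous_subspaceT.
  by rewrite image_id.
have [nu [nu1 nulow nuup]] := limit_measure (g := (idfun : X -> remetric theta))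
  x0 Xc idc r0 rh (fun A => ltW (mu0 _ A)) (mu1 0%N) P0 P1 muS Psupp.
have small e : 0 < e -> exists j, C' * dl' ^+ j * g0 < e.
  move=> e0; have g00 : 0 < g0 by exact: h0.
  have [j Hj] : exists j, dl' ^+ j < e / (C' * g0).
    have e' : 0 < e / (C' * g0) by rewrite divr_gt0 ?mulr_gt0.
    have := cvg_expr (z := dl'); rewrite gtr0_norm// => /(_ dl'1).
    move/cvgrPdist_lt => /(_ _ e')[j _ /(_ j (leqnn j))].
    by rewrite /= sub0r normrN ger0_norm ?exprn_ge0 ?ltW// => ?; exists j.
  exists j; move: Hj; rewrite ltr_pdivlMr ?mulr_gt0//.
  by rewrite [C' * dl' ^+ j]mulrC -mulrA.
have G0small e : 0 < e -> exists j, forall x, G j x < e.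
  move=> e0; have [j Hj] := small e e0; exists j => x.
  by have := Gup j 0%N x; rewrite addn0 G00 => h1; exact: le_lt_trans h1 Hj.
have AR : ahlfors_regular_of_dim (remetric theta) p.
  apply: (ahlfors_from_scales (theta := theta) (r := r) (G := G) (b1 := C0 - 1)
    (b2 := 5) (c1 := c1) (C2 := N%:R * K) (phi := phi) (g0 := g0) (nu := nu))
    => //.
  - by rewrite mulr_gt0// ltr0n.
  - by move=> j x; exact: h0.
  - by move=> x e /G0small[j Hj]; exists j.
  - move=> j x E mE HE'; rewrite hp.
    have := nulow j (pred1 (a j x)) E mE; rewrite big_pred1_eq; apply.
    move=> _ y /eqP-> h1; apply: HE'.
    have := metric_triangle x (c j (a j x)) y; rewrite (metric_sym x (c _ _)).
    have h2 : 7 * r j <= (C0 - 1) * r j by rewrite ler_pM2r//; move: C010; glra.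
    by have := Ha j x; move: h1 h2; glra.
  - move=> j x E mE HE'; rewrite hp.
    pose Q := [pred A : V j | (mdist x (c _ A) <= 14 * r j)%R].
    apply: le_trans (nuup j Q E mE _) _.
      move=> A y /HE' h1 h2 /=; have := metric_triangle x y (c j A).
      by rewrite (metric_sym y); move: h1 h2; have := r0 j; glra.
    rewrite lee_fin; apply: (@le_trans _ _ (\sum_(A | Q A) K * mu j (a j x))).
      apply: ler_sum => A /= h1; apply: muK.
      have := metric_triangle (c j A) x (c j (a j x)).
      rewrite (metric_sym _ x) (metric_sym x (c j (a _ _))).
      have h2 : 15 * r j <= H * r j by rewrite ler_pM2r.
      by move: h1 h2 (Ha j x); glra.
    rewrite sumr_const -[leLHS]mulr_natl -[leRHS]mulrA ler_pM2r ?mulr_gt0//.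
    by rewrite ler_nat; exact: count0.
have HD : (hausdorff_dim [set: remetric theta] <= p%:E)%E.
  apply: (dim_from_scales (theta := theta) (c := c) (r := r) (mu := mu)) => //.
  - move=> j A y h1; apply: T1.
      by rewrite mdistxx mulr_ge0 ?(ltW C00) ?(ltW (r0 _)).
    rewrite metric_sym; apply: le_trans h1 _.
    by rewrite ler_peMl ?ltW//; move: C010; glra.
  - move=> e e0; pose e' := e / K `^ p^-1.
    have [|j Hj] := G0small e'; first by rewrite divr_gt0// powR_gt0.
    exists j => A; have := Hj (c j A); rewrite ltr_pdivlMr ?powR_gt0//.
    apply: le_lt_trans; rewrite -powRM ?(ltW K0) ?(ltW (mu0 _ _))//.
    apply: ler_powR2r; rewrite ?(ltW pV0) ?(ltW (mu0 _ _))//.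
    rewrite mulrC; apply: muK; rewrite metric_sym; apply: le_trans (Ha _ _) _.
    by rewrite ler_peMl ?ltW//; move: H15; glra.
apply: le_trans HD; apply: ereal_inf_lbound; exists theta => //; split=> //.
by exists p.
Qed.

(** A run may repeat cells, while path weights are summed over a set. *)
Lemma ler_sum_mem_seq (R : numDomainType) (I : finType) (s : seq I) (F : I -> R) :
  (forall i, 0 <= F i) -> \sum_(i in s) F i <= \sum_(i <- s) F i.
Proof.
move=> F0; elim: s => [|x s IH]; first by rewrite big_nil big_pred0.
rewrite big_cons (bigD1 x) ?mem_head//= lerD2l; apply: le_trans IH.
rewrite big_mkcond [leRHS]big_mkcond; apply: ler_sum => i _; rewrite inE.
by case: eqVneq => [->|_] /=; do ?case: ifP.
Qed.

Lemma conformal_dim_le (R : realType) (X : metricType R) (kappa b : R)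
    (U : coverings X kappa b) (L p : R) :
  1 < kappa -> 1 < b -> compact [set: X] -> doubling X ->
  uniformly_perfect X -> (exists x y : X, x != y) ->
  uniformly_linearly_connected_components X ->
  uniformly_separated_components X -> 0 <= L -> 0 < p ->
  limn_einf (sup_modulus_curves U L p) = 0%E ->
  (ahlfors_regular_conformal_dim X <= p%:E)%E.
Proof.
move=> kappa1 b1 Xc XD [KP [KP1 HKP]] [y0 [y1 y01]] Xl Xs L0 p0 HL.
have kappa0 : 0 < kappa by exact: lt_trans kappa1.
have b0 : 0 < b by exact: lt_trans b1.
have KP0 : 0 < KP by exact: lt_trans KP1.
have scale0 n : 0 < b ^- n by exact: scale_gt0.
(* Level 0 of the construction is level 1 of the covering, the first that is constrained. *)
pose r0 := kappa * b ^- 1.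
have r00 : 0 < r0 by exact: mulr_gt0.
have [Dm Dm0 HDm] : exists2 Dm, 0 < Dm & forall x y : X, mdist x y <= Dm.
  have [s Hs] := compact_ball_cover Xc ltr01.
  exists (1 + 2 * \sum_(z <- s) (mdist y0 z + 1)).
    by rewrite ltr_pwDl// mulr_ge0// sumr_ge0// => z _; rewrite addr_ge0 ?mdist_ge0.
  have near x : mdist y0 x <= \sum_(z <- s) (mdist y0 z + 1).
    have [z /= zs] := Hs x I; rewrite ballEmdist /= => zx.
    rewrite (big_rem z)//=; apply: (@le_trans _ _ (mdist y0 z + 1)).
      by have := metric_triangle y0 z x; move: zx; glra.
    by rewrite lerDl sumr_ge0// => w _; rewrite addr_ge0 ?mdist_ge0.
  move=> x y; have := metric_triangle x y0 y; rewrite (metric_sym x y0).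
  by have := near x; have := near y; glra.
pose C0 := 10 + Dm / r0.
have Dr0 : 0 < Dm / r0 by exact: divr_gt0.
have C010 : 10 < C0 by rewrite ltrDl.
have diamX (x y : X) : mdist x y <= (C0 - 1) * r0.
  apply: le_trans (HDm x y) _; have : Dm = Dm / r0 * r0 by rewrite divfK ?gt_eqF.
  by rewrite /C0; move: r00; glra.
pose H := C0 + 20.
pose d0 := mdist y0 y1.
have d00 : 0 < d0 by rewrite mdist_gt0.
(* Keeps [ups0 * r j] below the diameter, where uniform perfectness applies. *)
pose ups0 := Num.min 1 (d0 / r0).
have ups00 : 0 < ups0 by rewrite lt_min ltr01 divr_gt0.
pose ups := ups0 / KP.
have upsp : 0 < ups by rewrite divr_gt0.
(* One ratio that dominates every gap required between consecutive radii. *)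
pose bt0 := 2 * C0 + 30 + 16 / ups.
have bt00 : 0 < bt0.
  have : 0 < 16 / ups by rewrite divr_gt0.
  by rewrite /bt0; move: C010; glra.
have Lam0 : 0 <= (2 * C0 + 5) * kappa.
  by apply: mulr_ge0; [move: C010; glra|exact: ltW].
have [Ck [m [k0 [Ck0 HCk]]]] :=
  discrete_weights kappa1 b1 U Xc XD Xl Xs L0 Lam0 p0.
have [k1 Hk1] := scale_small b1 (e := bt0^-1) ltac:(by rewrite invr_gt0).
have HL' := (limn_einf_eq0P (fun n => nnsup_ge0 _)).1 HL.
have eps0 : 0 < (2 * Ck)^-1 by rewrite invr_gt0 mulr_gt0.
have [k] := HL' _ (maxn k0 k1) eps0.
rewrite geq_max => /andP[kk0 kk1] Mk.
pose st := (m + k)%N.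
have bst : b ^- st < bt0^-1 by apply: Hk1; apply: leq_trans kk1 (leq_addl _ _).
pose bt := b ^+ st.
have btb : bt0 < bt.
  by move: bst; rewrite ltf_pV2 ?posrE ?exprn_gt0.
pose lev := fix lev j := if j is j'.+1 then (lev j' + (m + k))%N else 1%N.
have lev0 j : (0 < lev j)%N by elim: j => [//|j IH] /=; rewrite addn_gt0 IH.
pose V j := cells U (lev j).
pose c j (A : V j) := cell_center A.
pose r j := kappa * b ^- lev j.
have rp j : 0 < r j by exact: mulr_gt0.
have rbt j : r j = bt * r j.+1.
  rewrite /r /bt [lev j.+1]/= scaleD mulrCA; congr (kappa * _).
  by rewrite mulrCA divff ?mulr1// gt_eqF// exprn_gt0.
have rgap t j : t <= bt -> t * r j.+1 <= r j.
  by move=> h; rewrite (rbt j) ler_pM2r.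
have ups16 : 0 < 16 / ups by rewrite divr_gt0.
have gap1 j : (2 * C0 + 10) * r j.+1 <= r j.
  by apply: rgap; apply: le_trans (ltW btb); rewrite /bt0; move: ups16; glra.
have gapH j : H * r j.+1 <= r j.
  apply: rgap; apply: le_trans (ltW btb).
  by rewrite /bt0 /H; move: ups16 C010; glra.
have gapu j : 16 * r j.+1 <= ups * r j.
  rewrite mulrC -ler_pdivrMl// mulrCA.
  have : 16 / ups * r j.+1 <= r j.
    apply: rgap; apply: le_trans (ltW btb); rewrite /bt0; move: C010; glra.
  by glra.
have rh j : r j.+1 <= r j / 2.
  have : 2 * r j.+1 <= r j.
    apply: rgap; apply: le_trans (ltW btb); rewrite /bt0; move: C010 ups16; glra.
  by glra.
have cover j x : exists A : V j, cell A x by exact: cell_exists.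
have memd j (B : V j) x : cell B x -> mdist (c j B) x < r j.
  exact: cell_dist.
have Ck2 : Ck * (2 * Ck)^-1 = 1 / 2.
  by rewrite invfM mulrCA divff ?mulr1 ?mul1r ?gt_eqF.
have Hw j : exists wj : V j -> V j.+1 -> R, [/\ forall B A, 0 <= wj B A,
    forall B, \sum_A wj B A <= 1 / 2,
    forall B A, 2 * r j < mdist (c _ B) (c _ A) -> wj B A = 0 &
    forall B A u A', cell B (c j.+1 A) ->
      path (fun D D' => mdist (c j.+1 D) (c j.+1 D') <= (2 * C0 + 5) * r j.+1)
        A (rcons u A') ->
      (forall D, D \in A :: u -> mdist (c j B) (c j.+1 D) < 2 * r j) ->
      2 * r j <= mdist (c j B) (c j.+1 A') ->
      1 <= \sum_(D <- A :: u) wj B D `^ p^-1].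
  have [rho Hrho] := choice (fun B : V j =>
    HCk k _ kk0 Mk (lev j) (lev j.+1) B (lev0 j) erefl).
  (* Truncating to the double of [B] loses nothing: the run stays inside until its exit cell, which
     [belast] leaves out. *)
  exists (fun B A => if mdist (c j B) (c j.+1 A) < 2 * r j
    then rho B A `^ p else 0); split.
  - by move=> B A; case: ifP => // _; exact: powR_ge0.
  - move=> B; have [_ h _] := Hrho B; rewrite -Ck2; apply: le_trans h.
    by apply: ler_sum => A _; case: ifP => // _; exact: powR_ge0.
  - by move=> B A h; rewrite ltNge (ltW h).
  - move=> B A u A' BA uA near far; have [rho0 _ cross] := Hrho B.
    have := cross A (rcons u A'); rewrite belast_rcons last_rcons => h.
    apply: le_trans (h _ BA _) _.
    + by apply: sub_path uA => D D' /=; rewrite /r mulrA.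
    + by rewrite /dilate ballEmdist /= -mulrA; apply/negP; rewrite -leNgt.
    + apply: (@le_trans _ _ (\sum_(D <- A :: u) rho B D)).
        exact: ler_sum_mem_seq.
      rewrite big_seq [leRHS]big_seq; apply: ler_sum => D DA; rewrite near//.
      by rewrite -powRrM divff ?gt_eqF// powRr1.
have [w Hw'] := dependent_function_choice Hw.
have [N1 [N10 HN1]] := cell_count kappa1 b1 U XD (3 * kappa * bt).
have [N2 [N20 HN2]] := cell_count kappa1 b1 U XD (14 * kappa).
have diam_d0 : (d0%:E <= diam [set: X])%E by exact: diam_ge.
apply: (conformal_dim_le_of_weights (V := V) (c := c) (r := r)
  (mem := fun j => @cell _ _ _ _ U (lev j)) (w := w) (C0 := C0) (H := H)
  (bt := bt) (ups := ups) (N := (N1 + N2)%N)) => //.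
- by exists y0.
- by apply: lt_trans btb; rewrite /bt0; move: C010 ups16; glra.
- move=> j x; have ur : 0 < ups0 * r j by exact: mulr_gt0.
  have ud : ((ups0 * r j)%:E <= diam [set: X])%E.
    apply: le_trans diam_d0; rewrite lee_fin.
    apply: (@le_trans _ _ (d0 / r0 * r0)); last by rewrite divfK ?gt_eqF.
    apply: ler_pM; rewrite ?(ltW ups00) ?(ltW (rp j)) ?ge_min ?lexx ?orbT//.
    by rewrite ler_pM2l// lef_pV2 ?posrE ?exprn_gt0// ler_eXn2l.
  have [z [z1 z2]] := HKP x _ ur ud; exists z; split.
    by move: z2; rewrite ballEmdist /= => /negP; rewrite -leNgt mulrA [_ * ups0]mulrC.
  move: z1; rewrite ballEmdist /= => /ltW/le_trans; apply.
  by apply: ler_piMl; [exact: ltW|rewrite ge_min lexx].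
- by rewrite addn_gt0 N10.
- move=> j x; apply: leq_trans (leq_addr _ _); apply: leq_trans (HN1 (lev j.+1) x _) => //.
  apply: subset_leq_card; apply/fintype.subsetP => A; rewrite !inE.
  by rewrite (rbt j) /r -!mulrA [kappa * (bt * _)]mulrCA.
- move=> j x; apply: leq_trans (leq_addl _ _); apply: leq_trans (HN2 (lev j) x _) => //.
  apply: subset_leq_card; apply/fintype.subsetP => A; rewrite !inE.
  by rewrite /r mulrA.
- by move=> j; have [] := Hw' j.
- by move=> j; have [] := Hw' j.
- by move=> j; have [] := Hw' j.
- by move=> j; have [] := Hw' j.
Qed.

(** * The one-point space *)

Section OnePoint.
Context {R : realType} {X : metricType R}.
Hypothesis X1 : forall x y : X, x = y.

Lemma diam_one_point (A : set X) : diam A = 0%E.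
Proof.
apply/eqP; rewrite eq_le nnsup_ge0 andbT; apply: nnsup_le => // t.
by move=> [x [y [_ _ ->]]]; rewrite (X1 x y) mdistxx.
Qed.

Lemma hausdorff_dim_one_point : hausdorff_dim [set: X] = 0%E.
Proof.
apply/eqP; rewrite eq_le; apply/andP; split; last first.
  by apply: le_ereal_inf_tmp => _ [s [s0 _] <-]; rewrite lee_fin ltW.
apply/lee_addgt0Pr => s s0; rewrite add0e; apply: ereal_inf_lbound.
exists s => //; split=> //; suff H d : 0 < d -> hausdorff_content s d [set: X] = 0%E.
  rewrite /hausdorff_measure (_ : [set _ | _ in _] = [set 0%E]) ?ereal_sup1//.
  by apply/seteqP; split=> [_ [d d0 <-]|_ ->]; [exact: H|exists 1; rewrite ?H /= ?ltr01].
move=> d0; apply/eqP; rewrite eq_le; apply/andP; split; last first.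
  apply: le_ereal_inf_tmp => _ [F _ <-].
  by apply: nneseries_ge0 => i _ _; exact: poweR_ge0.
apply: ereal_inf_lbound; exists (fun=> setT).
  by split=> [x _|i]; [exists 0%N|rewrite diam_one_point lee_fin ltW].
rewrite eseries0// => i _ _; rewrite diam_one_point poweR_EFin powR0//.
exact: lt0r_neq0.
Qed.

End OnePoint.

(** No radius satisfies [0 < r <= diam], so Ahlfors regularity holds vacuously, even with the zero
    measure. *)
Lemma conformal_dim_one_point (R : realType) (X : metricType R) :
  [set: X] !=set0 -> compact [set: X] -> (forall x y : X, x = y) ->
  ahlfors_regular_conformal_dim X = 0%E.
Proof.
move=> [x0 _] Xc X1.
have dim0 (theta : distance R X) : hausdorff_dim [set: remetric theta] = 0%E.
  exact: hausdorff_dim_one_point.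
pose theta := Distance (@mdistxx R X) (fun x y _ => X1 x y) (@metric_sym R X)
  (fun y x z => metric_triangle x y z).
have idc : continuous (idfun : X -> remetric theta).
  have -> : (idfun : X -> remetric theta) = cst x0 by apply/funext => x; exact: X1.
  exact: cst_continuous.
have idc' : continuous (idfun : remetric theta -> X).
  have -> : (idfun : remetric theta -> X) = cst x0 by apply/funext => x; exact: X1.
  exact: cst_continuous.
have Tc : compact [set: remetric theta].
  rewrite -[setT](_ : (idfun : X -> remetric theta) @` setT = _).
    by apply: continuous_compact => //; exact: continuous_subspaceT.
  by rewrite image_id.
apply/eqP; rewrite eq_le; apply/andP; split; last first.
  by apply: le_ereal_inf_tmp => _ [th _ <-]; rewrite dim0.
apply: ereal_inf_lbound; exists theta; last exact: dim0.
split.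
  exists 1; split=> //; exists x0, mzero; split.
    by apply: finite_borel_radon => //; rewrite /mzero ltry.
  exists 1; split=> // x r r0; rewrite (diam_one_point (X := remetric theta))//.
  by rewrite lee_fin leNgt r0.
split; first by split=> //; exists idfun; split.
have [eb ei ec] := power_gauge (@ltr01 R) (@ltr01 R) (@ltr01 R) (@ltr01 R).
by eexists; split; [exact: eb|exact: ei|exact: ec|move=> x a y /(_ (X1 _ _))].
Qed.

Lemma Q_X_one_point (R : realType) (X : metricType R) (kappa b L : R)
    (U : coverings X kappa b) : 0 < kappa -> 0 < b -> 0 < L ->
  (forall x y : X, x = y) -> Q_X U L = 0%E.
Proof.
move=> kappa0 b0 L0 X1; apply/eqP; rewrite eq_le; apply/andP; split; last first.
  by apply: le_ereal_inf_tmp => _ [p [p0 _] <-]; rewrite lee_fin ltW.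
apply/lee_addgt0Pr => p p0; rewrite add0e; apply: ereal_inf_lbound.
exists p => //; split=> //; apply/(limn_einf_eq0P (fun=> nnsup_ge0 _)).
move=> e k0 e0; exists k0 => //; apply: le_lt_trans (_ : _ <= 0)%E _ => //.
apply: nnsup_le => // _ [n [B [n0 ->]]].
rewrite -[leRHS](_ : (\sum_(A : cells U (n + k0)) 0 `^ p)%:E = _).
  apply: modulus_le => // g [_ [c [_ [s [t [_ _ _ far]]]] _] _]; case: far.
  rewrite /dilate (X1 (c t) (cell_center B)); apply: ballxx.
  by rewrite !mulr_gt0// invr_gt0 exprn_gt0.
by rewrite powR0 ?lt0r_neq0// big1.
Qed.

Theorem theorem3p12 (R : realType) (X : metricType R)
    (X_nonempty : [set: X] !=set0)
    (X_compact : compact [set: X])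
    (X_doubling : doubling X)
    (X_perfect : uniformly_perfect X)
    (kappa b lambda L : R)
    (kappa_gt1 : 1 < kappa) (b_gt1 : 1 < b) (lambda_ge32 : 32 <= lambda)
    (L_ge2 : 2 <= L)
    (U : coverings X kappa b) :
  (uniformly_linearly_connected_components X ->
   uniformly_separated_components X ->
   Q_X U L = Q_N U lambda) /\
  (linearly_connected X ->
   Q_X U L = ahlfors_regular_conformal_dim X).
Proof.
have lambda0 : 0 < lambda by apply: lt_le_trans lambda_ge32.
have L0 : 0 < L by apply: lt_le_trans L_ge2.
have QXN : (Q_X U L <= Q_N U lambda)%E.
  exact: (Q_X_le_Q_N kappa_gt1 b_gt1 U X_doubling lambda_ge32 L_ge2).
split=> [Xl Xs|Xlc].
  apply/le_anti/andP; split; first exact: QXN.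
  exact: (Q_N_le_Q_X kappa_gt1 b_gt1 U X_compact X_doubling Xl Xs
    (ltW lambda0) (ltW L0)).
(* Comparison with the conformal dimension rests on two distinct points, which provide a positive
   scale; for a single point both sides are 0. *)
have [X1|/existsNP[x /existsNP[y /eqP xy]]] := pselect (forall x y : X, x = y).
  rewrite (conformal_dim_one_point X_nonempty X_compact X1).
  by apply: Q_X_one_point X1 => //; exact: lt_trans ltr01 _.
have Xxy : exists x y : X, x != y by exists x, y.
apply/le_anti/andP; split.
  apply: le_trans QXN _.
  exact: (Q_N_le_conformal_dim U kappa_gt1 b_gt1 lambda0 X_compact X_perfect Xxy).
apply: le_ereal_inf_tmp => _ [p [p0 Hp] <-].
exact: (conformal_dim_le kappa_gt1 b_gt1 X_compact X_doubling X_perfect Xxy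
  (linearly_connected_components Xlc) (linearly_connected_separated Xlc)
  (ltW L0) p0 Hp).
Qed.
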